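(* Let $R$ and $B$ be two disjoint finite sets of points in the plane such that no three points of $R\cup B$ are collinear, and let $n=|R|+|B|$. The (possibly empty) set of angular intervals of $\theta\in[0,2\pi)$ for which $\mathcal{RH}_\theta(R)$ is $B$-free (i.e., $\mathcal{RH}_\theta(R)$ is a separator of $R$ and $B$) can be computed in $O(n\log n)$ time and $O(n)$ space.
   Context: Let $\mathcal{O}$ be a fixed set of two orthogonal lines through the origin, and let $\mathcal{O}_\theta$ be the set of lines obtained by rotating both lines of $\mathcal{O}$ counterclockwise around the origin by the angle $\theta$. A quadrant (with respect to $\mathcal{O}_\theta$) with vertex $x\in\mathbb{R}^2$ is one of the four open wedges of size $\pi/2$ into which the plane is cut by the two lines through $x$ parallel to the lines of $\mathcal{O}_\theta$. A region of the plane is $P$-free if no point of $P$ lies in its interior. For a finite point set $P$, the rectilinear convex hull is $\mathcal{RH}_\theta(P)=\mathbb{R}^2\setminus\bigcup_{q\in\mathcal{Q}}q$, where $\mathcal{Q}$ is the set of all $P$-free quadrants of the plane (with respect to $\mathcal{O}_\theta$, with arbitrary vertices). Containment is strict: a blue point (point of $B$) on the boundary of $\mathcal{RH}_\theta(R)$ is not considered contained in it, so $\mathcal{RH}_\theta(R)$ is $B$-free if and only if no point of $B$ lies in its interior. The model of computation is the real RAM, in which standard arithmetic and trigonometric operations take constant time. *)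

(* Defs.v *)
From mathcomp Require Import all_boot all_order all_algebra.
From mathcomp Require Import all_classical all_reals all_analysis.
Import Order.TTheory GRing.Theory Num.Theory numFieldNormedType.Exports.

Set Implicit Arguments.
Unset Strict Implicit.
Unset Printing Implicit Defensive.

Local Open Scope classical_set_scope.
Local Open Scope ring_scope.

Section Plane.
Variable R : realType.
Implicit Types (u v x y : R * R) (theta : R) (P : set (R * R)).

Definition dot u v : R := u.1 * v.1 + u.2 * v.2.

Definition rotate theta v : R * R :=
  (cos theta * v.1 - sin theta * v.2, sin theta * v.1 + cos theta * v.2).

Definition is_line (L : set (R * R)) : Prop :=
  exists a b c : R, (a, b) != (0, 0) /\ L = [set x | a * x.1 + b * x.2 = c].

Definition collinear x y z : Prop :=
  exists L, [/\ is_line L, L x, L y & L z].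

(** A pair of orthogonal lines through the origin is given by a nonzero
    direction vector [u] of one of them: the lines are spanned by [u] and
    [rotate (pi / 2) u].  Each of these two vectors is normal to the line spanned
    by the other, so after rotation by [theta] and translation to [x], the four
    open wedges are selected by the signs of the two scalar products. *)
Definition quadrant u theta (s t : bool) x : set (R * R) :=
  [set y | 0 < (-1) ^+ s * dot (y - x) (rotate theta u) /\
           0 < (-1) ^+ t * dot (y - x) (rotate theta (rotate (pi / 2) u))].

Definition point_free P (A : set (R * R)) : Prop :=
  forall x, P x -> ~ interior A x.

Definition free_quadrants u theta P : set (set (R * R)) :=
  [set q | (exists s t x, q = quadrant u theta s t x) /\ point_free P q].

Definition rect_hull u theta P : set (R * R) :=
  ~` \bigcup_(q in free_quadrants u theta P) q.

Definition separating_angles u (Red Blue : set (R * R)) : set R :=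
  [set theta | 0 <= theta < 2 * pi /\
               point_free Blue (rect_hull u theta Red)].

End Plane.

(** Real RAM.  A program is a finite, input-independent piece of syntax over two
    disjoint kinds of data: integers (also used as addresses) and exact reals.
    There are no real constants besides integers, no rounding, and no conversion
    from reals to integers; reals influence control only through comparisons. *)
Inductive nexp :=
  | NVar of nat
  | NCst of nat
  | NAdd of nexp & nexp
  | NSub of nexp & nexp
  | NMul of nexp & nexp
  | NDiv of nexp & nexp.

Inductive unop := Opp | Recip | Sin | Cos | Tan | Asin | Acos | Atan.

Inductive rexp :=
  | RVar of nat
  | ROfN of nexp
  | RUn of unop & rexp
  | RAdd of rexp & rexp
  | RMul of rexp & rexp.

Inductive bexp :=
  | NLt of nexp & nexp
  | RLt of rexp & rexp
  | BNot of bexp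
  | BAnd of bexp & bexp.

Inductive cmd :=
  | Skip
  | NSet of nat & nexp
  | RSet of nat & rexp
  | NLoad of nat & nat & nexp
  | NStore of nat & nexp & nexp
  | RLoad of nat & nat & nexp
  | RStore of nat & nexp & rexp
  | Seq of cmd & cmd
  | If of bexp & cmd & cmd
  | While of bexp & cmd.

Fixpoint ncost (e : nexp) : nat :=
  match e with
  | NVar _ | NCst _ => 1
  | NAdd e1 e2 | NSub e1 e2 | NMul e1 e2 | NDiv e1 e2 =>
      (ncost e1 + ncost e2).+1
  end.

Fixpoint rcost (e : rexp) : nat :=
  match e with
  | RVar _ => 1
  | ROfN e1 => (ncost e1).+1
  | RUn _ e1 => (rcost e1).+1
  | RAdd e1 e2 | RMul e1 e2 => (rcost e1 + rcost e2).+1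
  end.

Fixpoint bcost (e : bexp) : nat :=
  match e with
  | NLt e1 e2 => (ncost e1 + ncost e2).+1
  | RLt e1 e2 => (rcost e1 + rcost e2).+1
  | BNot e1 => (bcost e1).+1
  | BAnd e1 e2 => (bcost e1 + bcost e2).+1
  end.

Section Semantics.
Variable R : realType.

Record state := State {
  nvar : nat -> nat;
  rvar : nat -> R;
  narr : nat -> nat -> nat;
  rarr : nat -> nat -> R }.

Definition upd (T : Type) (f : nat -> T) (i : nat) (v : T) : nat -> T :=
  fun j => if j == i then v else f j.

Definition set_nvar st x v :=
  State (upd (nvar st) x v) (rvar st) (narr st) (rarr st).
Definition set_rvar st x v :=
  State (nvar st) (upd (rvar st) x v) (narr st) (rarr st).
Definition set_narr st a i v :=
  State (nvar st) (rvar st) (upd (narr st) a (upd (narr st a) i v)) (rarr st).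
Definition set_rarr st a i v :=
  State (nvar st) (rvar st) (narr st) (upd (rarr st) a (upd (rarr st a) i v)).

Fixpoint neval (st : state) (e : nexp) : nat :=
  match e with
  | NVar x => nvar st x
  | NCst k => k
  | NAdd e1 e2 => (neval st e1 + neval st e2)%N
  | NSub e1 e2 => (neval st e1 - neval st e2)%N
  | NMul e1 e2 => (neval st e1 * neval st e2)%N
  | NDiv e1 e2 => (neval st e1 %/ neval st e2)%N
  end.

Definition unop_eval (o : unop) : R -> R :=
  match o with
  | Opp => fun x => - x
  | Recip => fun x => x^-1
  | Sin => sin
  | Cos => cos
  | Tan => tan
  | Asin => asin
  | Acos => acos
  | Atan => atan
  end.

Fixpoint reval (st : state) (e : rexp) : R :=
  match e with
  | RVar x => rvar st x
  | ROfN e1 => (neval st e1)%:R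
  | RUn o e1 => unop_eval o (reval st e1)
  | RAdd e1 e2 => reval st e1 + reval st e2
  | RMul e1 e2 => reval st e1 * reval st e2
  end.

Fixpoint beval (st : state) (e : bexp) : bool :=
  match e with
  | NLt e1 e2 => (neval st e1 < neval st e2)%N
  | RLt e1 e2 => reval st e1 < reval st e2
  | BNot e1 => ~~ beval st e1
  | BAnd e1 e2 => beval st e1 && beval st e2
  end.

(** [exec M c st t st']: from [st], the command [c] terminates in [st'] in time
    [t], every operator, variable access and elementary command costing one unit.
    [M] is the memory bound: each array has only the cells [0, ..., M - 1], and
    the integers stored during the run are at most [M]; a run that violates
    either condition is stuck.  Since a program mentions a constant number of
    variables and arrays, such a run uses O(1 + M) memory cells, whose integers
    fit in words of O(log M) bits, so that no information can be packed into huge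
    integers. *)
Inductive exec (M : nat) : cmd -> state -> nat -> state -> Prop :=
  | exec_skip st : exec M Skip st 1 st
  | exec_nset st x e :
      (neval st e <= M)%N ->
      exec M (NSet x e) st (ncost e).+1 (set_nvar st x (neval st e))
  | exec_rset st x e :
      exec M (RSet x e) st (rcost e).+1 (set_rvar st x (reval st e))
  | exec_nload st x a e :
      (neval st e < M)%N ->
      exec M (NLoad x a e) st (ncost e).+1
        (set_nvar st x (narr st a (neval st e)))
  | exec_nstore st a e1 e2 :
      (neval st e1 < M)%N -> (neval st e2 <= M)%N ->
      exec M (NStore a e1 e2) st (ncost e1 + ncost e2).+1
        (set_narr st a (neval st e1) (neval st e2))
  | exec_rload st x a e :
      (neval st e < M)%N ->
      exec M (RLoad x a e) st (ncost e).+1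
        (set_rvar st x (rarr st a (neval st e)))
  | exec_rstore st a e1 e2 :
      (neval st e1 < M)%N ->
      exec M (RStore a e1 e2) st (ncost e1 + rcost e2).+1
        (set_rarr st a (neval st e1) (reval st e2))
  | exec_seq st st1 st2 c1 c2 t1 t2 :
      exec M c1 st t1 st1 -> exec M c2 st1 t2 st2 ->
      exec M (Seq c1 c2) st (t1 + t2) st2
  | exec_if st st1 b c1 c2 t :
      exec M (if beval st b then c1 else c2) st t st1 ->
      exec M (If b c1 c2) st (bcost b + t).+1 st1
  | exec_while_false st b c :
      ~~ beval st b ->
      exec M (While b c) st (bcost b).+1 st
  | exec_while_true st st1 st2 b c t1 t2 :
      beval st b -> exec M c st t1 st1 -> exec M (While b c) st1 t2 st2 ->
      exec M (While b c) st (bcost b + t1 + t2).+1 st2.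

(** Input convention: integer variables 0 and 1 hold the numbers of red and blue
    points, real variables 0 and 1 the direction vector [u], real arrays 0 and 1
    the coordinates of the red points, real arrays 2 and 3 those of the blue
    points; everything else is zero. *)
Definition input_state (u : R * R) (red blue : seq (R * R)) : state :=
  State
    (nth 0%N [:: size red; size blue])
    (nth 0 [:: u.1; u.2])
    (fun _ _ => 0%N)
    (fun a i => nth 0 [:: (nth 0 red i).1; (nth 0 red i).2;
                          (nth 0 blue i).1; (nth 0 blue i).2] a).

(** Output convention: integer variable 0 holds the number of intervals; real
    arrays 0 and 1 hold their left and right endpoints, and integer arrays 0 and
    1 tell whether the left, respectively right, endpoint belongs to the interval
    (nonzero) or not (zero). *)
Definition output_size (st : state) : nat := nvar st 0%N.

Definition output_interval (st : state) (i : nat) : set R :=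
  [set theta | (rarr st 0%N i < theta ?<= if (narr st 0%N i != 0%N)) &&
               (theta < rarr st 1%N i ?<= if (narr st 1%N i != 0%N))].

(** The intervals are the maximal ones, i.e. the connected components of [A],
    each listed once. *)
Definition outputs_intervals (st : state) (A : set R) : Prop :=
  [/\ A = \bigcup_(i < output_size st) output_interval st i,
      forall i, (i < output_size st)%N ->
        exists2 theta, A theta &
          output_interval st i = connected_component A theta
    & trivIset `I_(output_size st) (output_interval st)].

End Semantics.

(* Main.v *)
(** A blue point [b] is interior to the rectilinear hull of the red points
    iff each of the four open quadrants at [b] contains a red point. For
    [theta] in (0, pi / 2], the [k]-th quadrant at [b] lies between the
    angles [theta - pi / 2] and [theta] measured from an axis direction
    [d_k]. It is therefore free of red points iff [pi / 2 - rho <= theta <=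
    lambda], where [rho] and [lambda] are the angles, at most [pi / 2], from
    [d_k] to the first red point clockwise and counterclockwise.

    Such an angle is given by the tangent from [b] to the convex hull of the
    red points on one side of [b]. When the points are swept in
    lexicographic order, this hull is a stack (as in Graham's scan), and a
    binary search on the stack finds the tangent in logarithmic time; four
    rotations of the axes and two orientations give all the angles [rho] and
    [lambda].

    Modulo [pi / 2], the angles forbidden by [b] form at most four open gaps
    between the intervals [pi / 2 - rho, lambda]. Six translates of each gap
    cover [0, 2 pi). After sorting these 24 |B| open intervals by their left
    end points, one sweep lists the components of the complement of their
    union. *)

Require Import Defs.
From mathcomp Require Import all_boot all_order all_algebra.
From mathcomp Require Import all_classical all_reals all_analysis.
From mathcomp Require Import zify ring lra.
Import Order.TTheory GRing.Theory Num.Theory numFieldNormedType.Exports.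

Set Implicit Arguments.
Unset Strict Implicit.
Unset Printing Implicit Defensive.

Local Open Scope classical_set_scope.
Local Open Scope ring_scope.

(** The delicate point is the treatment of ties. A quarter turn only permutes the four wedges, so
    angles are reduced to the half-open period (0, pi / 2], on which sin > 0 and cos >= 0. A red
    point exactly on an axis direction blocks every angle of the period except pi / 2; the
    lexicographic order counts it on one side only, as a point with [rho = 0], which gives precisely
    this. At the seam the free intervals must fit together: if pi / 2 is blocked, so are the angles
    just after 0. The lexicographic order also makes all differences met in a sweep
    lexicographically positive. Finitely many of them lie in one open half-plane, where the sign of
    a determinant is a transitive comparison, vertical differences included. To look only at points
    after the viewpoint, [lambda] in direction [k] is computed in the opposite frame [k + 2]. The
    shifts of a gap are -2, ..., 3 quarter turns: [0, 2 pi) meets five periods, because 0 is the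
    right end of the period before it, and a gap may start one period earlier than the angle it
    contains. *)

Notation "c1 ;; c2" := (Seq c1 c2) (at level 90, right associativity).

(** * Total correctness with time bounds *)

Section Logic.
Variable R : realType.
Implicit Types (st : state R) (Q : state R -> Prop) (c : cmd) (M k : nat).

(** Stuck and divergent runs have no derivation in [exec], so memory safety, termination, the
    postcondition and the bound are proved together. Since [k] is only an upper bound, both branches
    of a test can share one budget. *)
Definition runs M c st k Q :=
  exists t st', [/\ exec M c st t st', (t <= k)%N & Q st'].

Lemma runs_weaken M c st k1 k2 Q1 Q2 :
  runs M c st k1 Q1 -> (k1 <= k2)%N -> (forall st', Q1 st' -> Q2 st') ->
  runs M c st k2 Q2.
Proof.
move=> [t [st' [e le1 q]]] le12 Q12.
by exists t, st'; split=> //; [exact: leq_trans le12 | exact: Q12].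
Qed.

Lemma runs_leq M c st k1 k2 Q :
  runs M c st k1 Q -> (k1 <= k2)%N -> runs M c st k2 Q.
Proof. by move=> run le; exact: runs_weaken run le (fun _ => id). Qed.

Lemma runs_seq M c1 c2 st k1 k2 Q :
  runs M c1 st k1 (fun st1 => runs M c2 st1 k2 Q) ->
  runs M (c1 ;; c2) st (k1 + k2) Q.
Proof.
move=> [t1 [st1 [e1 le1 [t2 [st2 [e2 le2 q]]]]]].
by exists (t1 + t2)%N, st2; split=> //; [exact: exec_seq e1 e2 | exact:
  leq_add].
Qed.

Lemma runs_if M b c1 c2 st k Q :
  (beval st b -> runs M c1 st k Q) -> (~~ beval st b -> runs M c2 st k Q) ->
  runs M (If b c1 c2) st (bcost b + k).+1 Q.
Proof.
move=> h1 h2; have [t [st' [e le q]]] : runs M (if beval st b then c1 else c2)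
  st k Q.
  by case: ifPn => hb; [exact: h1 | exact: h2].
exists (bcost b + t).+1, st'; split=> //; first exact: exec_if.
by rewrite ltnS leq_add2l.
Qed.

(** The value 0 for a loop is a dummy: [ccost] bounds the time only of commands with a provable
    [wp], and these contain no reachable loop. *)
Fixpoint ccost c : nat :=
  match c with
  | Skip => 1
  | NSet _ e => (ncost e).+1
  | RSet _ e => (rcost e).+1
  | NLoad _ _ e => (ncost e).+1
  | NStore _ e1 e2 => (ncost e1 + ncost e2).+1
  | RLoad _ _ e => (ncost e).+1
  | RStore _ e1 e2 => (ncost e1 + rcost e2).+1
  | Seq c1 c2 => ccost c1 + ccost c2
  | If b c1 c2 => (bcost b + maxn (ccost c1) (ccost c2)).+1
  | While _ _ => 0
  end.

(* Loops are deliberately given the weakest precondition [False]; they are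
   handled by [runs_while]. *)
Fixpoint wp M c Q st : Prop :=
  match c with
  | Skip => Q st
  | NSet x e => (neval st e <= M)%N /\ Q (set_nvar st x (neval st e))
  | RSet x e => Q (set_rvar st x (reval st e))
  | NLoad x a e =>
      (neval st e < M)%N /\ Q (set_nvar st x (narr st a (neval st e)))
  | NStore a e1 e2 =>
      ((neval st e1 < M)%N /\ (neval st e2 <= M)%N) /\
      Q (set_narr st a (neval st e1) (neval st e2))
  | RLoad x a e =>
      (neval st e < M)%N /\ Q (set_rvar st x (rarr st a (neval st e)))
  | RStore a e1 e2 =>
      (neval st e1 < M)%N /\ Q (set_rarr st a (neval st e1) (reval st e2))
  | Seq c1 c2 => wp M c1 (wp M c2 Q) st
  | If b c1 c2 => if beval st b then wp M c1 Q st else wp M c2 Q st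
  | While _ _ => False
  end.

Lemma runs_wp M c st Q : wp M c Q st -> runs M c st (ccost c) Q.
Proof.
elim: c Q st => /=
  [|x e|x e|x a e|a e1 e2|x a e|a e1 e2|c1 IH1 c2 IH2|b c1 IH1 c2 IH2|b c _]
  Q st.
- by move=> q; exists 1%N, st; split=> //; exact: exec_skip.
- by move=> [l q]; eexists _, _; split; [exact: exec_nset | | exact: q].
- by move=> q; eexists _, _; split; [exact: exec_rset | | exact: q].
- by move=> [l q]; eexists _, _; split; [exact: exec_nload | | exact: q].
- by move=> [[l l'] q]; eexists _, _; split; [exact: exec_nstore | | exact: q].
- by move=> [l q]; eexists _, _; split; [exact: exec_rload | | exact: q].
- by move=> [l q]; eexists _, _; split; [exact: exec_rstore | | exact: q].
- move=> /IH1 h; apply: runs_seq; apply: (runs_weaken h) => // st'.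
  exact: IH2.
- case hb : (beval st b) => h; apply: runs_if; rewrite hb //= => _.
  + by apply: (runs_weaken (IH1 _ _ h)) => //; exact: leq_maxl.
  + by apply: (runs_weaken (IH2 _ _ h)) => //; exact: leq_maxr.
- by [].
Qed.

Lemma runs_wp_seq M c1 c2 st k Q : wp M c1 (fun st1 => runs M c2 st1 k Q) st ->
  runs M (c1 ;; c2) st (ccost c1 + k) Q.
Proof. by move=> h; apply: runs_seq; exact: runs_wp. Qed.

Fixpoint nvar_writes c : seq nat :=
  match c with
  | NSet x _ | NLoad x _ _ => [:: x]
  | Seq c1 c2 | If _ c1 c2 => nvar_writes c1 ++ nvar_writes c2
  | While _ c1 => nvar_writes c1
  | _ => [::]
  end.

Fixpoint rvar_writes c : seq nat :=
  match c with
  | RSet x _ | RLoad x _ _ => [:: x]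
  | Seq c1 c2 | If _ c1 c2 => rvar_writes c1 ++ rvar_writes c2
  | While _ c1 => rvar_writes c1
  | _ => [::]
  end.

Fixpoint narr_writes c : seq nat :=
  match c with
  | NStore a _ _ => [:: a]
  | Seq c1 c2 | If _ c1 c2 => narr_writes c1 ++ narr_writes c2
  | While _ c1 => narr_writes c1
  | _ => [::]
  end.

Fixpoint rarr_writes c : seq nat :=
  match c with
  | RStore a _ _ => [:: a]
  | Seq c1 c2 | If _ c1 c2 => rarr_writes c1 ++ rarr_writes c2
  | While _ c1 => rarr_writes c1
  | _ => [::]
  end.

(** The write sets are computed from the syntax, so what a subroutine leaves alone is settled by
    evaluation, and loop invariants mention only what changes. *)
Definition frame c st st' :=
  [/\ forall x, x \notin nvar_writes c -> nvar st' x = nvar st x,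
      forall x, x \notin rvar_writes c -> rvar st' x = rvar st x,
      forall a, a \notin narr_writes c -> narr st' a = narr st a
    & forall a, a \notin rarr_writes c -> rarr st' a = rarr st a].

Lemma frame_trans c st1 st2 st3 :
  frame c st1 st2 -> frame c st2 st3 -> frame c st1 st3.
Proof.
by move=> [a1 a2 a3 a4] [b1 b2 b3 b4]; split=> x hx;
  rewrite ?b1 ?a1 ?b2 ?a2 ?b3 ?a3 ?b4 ?a4.
Qed.

Lemma frame_widen c c' st st' :
  {subset nvar_writes c <= nvar_writes c'} ->
  {subset rvar_writes c <= rvar_writes c'} ->
  {subset narr_writes c <= narr_writes c'} ->
  {subset rarr_writes c <= rarr_writes c'} ->
  frame c st st' -> frame c' st st'.
Proof.
move=> s1 s2 s3 s4 [h1 h2 h3 h4]; split=> x hx.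
- by apply: h1; apply: contra hx; exact: s1.
- by apply: h2; apply: contra hx; exact: s2.
- by apply: h3; apply: contra hx; exact: s3.
- by apply: h4; apply: contra hx; exact: s4.
Qed.

Lemma exec_frame M c st t st' : exec M c st t st' -> frame c st st'.
Proof.
elim=> {c st t st'} /=.
- by [].
- by move=> st x e _; split=> //= y; rewrite inE /upd => /negPf->.
- by move=> st x e; split=> //= y; rewrite inE /upd => /negPf->.
- by move=> st x a e _; split=> //= y; rewrite inE /upd => /negPf->.
- by move=> st a e1 e2 _ _; split=> //= y; rewrite inE /upd => /negPf->.
- by move=> st x a e _; split=> //= y; rewrite inE /upd => /negPf->.
- by move=> st a e1 e2 _; split=> //= y; rewrite inE /upd => /negPf->.
- move=> st st1 st2 c1 c2 t1 t2 _ h1 _ h2.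
  apply: (@frame_trans _ _ st1).
  + by apply: frame_widen h1 => x /= hx; rewrite mem_cat hx.
  + by apply: frame_widen h2 => x /= hx; rewrite mem_cat hx orbT.
- move=> st st1 b c1 c2 t _ h; case: (beval st b) h => h;
  by apply: frame_widen h => x /= hx; rewrite mem_cat hx ?orbT.
- by [].
- move=> st st1 st2 b c t1 t2 _ _ h1 _ h2.
  exact: frame_trans h1 h2.
Qed.

Lemma runs_frame M c st k Q :
  runs M c st k Q -> runs M c st k (fun st' => frame c st st' /\ Q st').
Proof.
move=> [t [st' [e le q]]]; exists t, st'; split=> //; split=> //.
exact: exec_frame e.
Qed.

(* [f] bounds the cost of the remaining iterations, hence also serves as the
   termination measure. *)
Lemma runs_while M b c (I : nat -> state R -> Prop) f st0 Q :
  I f st0 ->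
  (forall f st, frame c st0 st -> I f st -> beval st b ->
     exists k, runs M c st k (fun st' =>
       exists2 f', (k + bcost b + f' < f)%N & I f' st')) ->
  (forall f st, frame c st0 st -> ~~ beval st b -> I f st -> Q st) ->
  runs M (While b c) st0 (f + bcost b).+1 Q.
Proof.
move=> I0 step post.
suff main n g st : (g <= n)%N -> frame c st0 st -> I g st ->
    runs M (While b c) st (g + bcost b).+1 Q.
  exact: (main f f).
have stop g1 st1 : frame c st0 st1 -> I g1 st1 -> ~~ beval st1 b ->
    runs M (While b c) st1 (g1 + bcost b).+1 Q.
  move=> fr Ig hb; exists (bcost b).+1, st1; split.
  - exact: exec_while_false.
  - by rewrite ltnS leq_addl.
  - exact: post Ig.
elim: n g st => [|n IH] g st gn fr Ig; case hb : (beval st b);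
  try by apply: stop => //; rewrite hb.
  have [k [t [st' [_ _ [f' lt _]]]]] := step _ _ fr Ig hb.
  by move: gn lt; rewrite leqn0 => /eqP->.
have [k [t [st' [e le [f' lt If']]]]] := step _ _ fr Ig hb.
have [||t2 [st2 [e2 le2 q2]]] := IH f' st' _ _ If'.
- by move: lt gn; lia.
- exact: frame_trans fr (exec_frame e).
exists (bcost b + t + t2).+1, st2; split=> //.
  exact: exec_while_true hb e e2.
by move: le le2 lt; lia.
Qed.

(** A round costs [k] for the body, [ncost e + 2] for the test and 1 for the loop; the successor of
    [N] pays for the last, failing test. The bound [e] is evaluated anew in each round, so its value
    has to be invariant. *)
Lemma runs_for M x e c N k (I : nat -> state R -> Prop) st0 Q :
  (nvar st0 x <= N)%N -> I (nvar st0 x) st0 ->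
  (forall i st, frame c st0 st -> nvar st x = i -> I i st ->
     neval st e = N /\ ((i < N)%N ->
     runs M c st k (fun st' => nvar st' x = i.+1 /\ I i.+1 st'))) ->
  (forall st, frame c st0 st -> nvar st x = N -> I N st -> Q st) ->
  runs M (While (NLt (NVar x) e) c) st0 ((k + ncost e + 3) * N.+1) Q.
Proof.
move=> le0 I0 step post; pose d := (k + ncost e + 3)%N.
apply: (@runs_leq _ _ _ (d * (N - nvar st0 x) + bcost (NLt (NVar x) e)).+1);
  [ | by rewrite /d /=; nia].
apply: (@runs_while _ _ _ (fun f st => [/\ f = (d * (N - nvar st x))%N,
  (nvar st x <= N)%N & I (nvar st x) st])) => //.
- move=> f st fr [-> le If] /= lt.
  have [eN run] := step _ _ fr erefl If; rewrite eN in lt.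
  exists k; apply: (runs_weaken (run lt)) => // st' [ex I'].
  exists (d * (N - nvar st' x))%N; last by rewrite ex.
  by rewrite ex /d (_ : N - nvar st x = (N - (nvar st x).+1).+1)%N ?mulnS; lia.
- move=> f st fr /= nb [ef lex If].
  have [eN _] := step _ _ fr erefl If.
  have exN : nvar st x = N.
    by apply/eqP; rewrite eqn_leq lex /= leqNgt -eN.
  by apply: post; rewrite // -exN.
Qed.

End Logic.

Ltac closed_nat n :=
  lazymatch n with O => idtac | S ?m => closed_nat m end.

(** Updates are resolved only at literal numbers, that is, at variables and array names; symbolic
    cells keep their [upd], which avoids a case split at every read. *)
Ltac upd_simpl :=
  cbn [nvar rvar narr rarr set_nvar set_rvar set_narr set_rarr
       neval reval beval unop_eval];
  repeat match goal with
  | |- context [@upd ?T ?f ?i ?v ?j] =>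
      closed_nat i; closed_nat j;
      let b := eval vm_compute in (eqn j i) in
      lazymatch b with
      | true => change (@upd T f i v j) with v
      | false => change (@upd T f i v j) with (f j)
      end
  end.

Ltac wp_step :=
  lazymatch goal with
  | |- wp ?M (Seq ?a ?b) ?Q ?st => change (wp M a (wp M b Q) st)
  | |- wp ?M (NSet ?x ?e) ?Q ?st =>
      change ((neval st e <= M)%N /\ Q (set_nvar st x (neval st e)));
      split; [upd_simpl; try solve [lia] | upd_simpl]
  | |- wp ?M (RSet ?x ?e) ?Q ?st =>
      change (Q (set_rvar st x (reval st e))); upd_simpl
  | |- wp ?M (NLoad ?x ?a ?e) ?Q ?st =>
      change ((neval st e < M)%N /\
              Q (set_nvar st x (narr st a (neval st e))));
      split; [upd_simpl; try solve [lia] | upd_simpl]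
  | |- wp ?M (NStore ?a ?e1 ?e2) ?Q ?st =>
      change (((neval st e1 < M)%N /\ (neval st e2 <= M)%N) /\
              Q (set_narr st a (neval st e1) (neval st e2)));
      split; [split; upd_simpl; try solve [lia] | upd_simpl]
  | |- wp ?M (RLoad ?x ?a ?e) ?Q ?st =>
      change ((neval st e < M)%N /\
              Q (set_rvar st x (rarr st a (neval st e))));
      split; [upd_simpl; try solve [lia] | upd_simpl]
  | |- wp ?M (RStore ?a ?e1 ?e2) ?Q ?st =>
      change ((neval st e1 < M)%N /\
              Q (set_rarr st a (neval st e1) (reval st e2)));
      split; [upd_simpl; try solve [lia] | upd_simpl]
  | |- wp ?M (If ?b ?c1 ?c2) ?Q ?st =>
      change (if beval st b then wp M c1 Q st else wp M c2 Q st); upd_simpl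
  | |- wp ?M Skip ?Q ?st => change (Q st)
  | |- wp ?M ?c ?Q ?st =>
      let c' := eval hnf in c in change (wp M c' Q st)
  end.

Ltac wp_steps := upd_simpl; repeat wp_step.

(** * Bottom-up merge sort *)

Section Merge.
Local Open Scope nat_scope.
Variables (le : rel nat).
Hypotheses (le_refl : reflexive le) (le_trans : transitive le).
Implicit Types (a b : nat -> nat) (N w v : nat).

(** Arrays are functions on all of [nat]; counting values is a form of multiset equality that is
    additive when a segment is split. *)
Definition occurrences a v m n := \sum_(m <= i < n) (a i == v).

Definition block_sorted a N w := forall e i j,
  e * w <= i -> i <= j -> j < e * w + w -> j < N -> le (a i) (a j).

(* The runs [e * (2 * w), pe) and [pe, qe) of [a] are being merged into [b]:
   [t] cells of [b] have been written; [p] and [q] are the reading positions. *)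
Record merging a N w b t p pe q qe : Prop := Merging {
  merging_block : exists e, [/\ e * (2 * w) <= p, p <= pe,
    pe = minn (e * (2 * w) + w) N, qe = minn (e * (2 * w) + 2 * w) N
    & forall i, e * (2 * w) <= i < t ->
      (forall j, p <= j < pe -> le (b i) (a j)) /\
      (forall j, q <= j < qe -> le (b i) (a j))];
  merging_right : pe <= q <= qe;
  merging_pos : t = p + (q - pe);
  merging_count : forall v,
    occurrences b v 0 t = occurrences a v 0 p + occurrences a v pe q;
  merging_sorted : forall e i j, e * (2 * w) <= i -> i <= j ->
    j < e * (2 * w) + 2 * w -> j < t -> le (b i) (b j) }.

Lemma occurrences_upd b v t x :
  occurrences (upd b t x) v 0 t.+1 = occurrences b v 0 t + (x == v).
Proof.
rewrite /occurrences big_nat_recr //=; congr (_ + _); last by rewrite /upd eqxx.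
by apply: eq_big_nat => i /andP[_ it]; rewrite /upd (ltn_eqF it).
Qed.

Lemma occurrencesS a v m n : m <= n ->
  occurrences a v m n.+1 = occurrences a v m n + (a n == v).
Proof. by move=> mn; rewrite /occurrences big_nat_recr. Qed.

Lemma merging_start a N w b : merging a N w b 0 0 (minn w N) (minn w N) (minn
  (2 * w) N).
Proof.
split=> //; try lia; first by exists 0; split=> //; lia.
by move=> v; rewrite /occurrences !big_geq.
Qed.

(** From [qe <= t] both runs are exhausted, and from [t < N] the block was not cut off by [N]; hence
    [t] is exactly the start of block [e.+1]. *)
Lemma merging_reset a N w b t p pe q qe : 0 < w -> t < N -> qe <= t ->
  merging a N w b t p pe q qe ->
  merging a N w b t t (minn (t + w) N) (minn (t + w) N) (minn (t + 2 * w) N).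
Proof.
move=> w0 tN qet [[e [h1 h2 h3 h4 h5]] h6 h7 h8 h9].
have epe : p = pe by lia.
have eqe : q = qe by lia.
have et : t = qe by lia.
have te : t = e.+1 * (2 * w) by rewrite mulSn; lia.
split=> //.
- exists e.+1; rewrite -te; split=> //; try lia.
- lia.
- lia.
- move=> v; rewrite h8 /occurrences [in RHS](big_geq (leqnn _)) addn0.
  by rewrite epe eqe -big_cat_nat -?et //=; lia.
Qed.

Lemma merging_left a N w b t p pe q qe : block_sorted a N w ->
  p < pe -> (q < qe -> le (a p) (a q)) ->
  merging a N w b t p pe q qe ->
  merging a N w (upd b t (a p)) t.+1 p.+1 pe q qe.
Proof.
move=> sa ppe lpq [[e [h1 h2 h3 h4 h5]] h6 h7 h8 h9].
have ue i : i < t -> upd b t (a p) i = b i by move=> it;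
  rewrite /upd (ltn_eqF it).
have ut : upd b t (a p) t = a p by rewrite /upd eqxx.
have ap j : p <= j < pe -> le (a p) (a j).
  by move=> /andP[pj jp]; apply: (sa (2 * e)); rewrite ?(mulnC 2 e) -?mulnA;
    lia.
have aq j : q <= j < qe -> le (a p) (a j).
  move=> /andP[qj jq]; apply: (le_trans (lpq _)); first lia.
  have e2 : (2 * e).+1 * w = e * (2 * w) + w.
    by rewrite mulSn (mulnC 2 e) -mulnA addnC.
  by apply: (sa (2 * e).+1); rewrite ?e2; lia.
split=> //; last 3 first.
- lia.
- by move=> v; rewrite occurrences_upd h8 occurrencesS //; lia.
- move=> e' i j ei ij je jt; have [jt'|tj] := ltnP j t.
    by rewrite !ue //; [exact: (h9 e') | lia].
  have -> : j = t by lia.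
  have [it|ti] := ltnP i t; last by rewrite (_ : i = t) //; lia.
  rewrite ut ue //.
  (* The position [t] lies in block [e], which is being merged, and in block [e']; blocks of length
     [2 * w] are disjoint. *)
  have ee : e = e'.
    have : e * (2 * w) < e' * (2 * w) + 2 * w by lia.
    have : e' * (2 * w) < e * (2 * w) + 2 * w by lia.
    by rewrite -!mulSnr !ltn_mul2r; lia.
  by apply: (h5 _ _).1; rewrite ?ee ?ei ?it //; lia.
- exists e; split=> //; first lia.
  move=> i /andP[ei it]; have [it'|ti] := ltnP i t.
    rewrite ue //; have [|k1 k2] := h5 i; first by rewrite ei.
    by split=> j hj; [apply: k1 | apply: k2]; lia.
  rewrite (_ : i = t) ?ut; last lia.
  by split=> j hj; [apply: ap | apply: aq]; lia.
Qed.

Lemma merging_right_step a N w b t p pe q qe : block_sorted a N w ->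
  q < qe -> (p < pe -> le (a q) (a p)) ->
  merging a N w b t p pe q qe ->
  merging a N w (upd b t (a q)) t.+1 p pe q.+1 qe.
Proof.
move=> sa qqe lqp [[e [h1 h2 h3 h4 h5]] h6 h7 h8 h9].
have ue i : i < t -> upd b t (a q) i = b i by move=> it;
  rewrite /upd (ltn_eqF it).
have ut : upd b t (a q) t = a q by rewrite /upd eqxx.
have ap j : p <= j < pe -> le (a q) (a j).
  move=> /andP[pj jp]; apply: (le_trans (lqp _)); first lia.
  by apply: (sa (2 * e)); rewrite ?(mulnC 2 e) -?mulnA; lia.
have aq j : q <= j < qe -> le (a q) (a j).
  move=> /andP[qj jq].
  have e2 : (2 * e).+1 * w = e * (2 * w) + w.
    by rewrite mulSn (mulnC 2 e) -mulnA addnC.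
  by apply: (sa (2 * e).+1); rewrite ?e2; lia.
split=> //; last 3 first.
- lia.
- move=> v; rewrite occurrences_upd h8 (occurrencesS _ _ (n := q)); last lia.
  by rewrite addnA.
- move=> e' i j ei ij je jt; have [jt'|tj] := ltnP j t.
    by rewrite !ue //; [exact: (h9 e') | lia].
  have -> : j = t by lia.
  have [it|ti] := ltnP i t; last by rewrite (_ : i = t) //; lia.
  rewrite ut ue //.
  have ee : e = e'.
    have : e * (2 * w) < e' * (2 * w) + 2 * w by lia.
    have : e' * (2 * w) < e * (2 * w) + 2 * w by lia.
    by rewrite -!mulSnr !ltn_mul2r; lia.
  by apply: (h5 _ _).2; rewrite ?ee ?ei ?it //; lia.
- exists e; split=> //.
  move=> i /andP[ei it]; have [it'|ti] := ltnP i t.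
    rewrite ue //; have [|k1 k2] := h5 i; first by rewrite ei.
    by split=> j hj; [apply: k1 | apply: k2]; lia.
  rewrite (_ : i = t) ?ut; last lia.
  by split=> j hj; [apply: ap | apply: aq]; lia.
- lia.
Qed.

Lemma merging_end a N w b p pe q qe : merging a N w b N p pe q qe ->
  block_sorted b N (2 * w) /\
  forall v, occurrences b v 0 N = occurrences a v 0 N.
Proof.
move=> [[e [h1 h2 h3 h4 h5]] h6 h7 h8 h9]; split=> //.
move=> v; rewrite h8.
have epe : p = pe by lia.
have eqe : q = N by lia.
by rewrite /occurrences epe eqe -big_cat_nat //; lia.
Qed.

Definition enumerates a N :=
  [/\ forall i, i < N -> a i < N, forall v, v < N -> exists2 i, i < N & a i = v
    & forall i j, i < N -> j < N -> a i = a j -> i = j].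

Lemma occurrences_enumerates a N :
  (forall v, occurrences a v 0 N = (v < N)) -> enumerates a N.
Proof.
move=> h; have pos i : i < N -> 0 < occurrences a (a i) 0 N.
  move=> iN; rewrite /occurrences (big_cat_nat (n := i)) //=; last exact: ltnW.
  by rewrite (big_ltn iN) eqxx addnC ltn_addr.
split.
- by move=> i iN; have := pos i iN; rewrite h lt0b.
- move=> v vN; have := h v; rewrite vN => hv.
  apply: contrapT => nx; suff: occurrences a v 0 N = 0 by rewrite hv.
  rewrite /occurrences big_nat big1 // => i /andP[_ iN].
  by apply/eqP; rewrite eqb0; apply/eqP => ai; apply: nx; exists i.
- move=> i j; wlog ij : i j / i < j.
    move=> H iN jN aij; have [ij|ji|//] := ltngtP i j; first exact: H.
    by apply/esym; apply: H.
  move=> iN jN aij; have := h (a j); rewrite /occurrences.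
  rewrite (big_cat_nat (n := i)) //=; last exact: ltnW.
  rewrite (big_ltn iN) (big_cat_nat (n := j) (p := N)) //=; last exact: ltnW.
  rewrite (big_ltn jN) aij eqxx.
  by case: (a j < N); lia.
Qed.

End Merge.

(* Different phases of the program reuse the same variables and arrays under
   different names. *)
Notation v_red := 0%N (only parsing).
Notation v_blue := 1%N (only parsing).
Notation v_size := 2%N (only parsing).
Notation v_i := 3%N (only parsing).
Notation v_w := 5%N (only parsing).
Notation v_t := 6%N (only parsing).
Notation v_p := 7%N (only parsing).
Notation v_pe := 8%N (only parsing).
Notation v_q := 9%N (only parsing).
Notation v_qe := 10%N (only parsing).
Notation v_right := 11%N (only parsing).
Notation v_x := 12%N (only parsing).
Notation v_y := 13%N (only parsing).

Notation a_key1 := 4%N (only parsing).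
Notation a_key2 := 5%N (only parsing).
Notation a_order := 2%N (only parsing).
Notation a_buffer := 3%N (only parsing).

Definition incr x := NSet x (NAdd (NVar x) (NCst 1)).
Notation nmin e1 e2 := (NSub e1 (NSub e1 e2)).

Definition rvar_lex_lt x1 x2 y1 y2 : bexp :=
  BNot (BAnd (BNot (RLt (RVar x1) (RVar y1)))
    (BNot (BAnd (BNot (RLt (RVar y1) (RVar x1))) (RLt (RVar x2) (RVar y2))))).

Definition merge_reset : cmd :=
  NSet v_p (NVar v_t) ;;
  NSet v_pe (nmin (NAdd (NVar v_t) (NVar v_w)) (NVar v_size)) ;;
  NSet v_q (NVar v_pe) ;;
  NSet v_qe (nmin (NAdd (NVar v_t) (NMul (NCst 2) (NVar v_w))) (NVar v_size)).

Definition merge_choose : cmd :=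
  NSet v_right (NCst 0) ;;
  If (NLt (NVar v_p) (NVar v_pe))
    (If (NLt (NVar v_q) (NVar v_qe))
      (NLoad v_x a_order (NVar v_p) ;;
       NLoad v_y a_order (NVar v_q) ;;
       RLoad 2 a_key1 (NVar v_x) ;; RLoad 3 a_key2 (NVar v_x) ;;
       RLoad 4 a_key1 (NVar v_y) ;; RLoad 5 a_key2 (NVar v_y) ;;
       If (rvar_lex_lt 4 5 2 3) (NSet v_right (NCst 1)) Skip)
      Skip)
    (NSet v_right (NCst 1)).

Definition merge_emit : cmd :=
  If (NLt (NCst 0) (NVar v_right))
    (NLoad v_x a_order (NVar v_q) ;; incr v_q)
    (NLoad v_x a_order (NVar v_p) ;; incr v_p) ;;
  NStore a_buffer (NVar v_t) (NVar v_x) ;;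
  incr v_t.

(** A pass is one flat loop in which every round writes exactly one cell; the next pair of runs is
    entered on the fly. A pass is thus a counted loop with constant cost per round. *)
Definition merge_step : cmd :=
  If (NLt (NVar v_t) (NVar v_qe)) Skip merge_reset ;;
  merge_choose ;; merge_emit.

Definition merge_pass : cmd :=
  NSet v_t (NCst 0) ;; merge_reset ;;
  While (NLt (NVar v_t) (NVar v_size)) merge_step.

Definition copy_back : cmd :=
  NSet v_i (NCst 0) ;;
  While (NLt (NVar v_i) (NVar v_size))
    (NLoad v_x a_buffer (NVar v_i) ;;
     NStore a_order (NVar v_i) (NVar v_x) ;;
     incr v_i).

Definition fill_order : cmd :=
  NSet v_i (NCst 0) ;;
  While (NLt (NVar v_i) (NVar v_size))
    (NStore a_order (NVar v_i) (NVar v_i) ;; incr v_i).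

(** Indices are sorted while the keys stay in place. The number of a point thus survives the
    re-sorting in each frame, and comparing it with the number of red points tells its colour. *)
Definition merge_sort : cmd :=
  fill_order ;;
  NSet v_w (NCst 1) ;;
  While (NLt (NVar v_w) (NVar v_size))
    (merge_pass ;; copy_back ;; NSet v_w (NMul (NCst 2) (NVar v_w))).

(** * The lexicographic order of the plane *)

Section LexicographicOrder.
Variable R : realType.
Implicit Types u v w : R * R.

Definition lex_pos v : bool := (0 < v.1) || (v.1 == 0) && (0 < v.2).

Definition lex_le u v : bool := ~~ lex_pos (u - v).

Lemma lex_posD u v : lex_pos u -> lex_pos v -> lex_pos (u + v).
Proof.
rewrite /lex_pos /= => /orP[u1|/andP[/eqP u1 u2]] /orP[v1|/andP[/eqP v1 v2]].
- by apply/orP; left; lra.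
- by apply/orP; left; lra.
- by apply/orP; left; lra.
- by apply/orP; right; apply/andP; split; [apply/eqP|]; lra.
Qed.

Lemma lex_pos_opp v : lex_pos v -> ~~ lex_pos (- v).
Proof.
rewrite /lex_pos /= => /orP[v1|/andP[/eqP v1 v2]]; apply/negP;
  move=> /orP[w1|/andP[/eqP w1 w2]]; lra.
Qed.

Lemma lex_pos_total v : v != 0 -> ~~ lex_pos v -> lex_pos (- v).
Proof.
move=> v0; rewrite /lex_pos /= negb_or negb_and -!leNgt => /andP[v1 v2].
have [w1|w1] := ltP 0 (- v.1); first by [].
have v10 : v.1 = 0 by lra.
rewrite v10 oppr0 eqxx /=; move: v2; rewrite v10 eqxx /= => v2.
rewrite oppr_gt0 lt_neqAle v2 andbT; apply: contraNN v0 => /eqP v20.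
by apply/eqP; rewrite [v]surjective_pairing v10 v20.
Qed.

Lemma lex_pos_le u v : lex_pos (u - v) -> lex_le v u.
Proof. by move=> /lex_pos_opp; rewrite opprB. Qed.

Lemma lex_le_refl : reflexive lex_le.
Proof. by move=> v; rewrite /lex_le subrr /lex_pos /= ltxx eqxx. Qed.

Lemma lex_le_trans : transitive lex_le.
Proof.
move=> v u w uv vw; apply/negP => uw.
have [e|d] := eqVneq (u - v) 0.
  by move: vw; rewrite /lex_le (_ : v = u) ?uw //; apply/eqP;
    rewrite eq_sym -subr_eq0 e.
have vu := lex_pos_total d uv; move/negP: vw; apply.
by rewrite -(subrKA u) addrC -(opprB u) addrC lex_posD.
Qed.

End LexicographicOrder.

(** * Correctness and cost of the merge sort *)

Section MergeSortCorrect.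
Variable R : realType.
Implicit Types (st : state R) (M : nat).

Definition key st i : R * R := (rarr st a_key1 i, rarr st a_key2 i).

Definition key_le (kappa : nat -> R * R) : rel nat :=
  fun i j => lex_le (kappa i) (kappa j).

Lemma key_le_refl kappa : reflexive (key_le kappa).
Proof. by move=> i; exact: lex_le_refl. Qed.

Lemma key_le_trans kappa : transitive (key_le kappa).
Proof. by move=> j i k; exact: lex_le_trans. Qed.

Lemma rvar_lex_ltE st x1 x2 y1 y2 :
  beval st (rvar_lex_lt x1 x2 y1 y2) =
  lex_pos (rvar st y1 - rvar st x1, rvar st y2 - rvar st x2).
Proof.
rewrite /= /lex_pos /= !subr_gt0 subr_eq0 negb_and !negbK.
by case: ltgtP.
Qed.

Definition merge_inv kappa a N w st :=
  [/\ nvar st v_size = N, narr st a_order = a, key st =1 kappa, nvar st v_w = w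
    & merging (key_le kappa) a N w (narr st a_buffer) (nvar st v_t)
        (nvar st v_p) (nvar st v_pe) (nvar st v_q) (nvar st v_qe)].


Lemma merge_step_correct M kappa a N w st : (N < M)%N -> (0 < w)%N ->
  (forall i, (i < N)%N -> (a i < N)%N) -> block_sorted (key_le kappa) a N w ->
  merge_inv kappa a N w st -> (nvar st v_t < N)%N ->
  runs M merge_step st (ccost merge_step) (fun st' =>
    nvar st' v_t = (nvar st v_t).+1 /\ merge_inv kappa a N w st').
Proof.
move=> NM w0 aN sa inv tN; apply: runs_seq.
set Q := fun st' : state R => [/\ nvar st' v_t = nvar st v_t,
  (nvar st v_t < nvar st' v_qe)%N & merge_inv kappa a N w st'].
have : runs M (If (NLt (NVar v_t) (NVar v_qe)) Skip merge_reset) st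
   (ccost (If (NLt (NVar v_t) (NVar v_qe)) Skip merge_reset)) Q.
  apply: runs_wp; wp_step; case: ltnP => tqe; first by wp_steps.
  case: inv => sN sa1 sk sw mg; wp_steps.
  all: rewrite ?sN ?sw; try lia.
  split; [by [] | rewrite /= !/(upd _ _ _ _) /=; lia |].
  have eqm x : (x - (x - N) = minn x N)%N by lia.
  split=> //=; rewrite !eqm.
  exact: merging_reset tqe mg.
move/runs_weaken; apply=> // st1 [t1 lt1 inv1]; rewrite -t1 in lt1 tN *.
case: inv1 => sN sa1 sk sw mg.
have sk1 i : rarr st1 a_key1 i = (kappa i).1 by rewrite -sk.
have sk2 i : rarr st1 a_key2 i = (kappa i).2 by rewrite -sk.
have [ppe qqe] : (nvar st1 v_pe <= N)%N /\ (nvar st1 v_qe <= N)%N.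
  by case: mg => -[e [_ _ -> -> _]] _ _ _ _; lia.
apply: runs_seq.
set Q2 := fun st' : state R => if (0 < nvar st' v_right)%N
  then (nvar st1 v_q < nvar st1 v_qe)%N /\ ((nvar st1 v_p < nvar st1 v_pe)%N ->
    key_le kappa (a (nvar st1 v_q)) (a (nvar st1 v_p)))
  else (nvar st1 v_p < nvar st1 v_pe)%N /\ ((nvar st1 v_q < nvar st1 v_qe)%N ->
    key_le kappa (a (nvar st1 v_p)) (a (nvar st1 v_q))).
have : runs M merge_choose st1 (ccost merge_choose) Q2.
  apply: runs_wp; wp_steps; case: ifP => pp.
    wp_steps; case: ifP => qq.
      have ap : (a (nvar st1 v_p) < N)%N by apply: aN; lia.
      have aq : (a (nvar st1 v_q) < N)%N by apply: aN; lia.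
      wp_steps; rewrite ?sa1; try lia.
      rewrite rvar_lex_ltE; upd_simpl; rewrite ?sa1 !sk1 !sk2.
      case: ifP => lt; wp_steps; rewrite /Q2 /=; upd_simpl; split=> // _.
        exact: lex_pos_le.
      by rewrite /key_le /lex_le lt.
    by wp_steps; rewrite /Q2; upd_simpl; rewrite pp qq.
  wp_steps; rewrite /Q2; upd_simpl; rewrite pp; split=> //.
  by case: mg => -[e [pe1 pe2 _ _ _]] _ et _ _; lia.
move/runs_frame/runs_weaken; apply=> // st2 [[fn fr fa fb] q2].
have n2 x : x \notin nvar_writes merge_choose -> nvar st2 x = nvar st1 x := fn
  x.
have st2a : narr st2 = narr st1 by apply/funext => x; exact: fa.
have st2b : rarr st2 = rarr st1 by apply/funext => x; exact: fb.
apply: runs_wp; wp_steps.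
move: q2; rewrite /Q2; case: ifP => _ [h1 h2].
  wp_steps; rewrite ?n2 // ?st2a ?sa1; try lia.
    by have := aN (nvar st1 9); lia.
  split; first by rewrite addn1.
  split; upd_simpl; rewrite ?n2 //.
  - by rewrite ?st2a.
  - by move=> i; rewrite /key /= st2b sk1 sk2; case: (kappa i).
  - by rewrite ?st2a ?sa1 !addn1; apply: merging_right_step => //;
      first [exact: key_le_refl | exact: key_le_trans].
wp_steps; rewrite ?n2 // ?st2a ?sa1; try lia.
  by have := aN (nvar st1 7); lia.
split; first by rewrite addn1.
split; upd_simpl; rewrite ?n2 //.
- by rewrite ?st2a.
- by move=> i; rewrite /key /= st2b sk1 sk2; case: (kappa i).
- by rewrite ?st2a ?sa1 !addn1; apply: merging_left => //;
    first [exact: key_le_refl | exact: key_le_trans].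
Qed.

Lemma merge_pass_correct : exists C, forall M kappa a N w st,
  (N < M)%N -> (0 < w)%N -> (forall i, (i < N)%N -> (a i < N)%N) ->
  block_sorted (key_le kappa) a N w ->
  nvar st v_size = N -> narr st a_order = a -> key st =1 kappa ->
  nvar st v_w = w ->
  runs M merge_pass st (C * N.+1) (fun st' =>
    block_sorted (key_le kappa) (narr st' a_buffer) N (2 * w) /\
    forall v, occurrences (narr st' a_buffer) v 0 N = occurrences a v 0 N).
Proof.
exists (ccost (NSet v_t (NCst 0)) + ccost merge_reset + ccost merge_step + 4)%N.
move=> M kappa a N w st NM w0 aN sa sN sa1 sk sw.
set k := ccost merge_step.
apply: (@runs_leq _ _ _ _ (ccost (NSet v_t (NCst 0)) + (ccost merge_reset +
  (k + 1 + 3) * N.+1))%N); [ | by nia].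
apply: runs_wp_seq; wp_steps; apply: runs_wp_seq; wp_steps; rewrite ?sN;
  try lia.
set st1 := set_nvar _ _ _.
have inv1 : merge_inv kappa a N w st1.
  rewrite /st1; split; upd_simpl => //; rewrite sw ?sN.
  have mE x y : (x - (x - y) = minn x y)%N by lia.
  by rewrite !mE !add0n; exact: merging_start.
apply: (@runs_for _ _ _ _ _ N k (fun _ st => merge_inv kappa a N w st)) => //.
- move=> i st2 fr ti inv2; split; first by case: inv2.
  by move=> iN; rewrite -ti; apply: merge_step_correct => //; rewrite ti.
- move=> st2 fr tN [_ _ _ _ mg]; rewrite tN in mg.
  exact: merging_end mg.
Qed.

Lemma copy_back_correct : exists C, forall M N st, (N < M)%N ->
  (forall i, (i < N)%N -> (narr st a_buffer i <= M)%N) ->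
  nvar st v_size = N ->
  runs M copy_back st (C * N.+1) (fun st' =>
    forall i, (i < N)%N -> narr st' a_order i = narr st a_buffer i).
Proof.
exists (ccost copy_back + 100)%N; move=> M N st NM bM sN.
set body := (NLoad v_x a_buffer (NVar v_i) ;;
  NStore a_order (NVar v_i) (NVar v_x) ;; incr v_i).
apply: (@runs_leq _ _ _ _ (ccost (NSet v_i (NCst 0)) +
  (ccost body + 1 + 3) * N.+1)%N); [ | by rewrite /=; lia].
apply: runs_wp_seq; wp_steps.
apply: (@runs_for _ _ _ _ _ N (ccost body) (fun i st' =>
  forall j, (j < i)%N -> narr st' a_order j = narr st a_buffer j)) => //.
- move=> i st1 [fn fr fa fb] ti inv; split; first by rewrite /= fn.
  move=> iN; apply: runs_wp; wp_steps; rewrite ti ?(fa a_buffer) //; try lia.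
    by have := bM i iN; upd_simpl; lia.
  split; first by rewrite addn1.
  move=> j; rewrite ltnS leq_eqVlt /upd => /orP[/eqP->|ji].
    by rewrite eqxx.
  by rewrite (ltn_eqF ji) inv.
Qed.

Lemma fill_order_correct : exists C, forall M N st, (N < M)%N ->
  nvar st v_size = N ->
  runs M fill_order st (C * N.+1) (fun st' =>
    forall i, (i < N)%N -> narr st' a_order i = i).
Proof.
exists (ccost fill_order + 100)%N; move=> M N st NM sN.
set body := (NStore a_order (NVar v_i) (NVar v_i) ;; incr v_i).
apply: (@runs_leq _ _ _ _ (ccost (NSet v_i (NCst 0)) +
  (ccost body + 1 + 3) * N.+1)%N); [ | by rewrite /=; lia].
apply: runs_wp_seq; wp_steps.
apply: (@runs_for _ _ _ _ _ N (ccost body) (fun i st' =>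
  forall j, (j < i)%N -> narr st' a_order j = j)) => //.
- move=> i st1 [fn fr fa fb] ti inv; split; first by rewrite /= fn.
  move=> iN; apply: runs_wp; wp_steps; rewrite ti; try lia.
  split; first by rewrite addn1.
  move=> j; rewrite ltnS leq_eqVlt /upd => /orP[/eqP->|ji].
    by rewrite eqxx.
  by rewrite (ltn_eqF ji) inv.
Qed.

(** The memory bound comes from the width: it is last doubled from a value below [N], and the result
    is stored. *)
Lemma merge_sort_correct : exists C, forall M kappa N st, (2 * N + 1 < M)%N ->
  nvar st v_size = N -> key st =1 kappa ->
  runs M merge_sort st (C * (N.+1 * (up_log 2 N).+1)) (fun st' =>
    enumerates (narr st' a_order) N /\
    forall i j, (i <= j)%N -> (j < N)%N ->
      key_le kappa (narr st' a_order i) (narr st' a_order j)).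
Proof.
have [C1 pass] := merge_pass_correct.
have [C2 copy] := copy_back_correct.
have [C3 fill] := fill_order_correct.
set k := ccost (NSet v_w (NMul (NCst 2) (NVar v_w))).
exists (C1 + C2 + C3 + k + 10)%N => M kappa N st NM sN sk.
set D := (C1 * N.+1 + (C2 * N.+1 + k) + 3 + 1)%N.
apply: (@runs_leq _ _ _ _ (C3 * N.+1 + (ccost (NSet v_w (NCst 1)) +
  (up_log 2 N * D + 3).+1))%N); last first.
- rewrite [ccost _]/=; move: (up_log 2 N) => L.
  have DN : (D <= (C1 + C2 + k + 4) * N.+1)%N by rewrite /D; nia.
  have {DN} : (L * D <= (C1 + C2 + k + 4) * (L * N.+1))%N.
    by rewrite mulnCA leq_mul2l DN orbT.
  have -> : (N.+1 * L.+1 = L * N.+1 + N.+1)%N by rewrite mulnC mulSn addnC.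
  by move: (L * N.+1)%N (L * D)%N => X Y; nia.
apply: runs_seq; apply: runs_weaken (runs_frame (fill M N st _ sN)) _ _ => //.
  lia.
move=> st1 [[fn fr fa fb] h1]; apply: runs_wp_seq; wp_steps.
set st2 := set_nvar _ _ _.
pose I f st' := exists e, [/\ f = ((up_log 2 N - e) * D)%N,
  nvar st' v_w = (2 ^ e)%N, nvar st' v_size = N, key st' =1 kappa
  & block_sorted (key_le kappa) (narr st' a_order) N (2 ^ e) /\
    forall v, occurrences (narr st' a_order) v 0 N = (v < N)%N].
apply: (@runs_while _ _ _ _ I (up_log 2 N * D)).
- exists 0%N; rewrite subn0 /st2; split; upd_simpl => //.
  + by rewrite fn.
  + by move=> i; rewrite /key /= !fb // -sk.
  + split; first by move=> e i j ei ij je jN; rewrite (_ : i = j) ?key_le_refl;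
      lia.
    move=> v; rewrite /occurrences.
    under eq_big_nat => i /andP[_ iN] do rewrite h1 //.
    have [vN|Nv] := ltnP v N; last first.
      by rewrite big_nat big1 // => i /andP[_ iN]; apply/eqP; rewrite eqb0; lia.
    rewrite (big_cat_nat (n := v)) //=; last exact: ltnW.
    rewrite (big_ltn vN) eqxx big_nat big1 => [|i /andP[_ iv]]; last first.
      by apply/eqP; rewrite eqb0; lia.
    rewrite big_nat big1 // => i /andP[iv _].
    by apply/eqP; rewrite eqb0; lia.
- move=> f st3 fr3 [e [-> wE sE kE [srt occ]]] /=; rewrite wE sE => lt.
  have eL : (e < up_log 2 N)%N by rewrite -(ltn_exp2l _ _ (isT : 1 < 2)%N);
    apply: leq_trans lt _; exact: up_logP.
  exists (C1 * N.+1 + (C2 * N.+1 + k))%N.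
  have aN : forall i, (i < N)%N -> (narr st3 a_order i < N)%N.
    by case: (occurrences_enumerates occ).
  apply: runs_seq; apply: runs_weaken (runs_frame (pass M kappa (narr st3
    a_order) N (2 ^ e)%N st3 _ _ _ _ _ _ _ _)) _ _ => //.
    by lia.
    by rewrite expn_gt0.
  move=> st4 [[fn4 fr4 fa4 fb4] [srt4 occ4]].
  have occ4' v : occurrences (narr st4 a_buffer) v 0 N = (v < N)%N by rewrite
    occ4.
  have bN : forall i, (i < N)%N -> (narr st4 a_buffer i < N)%N.
    by case: (occurrences_enumerates occ4').
  apply: runs_seq; apply: runs_weaken (runs_frame (copy M N st4 _ _ _)) _ _ =>
    //.
  + lia.
  + by move=> i /bN; lia.
  + by rewrite fn4.
  move=> st5 [[fn5 fr5 fa5 fb5] cp5]; apply: runs_wp; wp_steps.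
    by rewrite fn5 // fn4 // wE; lia.
  exists ((up_log 2 N - e.+1) * D)%N.
    by rewrite /D -(subnSK eL) mulSn; lia.
  exists e.+1; split; upd_simpl => //.
  + by rewrite fn5 // fn4 // wE expnS.
  + by rewrite fn5 // fn4.
  + by move=> i; rewrite /key /= !fb5 // !fb4 // -kE.
  + split; rewrite ?expnS.
      move=> e' i j ei ij je jN; rewrite !cp5 //; last lia.
      exact: srt4 ei ij je jN.
    move=> v; rewrite -occ4'; apply: eq_big_nat => i /andP[_ iN].
    by rewrite cp5.
- move=> f st3 fr3 nb [e [_ wE sE kE [srt occ]]].
  move: nb; rewrite /= wE sE -leqNgt => Ne; split;
    first exact: occurrences_enumerates.
  move=> i j ij jN; apply: (srt 0%N) => //; lia.
Qed.
End MergeSortCorrect.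

(** * Tangents to the hull of a suffix *)

Section PlaneGeometry.
Variable R : realType.
Implicit Types (u v w a c p z : R * R) (s : R).

Definition det u v : R := u.1 * v.2 - u.2 * v.1.

(* Finitely many lexicographically positive vectors are positive for one linear
   form [v.1 + d * v.2], which replaces case analyses on the order. *)
Lemma lex_pos_linear_form (vs : seq (R * R)) : all (@lex_pos R) vs ->
  exists2 d : R, 0 < d & forall d', 0 < d' <= d ->
    forall v, v \in vs -> 0 < v.1 + d' * v.2.
Proof.
elim: vs => [_|v vs IH /= /andP[vpos /IH [d d0 dP]]]; first by exists 1.
have [e e0 eP] : exists2 e : R, 0 < e &
    forall d', 0 < d' <= e -> 0 < v.1 + d' * v.2.
  case/orP: vpos => [v1|/andP[/eqP v1 v2]]; last first.
    by exists 1 => // d' /andP[d'0 _]; rewrite v1 add0r mulr_gt0.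
  have n0 : 0 < `|v.2| + 1 by rewrite ltr_wpDl.
  exists (v.1 / (`|v.2| + 1)); first exact: divr_gt0.
  move=> d' /andP[d'0]; rewrite ler_pdivlMr // => h.
  have : - v.2 <= `|v.2| by rewrite -normrN ler_norm.
  by nra.
exists (Num.min d e); first by rewrite lt_min d0 e0.
move=> d' /andP[d'0]; rewrite le_min => /andP[d'd d'e] w.
rewrite inE => /orP[/eqP->|wvs]; first by apply: eP; rewrite d'0.
by apply: dP => //; rewrite d'0.
Qed.

Lemma lex_pos_form3 u v w : lex_pos u -> lex_pos v -> lex_pos w ->
  exists d : R, [/\ 0 < u.1 + d * u.2, 0 < v.1 + d * v.2 & 0 < w.1 + d * w.2].
Proof.
move=> hu hv hw; have [|d d0 dP] := @lex_pos_linear_form [:: u; v; w].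
  by rewrite /= hu hv hw.
by exists d; split; apply: dP; rewrite ?d0 ?lexx // !inE eqxx ?orbT.
Qed.

(** In an open half-plane the sign of [det] compares directions. The identity [e] is Cramer's
    relation between three plane vectors, evaluated under the positive linear form. The orientation
    [s] lets one argument serve both tangents. *)
Lemma det_trans s u v w : lex_pos u -> lex_pos v -> lex_pos w ->
  0 <= s * det u v -> 0 <= s * det v w -> 0 <= s * det u w.
Proof.
move=> hu hv hw uv vw; have [d [du dv dw]] := lex_pos_form3 hu hv hw.
have e : (s * det u w) * (v.1 + d * v.2) =
    (s * det v w) * (u.1 + d * u.2) + (s * det u v) * (w.1 + d * w.2).
  by rewrite /det; ring.
by rewrite -(pmulr_lge0 _ dv) e addr_ge0 // mulr_ge0 // ltW.
Qed.

(* A middle point on or below the chord [p c] is dominated from every viewpoint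
   (here the origin) lying before [p]. *)
Lemma det_pop s a c p : lex_pos p -> lex_pos (a - p) -> lex_pos (c - a) ->
  0 <= s * det (a - p) (c - p) -> 0 <= s * det a p \/ 0 <= s * det a c.
Proof.
move=> hp hap hca h; have [d [/= d1 d2 d3]] := lex_pos_form3 hp hap hca.
have [|nap] := leP 0 (s * det a p); first by left.
right; rewrite leNgt; apply/negP => nac.
have e : s * det a c * (p.1 + d * p.2) + s * det c p * (a.1 + d * a.2)
    - s * det a p * (c.1 + d * c.2) = 0 by rewrite /det; ring.
have {}h : 0 <= s * det a c - s * det a p + s * det c p.
  by move: h; congr (_ <= _); rewrite /det /=; ring.
move: (s * det a c) (s * det a p) (s * det c p) nac nap h e => x y z nac nap h
  e.
have : 0 <= (x - y + z) * (a.1 + d * a.2) by apply: mulr_ge0 => //; lra.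
have : x * (a.1 - p.1 + d * (a.2 - p.2)) < 0 by rewrite pmulr_llt0.
have : y * (c.1 - a.1 + d * (c.2 - a.2)) < 0 by rewrite pmulr_llt0.
lra.
Qed.

(** This makes binary search possible: seen from a viewpoint before the chain, a step that does not
    lose is preceded only by steps that gain. Otherwise the linear relation [e] between the three
    determinants contradicts the strict convexity [h]. *)
Lemma det_unimodal s a c p : lex_pos p -> lex_pos (a - p) -> lex_pos (c - a) ->
  s * det (a - p) (c - p) < 0 -> 0 <= s * det a p -> 0 < s * det c a.
Proof.
move=> hp hap hca h ap; have [d [/= d1 d2 d3]] := lex_pos_form3 hp hap hca.
rewrite ltNge; apply/negP => ca.
have e : - s * det c a * (p.1 + d * p.2) + s * det c p * (a.1 + d * a.2)
    - s * det a p * (c.1 + d * c.2) = 0 by rewrite /det; ring.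
have {}h : - s * det c a - s * det a p + s * det c p < 0.
  by move: h; congr (_ < _); rewrite /det /=; ring.
rewrite !mulNr in h e.
move: (s * det c a) (s * det a p) (s * det c p) ca ap h e => x y z ca ap h e.
have : (- x - y + z) * (a.1 + d * a.2) < 0 by rewrite pmulr_llt0 //; lra.
have : x * (a.1 - p.1 + d * (a.2 - p.2)) <= 0 by rewrite pmulr_lle0.
have : 0 <= y * (c.1 - a.1 + d * (c.2 - a.2)) by rewrite pmulr_lge0.
lra.
Qed.

End PlaneGeometry.

Section HullStack.
Variables (R : realType) (s : R) (kappa : nat -> R * R).
Implicit Types (D : nat -> Prop) (h : nat -> nat) (m p : nat) (z : R * R).

(* [h 0, ..., h m.-1] is the convex chain, seen from the left, of the points
   [kappa r] with [D r]: it consists of points ordered from right to left. *)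
Record chain D h m : Prop := Chain {
  chain_mem : forall j, (j < m)%N -> D (h j);
  chain_order : forall j, (j.+1 < m)%N -> lex_pos (kappa (h j) - kappa (h
    j.+1));
  chain_convex : forall j, (j.+2 < m)%N ->
    s * det (kappa (h j.+1) - kappa (h j.+2)) (kappa (h j) - kappa (h j.+2)) <
      0 }.

Definition before D z : Prop := forall r, D r -> lex_pos (kappa r - z).

Definition dominated h m z r : Prop :=
  exists2 j, (j < m)%N & 0 <= s * det (kappa r - z) (kappa (h j) - z).

(** Being a convex hull is expressed by what a tangent query needs: from every viewpoint before [D],
    each point of [D] is matched or beaten by a vertex of the chain. *)
Definition hull D h m : Prop := chain D h m /\
  (forall z, before D z -> forall r, D r -> dominated h m z r).

(* The state while the point [p] is about to be pushed. *)
Definition pending D p h m := [/\ chain D h m, before D (kappa p) &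
  forall z, before D z -> lex_pos (kappa p - z) -> forall r, D r ->
    dominated h m z r \/ 0 <= s * det (kappa r - z) (kappa p - z)].

Lemma hull_pending D p h m : hull D h m -> before D (kappa p) -> pending D p h
  m.
Proof. by move=> [hc hd] pD; split=> // z zD _ r Dr; left; exact: hd. Qed.

Lemma hull_empty D h : (forall r, ~ D r) -> hull D h 0.
Proof. by move=> nD; split=> // z _ r /nD. Qed.

(** By [det_pop], every admissible viewpoint sees the popped point beaten by the new point [p] or by
    its neighbour on the stack. Whatever it dominated is then dominated by one of these two, by
    [det_trans]. *)
Lemma pending_pop D p h m :
  0 <= s * det (kappa (h m.+1) - kappa p) (kappa (h m) - kappa p) ->
  pending D p h m.+2 -> pending D p h m.+1.
Proof.
move=> dm [[hm ho hc] pD hd]; split=> //.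
  split=> j jm; [apply: hm | apply: ho | apply: hc]; exact: ltnW.
move=> z zD pz r Dr; have [[j jm dj]|] := hd z zD pz r Dr; last by right.
have [jm1|] := ltnP j m.+1; first by left; exists j.
move=> jm1; have {jm jm1} ej : j = m.+1 by lia.
rewrite {j}ej in dj.
have Da : D (h m.+1) by exact: hm.
have Dc : D (h m) by exact: hm.
set a := kappa (h m.+1) in dj dm; set c := kappa (h m) in dm.
have sub u v : u - v = (u - z) - (v - z) by rewrite opprB addrA subrK.
have [|||pa|ca] := @det_pop R s (a - z) (c - z) (kappa p - z) pz.
- by rewrite -sub; exact: pD.
- by rewrite -sub; exact: ho.
- by rewrite -!sub.
- right; apply: (det_trans _ _ _ dj pa) => //; [exact: zD | exact: zD].
- left; exists m => //; apply: (det_trans _ _ _ dj ca); exact: zD.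
Qed.

Lemma pending_push D p h m :
  ((1 < m)%N -> s * det (kappa (h m.-1) - kappa p) (kappa (h m.-2) - kappa p) <
    0) ->
  pending D p h m -> hull (fun r => D r \/ r = p) (upd h m p) m.+1.
Proof.
move=> dm [[hm ho hc] pD hd].
have um : upd h m p m = p by rewrite /upd eqxx.
have ul j : (j < m)%N -> upd h m p j = h j by move=> jm;
  rewrite /upd (ltn_eqF jm).
split; first split.
- move=> j; rewrite ltnS leq_eqVlt => /orP[/eqP->|jm]; first by right.
  by left; rewrite ul //; exact: hm.
- move=> j; rewrite ltnS leq_eqVlt => /orP[/eqP jm|jm].
    by rewrite jm um ul -?jm //; apply: pD; apply: hm; rewrite -jm.
  by rewrite (ul j (ltnW jm)) (ul _ jm); exact: ho.
- move=> j; rewrite ltnS leq_eqVlt => /orP[/eqP jm|jm].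
    have jm1 : (j.+1 < m)%N by rewrite -jm.
    by rewrite jm um (ul j (ltnW jm1)) (ul _ jm1); have := dm; rewrite -jm /=;
      apply.
  by rewrite (ul j (ltnW (ltnW jm))) (ul _ (ltnW jm)) (ul _ jm); exact: hc.
- move=> z zD r Dr.
  have zD' : before D z by move=> r' Dr'; apply: zD; left.
  have pz : lex_pos (kappa p - z) by apply: zD; right.
  case: Dr => [Dr|->]; last first.
    by exists m => //; rewrite um (_ : det _ _ = 0) ?mulr0 // /det; ring.
  have [[j jm dj]|dp] := hd z zD' pz r Dr; last by exists m => //; rewrite um.
  by exists j; [exact: ltnW | rewrite ul].
Qed.

Section Query.
Variables (D : nat -> Prop) (h : nat -> nat) (m : nat) (z : R * R).
Hypotheses (hullD : hull D h m) (zD : before D z).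

(** Positive when vertex [j.+1] is a strictly better tangent point than vertex [j], seen from
    [z]. *)
Definition advance j :=
  s * det (kappa (h j) - z) (kappa (h j.+1) - z).

Lemma advance_unimodal j : (j.+2 < m)%N -> 0 <= advance j.+1 -> 0 < advance j.
Proof.
move=> jm; have [[hm ho hc] _] := hullD.
have sub u v : u - v = (u - z) - (v - z) by rewrite opprB addrA subrK.
apply: det_unimodal.
- by apply: zD; exact: hm.
- by rewrite -sub; exact: ho.
- by rewrite -sub; apply: ho; exact: ltnW.
- by rewrite -!sub; exact: hc.
Qed.

Lemma advance_left j k : (j <= k)%N -> (k.+1 < m)%N -> 0 < advance k -> 0 <
  advance j.
Proof.
move=> jk; rewrite -(subnKC jk); elim: (k - j)%N => [|d IH];
  first by rewrite addn0.
rewrite addnS => lt ad; apply: IH; first exact: ltnW.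
by apply: advance_unimodal => //; exact: ltW.
Qed.

Lemma advance_right j k : (k <= j)%N -> (j.+1 < m)%N -> advance k <= 0 ->
  advance j <= 0.
Proof.
by move=> kj jm; rewrite !leNgt; apply: contra; exact: advance_left.
Qed.

Lemma chain_best k : (k < m)%N ->
  (forall j, (j < k)%N -> 0 < advance j) ->
  (forall j, (k <= j)%N -> (j.+1 < m)%N -> advance j <= 0) ->
  D (h k) /\ forall r, D r -> 0 <= s * det (kappa r - z) (kappa (h k) - z).
Proof.
move=> km al ar; have [[hm ho hc] hd] := hullD; split; first exact: hm.
have pos j : (j < m)%N -> lex_pos (kappa (h j) - z) by move=> jm; exact/zD/hm.
have det0 u : s * det u u = 0 by rewrite /det; ring.
suff top j : (j < m)%N -> 0 <= s * det (kappa (h j) - z) (kappa (h k) - z).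
  move=> r Dr; have [j jm dj] := hd z zD r Dr.
  by apply: (det_trans _ _ _ dj (top j jm)); [exact: zD | exact: pos | exact:
    pos].
have [jk|kj] := leqP j k.
  rewrite -(subKn jk); move: (leq_subr j k); elim: (k - j)%N => [|d IH] dk jm.
    by rewrite subn0 det0.
  have e : (k - d.+1).+1 = (k - d)%N by rewrite subnSK.
  have h1 : 0 <= s * det (kappa (h (k - d.+1)%N) - z) (kappa (h (k - d)%N) - z).
    by have := al (k - d.+1)%N; rewrite /advance e => /(_ _)/ltW; apply; lia.
  apply: (det_trans _ _ _ h1 (IH _ _)); rewrite ?pos //; try lia.
move=> jm; move: (ltnW kj) jm; move/subnKC <-; elim: (j - k)%N => [|d IH].
  by rewrite addn0 det0.
rewrite addnS => lt.
have h1 : 0 <= s * det (kappa (h (k + d).+1) - z) (kappa (h (k + d)%N) - z).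
  have := ar (k + d)%N (leq_addr _ _) lt; rewrite /advance -oppr_ge0 -mulrN.
  by congr (_ <= _ * _); rewrite /det; ring.
apply: (det_trans _ _ _ h1 (IH _)); rewrite ?pos //; lia.
Qed.

End Query.
End HullStack.

(** * Smallest angle from an axis *)

Section Offset.
Variable R : realType.

Definition sign_of (eps : bool) : R := if eps then 1 else -1.

(* The angle from the axis [(0, sign_of eps)] to [v], for [v] lexicographically
   positive and in the corresponding open half-plane. *)
Definition offset_of eps (v : R * R) : R := atan (v.1 / (sign_of eps * v.2)).

(** A minimum with default value pi / 2, which no [offset_of] of a point in [D] exceeds: a side
    without red points imposes no restriction on the angle. *)
Definition is_offset eps (kappa : nat -> R * R) nr (z : R * R) (o : R) : Prop :=
  let D r := (r < nr)%N /\ lex_pos (kappa r - z) /\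
             0 < sign_of eps * (kappa r - z).2 in
  [/\ 0 <= o <= pi / 2,
      forall r, D r -> o <= offset_of eps (kappa r - z)
    & o = pi / 2 \/ exists2 r, D r & o = offset_of eps (kappa r - z)].

Lemma lex_pos_fst (v : R * R) : lex_pos v -> 0 <= v.1.
Proof. by move=> /orP[/ltW //|/andP[/eqP-> _]]. Qed.

Lemma offset_of_bounds eps v : lex_pos v -> 0 < sign_of eps * v.2 ->
  0 <= offset_of eps v <= pi / 2.
Proof.
move=> vp v2; rewrite /offset_of (ltW (atan_ltpi2 _)) andbT.
by rewrite -atan0 le_atan // divr_ge0 ?lex_pos_fst // ltW.
Qed.

Lemma offset_none eps kappa nr z :
  (forall r, (r < nr)%N -> ~~ lex_pos (kappa r - z)) ->
  is_offset eps kappa nr z (pi / 2).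
Proof.
move=> no; split; [ | | by left].
- by rewrite lexx andbT divr_ge0 // pi_ge0.
- by move=> r [rn [rp _]]; have := no r rn; rewrite rp.
Qed.

(** The point turned furthest towards the axis decides both cases: if it is not in the open
    half-plane of the axis, no other candidate is. *)
Lemma offset_best eps kappa nr z k : (k < nr)%N -> lex_pos (kappa k - z) ->
  (forall r, (r < nr)%N -> lex_pos (kappa r - z) ->
     0 <= sign_of eps * det (kappa r - z) (kappa k - z)) ->
  is_offset eps kappa nr z
    (if 0 < sign_of eps * (kappa k - z).2 then offset_of eps (kappa k - z)
     else pi / 2).
Proof.
move=> kn; set w := kappa k - z => wp best.
case: ifPn => [w2|nw2].
  split; first exact: offset_of_bounds.
  - move=> r [rn [rp r2]]; rewrite /offset_of le_atan //.
    rewrite ler_pdivrMr // mulrAC ler_pdivlMr //.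
    have := best r rn rp; rewrite /det; lra.
  - by right; exists k.
split; [ | | by left].
- by rewrite lexx andbT divr_ge0 // pi_ge0.
- move=> r [rn [rp r2]]; exfalso; rewrite -leNgt in nw2.
  have := best r rn rp; set v := kappa r - z in rp r2 *.
  have v1 := lex_pos_fst rp; have w1 := lex_pos_fst wp.
  rewrite /det => b; have {}b : 0 <= v.1 * (sign_of eps * w.2) - w.1 * (sign_of
    eps * v.2).
    by move: b; congr (_ <= _); ring.
  (* Both terms of [b] have unfavourable signs, so [w] is vertical. Being lexicographically positive
     it points up, which forces the downward axis; then [v] is vertical too and would have to point
     both up and down. *)
  have w10 : w.1 = 0 by nra.
  have w2 : 0 < w.2 by case/orP: wp; rewrite w10 ?ltxx // => /andP[].
  have s0 : sign_of eps = -1 by move: nw2; rewrite /sign_of; case: (eps) => //;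
    lra.
  rewrite s0 in r2 nw2 b.
  have v10 : v.1 = 0 by nra.
  by case/orP: rp; rewrite v10 ?ltxx // => /andP[_]; lra.
Qed.

End Offset.

(** * The sweep: hull stack and binary search for tangents *)

Notation v_frame := 4%N (only parsing).
Notation v_id := 5%N (only parsing).
Notation v_top := 6%N (only parsing).
Notation v_a := 7%N (only parsing).
Notation v_c := 8%N (only parsing).
Notation v_lo := 9%N (only parsing).
Notation v_hi := 10%N (only parsing).
Notation v_mid := 11%N (only parsing).

Notation a_stack := 4%N (only parsing).

Notation x_px := 2%N (only parsing).
Notation x_py := 3%N (only parsing).
Notation x_ax := 4%N (only parsing).
Notation x_ay := 5%N (only parsing).
Notation x_cx := 6%N (only parsing).
Notation x_cy := 7%N (only parsing).
Notation x_offset := 8%N (only parsing).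
Notation x_quarter := 9%N (only parsing).

Notation rsub e1 e2 := (RAdd e1 (RUn Opp e2)).

Definition sign_exp (eps : bool) (e : rexp) : rexp :=
  if eps then e else RUn Opp e.

(** Used in two roles: with [p] the new point and [a], [c] the top two of the stack it is the
    convexity test; with [p] the viewpoint and [a], [c] consecutive vertices it is [advance]. *)
Definition turn eps : rexp := sign_exp eps
  (rsub (RMul (rsub (RVar x_ax) (RVar x_px)) (rsub (RVar x_cy) (RVar x_py)))
        (RMul (rsub (RVar x_ay) (RVar x_py)) (rsub (RVar x_cx) (RVar x_px)))).

Definition load_key x y v : cmd :=
  RLoad x a_key1 (NVar v) ;; RLoad y a_key2 (NVar v).

Definition push : cmd :=
  NStore a_stack (NVar v_top) (NVar v_id) ;;
  incr v_top ;;
  NSet v_i (NSub (NVar v_i) (NCst 1)).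

(** One push or one pop per round. After a pop [v_i] is unchanged, so the same red point is fetched
    again, and the cost is amortized over the rounds of a single loop. *)
Definition hull_step eps : cmd :=
  If (NLt (NVar v_top) (NCst 2)) push
    (NLoad v_a a_stack (NSub (NVar v_top) (NCst 1)) ;;
     NLoad v_c a_stack (NSub (NVar v_top) (NCst 2)) ;;
     load_key x_ax x_ay v_a ;; load_key x_cx x_cy v_c ;;
     If (RLt (turn eps) (ROfN (NCst 0))) push
       (NSet v_top (NSub (NVar v_top) (NCst 1)))).

Definition search_step eps : cmd :=
  NSet v_mid (NDiv (NAdd (NVar v_lo) (NVar v_hi)) (NCst 2)) ;;
  NLoad v_a a_stack (NVar v_mid) ;;
  NLoad v_c a_stack (NAdd (NVar v_mid) (NCst 1)) ;;
  load_key x_ax x_ay v_a ;; load_key x_cx x_cy v_c ;;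
  If (RLt (ROfN (NCst 0)) (turn eps))
    (NSet v_lo (NAdd (NVar v_mid) (NCst 1)))
    (NSet v_hi (NVar v_mid)).

Definition search eps : cmd :=
  While (NLt (NVar v_lo) (NVar v_hi)) (search_step eps).

Definition tangent_offset eps : cmd :=
  NLoad v_a a_stack (NVar v_lo) ;;
  load_key x_ax x_ay v_a ;;
  RSet x_ax (rsub (RVar x_ax) (RVar x_px)) ;;
  RSet x_ay (sign_exp eps (rsub (RVar x_ay) (RVar x_py))) ;;
  If (RLt (ROfN (NCst 0)) (RVar x_ay))
    (RSet x_offset (RUn Atan (RMul (RVar x_ax) (RUn Recip (RVar x_ay)))))
    Skip.

Definition record_offset res : cmd :=
  RStore res
    (NAdd (NMul (NCst 4) (NSub (NVar v_id) (NVar v_red))) (NVar v_frame))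
    (RVar x_offset) ;;
  NSet v_i (NSub (NVar v_i) (NCst 1)).

Definition query eps : cmd :=
  RSet x_offset (RVar x_quarter) ;;
  If (NLt (NVar v_top) (NCst 1)) Skip
    (NSet v_lo (NCst 0) ;; NSet v_hi (NSub (NVar v_top) (NCst 1)) ;;
     search eps ;; tangent_offset eps).

Definition fetch : cmd :=
  NLoad v_id a_order (NSub (NVar v_i) (NCst 1)) ;; load_key x_px x_py v_id.

Definition sweep_step eps res : cmd :=
  fetch ;;
  If (NLt (NVar v_id) (NVar v_red)) (hull_step eps)
    (query eps ;; record_offset res).

Definition sweep eps res : cmd :=
  NSet v_top (NCst 0) ;; NSet v_i (NVar v_size) ;;
  While (NLt (NCst 0) (NVar v_i)) (sweep_step eps res).

Section SweepCorrect.
Variable R : realType.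
Implicit Types (st : state R) (M : nat) (eps : bool).

Lemma sign_expE st eps e : reval st (sign_exp eps e) = sign_of R eps * reval st
  e.
Proof. by rewrite /sign_exp /sign_of; case: eps; rewrite ?mul1r ?mulN1r. Qed.

Lemma turnE st eps : reval st (turn eps) = sign_of R eps *
  det ((rvar st x_ax, rvar st x_ay) - (rvar st x_px, rvar st x_py))
      ((rvar st x_cx, rvar st x_cy) - (rvar st x_px, rvar st x_py)).
Proof. by rewrite sign_expE. Qed.

Lemma search_correct eps : exists C, forall M kappa D h m L st,
  (m < M)%N -> (forall j, (j < m)%N -> (h j < M)%N) -> (m <= 2 ^ L)%N ->
  key st =1 kappa -> narr st a_stack = h -> (0 < m)%N ->
  nvar st v_lo = 0%N -> nvar st v_hi = m.-1 ->
  let z := (rvar st x_px, rvar st x_py) in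
  hull (sign_of R eps) kappa D h m -> before kappa D z ->
  runs M (search eps) st (C * L.+1) (fun st' =>
    let k := nvar st' v_lo in
    [/\ (k < m)%N, D (h k) & forall r, D r ->
      0 <= sign_of R eps * det (kappa r - z) (kappa (h k) - z)]).
Proof.
pose K := ccost (search_step eps).
exists (K + 10)%N => M kappa D h m L st mM hM mL sk sh m0 lo0 hi0 z hD zD.
apply: (@runs_leq _ _ _ _ (L * (K + 4) + 3).+1); [ | by nia].
pose adv := advance (sign_of R eps) kappa h z.
pose I f st' := exists e, [/\ f = (e * (K + 4))%N,
  (nvar st' v_lo <= nvar st' v_hi < m)%N,
  (nvar st' v_hi - nvar st' v_lo < 2 ^ e)%N,
  forall j, (j < nvar st' v_lo)%N -> 0 < adv j
  & forall j, (nvar st' v_hi <= j)%N -> (j.+1 < m)%N -> adv j <= 0].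
apply: (@runs_while _ _ _ _ I (L * (K + 4))).
- exists L; rewrite lo0 hi0; split=> //; try lia.
- move=> f st1 [fn fr fa fb] [e [-> lohi lt al ar]] /= test.
  case: e lt => [|e] lt; first by rewrite expn0 in lt; lia.
  exists K; apply: runs_wp.
  set mid := ((nvar st1 v_lo + nvar st1 v_hi) %/ 2)%N.
  have midlo : (nvar st1 v_lo <= mid)%N by rewrite /mid; lia.
  have midhi : (mid < nvar st1 v_hi)%N by rewrite /mid; lia.
  have sh1 : narr st1 a_stack = h by rewrite fa.
  have hM1 : (h mid < M)%N by apply: hM; lia.
  have hM2 : (h mid.+1 < M)%N by apply: hM; lia.
  have sk1 i : rarr st1 a_key1 i = (kappa i).1 by rewrite fb // -sk.
  have sk2 i : rarr st1 a_key2 i = (kappa i).2 by rewrite fb // -sk.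
  rewrite expnS in lt.
  wp_steps; rewrite -?/mid ?sh1 ?addn1; try lia.
  rewrite turnE; upd_simpl; rewrite -?/mid ?sh1 ?addn1 !sk1 !sk2 !fr //.
  rewrite -!surjective_pairing.
  have -> : sign_of R eps * det (kappa (h mid) - z) (kappa (h mid.+1) - z) =
    adv mid by [].
  have [g0|g0] := ltP 0 (adv mid); wp_steps; rewrite -?/mid ?addn1; try lia.
  + exists (e * (K + 4))%N; first by lia.
    exists e; split; upd_simpl => //; try lia.
    by move=> j jm; apply: (advance_left hD zD _ _ g0); lia.
  + exists (e * (K + 4))%N; first by lia.
    exists e; split; upd_simpl => //; try lia.
    by move=> j jm jm1; apply: (advance_right hD zD jm jm1 g0).
- move=> f st1 fr1 nb [e [_ lohi lt al ar]]; rewrite /= -leqNgt in nb.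
  have e1 : nvar st1 v_hi = nvar st1 v_lo by lia.
  have lom : (nvar st1 v_lo < m)%N by lia.
  rewrite e1 in ar.
  by have [d best] := chain_best hD zD lom al ar.
Qed.

Lemma tangent_offset_correct M eps st kappa h nr k Q :
  let z := (rvar st x_px, rvar st x_py) in
  key st =1 kappa -> narr st a_stack = h -> nvar st v_lo = k -> (k < M)%N ->
  (h k < M)%N -> rvar st x_offset = pi / 2 ->
  (h k < nr)%N -> lex_pos (kappa (h k) - z) ->
  (forall r, (r < nr)%N -> lex_pos (kappa r - z) ->
     0 <= sign_of R eps * det (kappa r - z) (kappa (h k) - z)) ->
  (forall st', is_offset eps kappa nr z (rvar st' x_offset) -> Q st') ->
  wp M (tangent_offset eps) Q st.
Proof.
move=> z sk sh lok kM hM qu hn hp best post.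
have sk1 i : rarr st a_key1 i = (kappa i).1 by rewrite -sk.
have sk2 i : rarr st a_key2 i = (kappa i).2 by rewrite -sk.
wp_steps; rewrite ?lok ?sh //.
have := offset_best hn hp best.
rewrite /offset_of; rewrite sign_expE; upd_simpl.
rewrite ?lok ?sh !sk1 !sk2.
by case: ifP => w2 o; wp_steps; apply: post; upd_simpl;
  rewrite ?qu // sign_expE; upd_simpl; rewrite ?lok ?sh !sk1 !sk2.
Qed.


Definition processed nr N (a : nat -> nat) i r : Prop :=
  (r < nr)%N /\ exists2 pos, (i <= pos < N)%N & a pos = r.

Record sweep_input kappa nr nb (a : nat -> nat) k : Prop := SweepInput {
  input_enum : enumerates a (nr + nb);
  input_sorted : forall i j, (i <= j)%N -> (j < nr + nb)%N ->
    key_le kappa (a i) (a j);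
  input_inj : forall i j, (i < nr + nb)%N -> (j < nr + nb)%N ->
    kappa i = kappa j :> R * R -> i = j;
  input_frame : (k < 4)%N }.

Definition sweep_state kappa nr nb a k st :=
  [/\ nvar st v_red = nr, nvar st v_size = (nr + nb)%N, nvar st v_frame = k,
      key st =1 kappa & narr st a_order = a /\ rvar st x_quarter = pi / 2].

(* The point in position [i.-1] is the next one to be treated. *)
Definition sweep_hull eps kappa nr nb a i h m :=
  hull (sign_of R eps) kappa (processed nr (nr + nb) a i) h m \/
  [/\ (0 < i)%N, (a i.-1 < nr)%N &
    pending (sign_of R eps) kappa (processed nr (nr + nb) a i) (a i.-1) h m].

Definition sweep_inv eps kappa nr nb a k (out0 out : nat -> R) i h m :=
  [/\ sweep_hull eps kappa nr nb a i h m, (m + i <= nr + nb)%N,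
      forall j, (j < m)%N -> (h j < nr)%N,
      forall pos, (i <= pos < nr + nb)%N -> (nr <= a pos)%N ->
        is_offset eps kappa nr (kappa (a pos)) (out (4 * (a pos - nr) + k)%N)
    & forall x, (forall j, (j < nb)%N -> x != (4 * j + k)%N) -> out x = out0 x].

Section SweepOrder.
Variables (kappa : nat -> R * R) (nr nb k : nat) (a : nat -> nat).
Hypothesis inp : sweep_input kappa nr nb a k.
Let N := (nr + nb)%N.

Lemma sweep_before i : (0 < i <= N)%N ->
  before kappa (processed nr N a i) (kappa (a i.-1)).
Proof.
move=> /andP[i0 iN] r [rnr [pos /andP[ipos posN] posr]].
have [[aN _ ainj] srt inj _] := inp.
have d : kappa (a i.-1) - kappa r != 0.
  rewrite subr_eq0; apply/eqP => e.
  have e1 : a i.-1 = r by apply: inj => //; [apply: aN; rewrite -/N; lia | lia].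
  have : i.-1 = pos by apply: ainj; rewrite -/N ?e1 //; lia.
  lia.
have := lex_pos_total d; rewrite opprB; apply.
by have := srt i.-1 pos; rewrite posr; apply; lia.
Qed.

Lemma sweep_processed i r : (0 < i <= N)%N -> (r < nr)%N -> (nr <= a i.-1)%N ->
  lex_pos (kappa r - kappa (a i.-1)) -> processed nr N a i r.
Proof.
move=> /andP[i0 iN] rnr bl pos; split=> //.
have [[aN asurj ainj] srt inj _] := inp.
have [|p pN pr] := asurj r; first by lia.
exists p => //; rewrite pN andbT leqNgt; apply/negP => pi.
have : key_le kappa (a p) (a i.-1) by apply: srt; rewrite -/N; lia.
by rewrite /key_le /lex_le pr pos.
Qed.

Lemma processed_red i r : (0 < i <= N)%N -> (a i.-1 < nr)%N ->
  processed nr N a i.-1 r <-> processed nr N a i r \/ r = a i.-1.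
Proof.
move=> /andP[i0 iN] red; split=> [[rnr [p /andP[ip pN] pr]]|].
  have [e|d] := eqVneq p i.-1; first by right; rewrite -pr e.
  by left; split=> //; exists p => //; lia.
case=> [[rnr [p /andP[ip pN] pr]]|->].
  by split=> //; exists p => //; lia.
by split=> //; exists i.-1 => //; lia.
Qed.

Lemma processed_blue i r : (0 < i <= N)%N -> (nr <= a i.-1)%N ->
  processed nr N a i.-1 r <-> processed nr N a i r.
Proof.
move=> /andP[i0 iN] blue; split=> [[rnr [p /andP[ip pN] pr]]|].
  have [e|d] := eqVneq p i.-1; first by move: rnr; rewrite -pr e; lia.
  by split=> //; exists p => //; lia.
by move=> [rnr [p /andP[ip pN] pr]]; split=> //; exists p => //; lia.
Qed.

Lemma hull_ext s D D' h m : (forall r, D' r <-> D r) ->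
  hull s kappa D h m -> hull s kappa D' h m.
Proof.
move=> e; suff -> : D' = D by [].
by apply/funext => r; apply/propext.
Qed.

Lemma sweep_hull_pop eps i h m :
  (0 < i <= N)%N -> (a i.-1 < nr)%N -> sweep_hull eps kappa nr nb a i h m ->
  pending (sign_of R eps) kappa (processed nr N a i) (a i.-1) h m.
Proof.
move=> iN red [hl|[_ _ //]]; apply: hull_pending hl _; exact: sweep_before.
Qed.

End SweepOrder.

Lemma query_correct eps : exists C, forall M kappa D h m L nr st,
  (m < M)%N -> (forall j, (j < m)%N -> (h j < M)%N) -> (m <= 2 ^ L)%N ->
  key st =1 kappa -> narr st a_stack = h -> nvar st v_top = m ->
  rvar st x_quarter = pi / 2 ->
  let z := (rvar st x_px, rvar st x_py) in
  hull (sign_of R eps) kappa D h m -> before kappa D z ->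
  (forall r, D r -> (r < nr)%N) ->
  (forall r, (r < nr)%N -> lex_pos (kappa r - z) -> D r) ->
  runs M (query eps) st (C * L.+1) (fun st' =>
    is_offset eps kappa nr z (rvar st' x_offset)).
Proof.
have [C srch] := search_correct eps.
set K := (ccost (query eps) + ccost (tangent_offset eps))%N.
exists (C + 2 * K + 20)%N => M kappa D h m L nr st mM hM mL sk sh tm qu z hD zD
  Dn nD.
apply: (@runs_leq _ _ _ _ (K + (C * L.+1 + K + 12))); [ | by nia].
apply: (@runs_leq _ _ _ _ (ccost (RSet x_offset (RVar x_quarter)) +
  (bcost (NLt (NVar v_top) (NCst 1)) +
   (2 + (4 + (C * L.+1 + ccost (tangent_offset eps))))).+1)); last first.
- by rewrite /K /=; lia.
apply: runs_wp_seq; wp_steps; apply: runs_if; upd_simpl; rewrite tm => m1.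
  apply: (@runs_leq _ _ _ _ (ccost Skip)); [ | by rewrite /=; lia].
  (* A red point after [z] would be dominated by an entry of the empty stack; so there is none, and
     the default value is right. *)
  apply: runs_wp; wp_steps; rewrite qu; apply: offset_none => r rn.
  apply/negP => /(nD _ rn) Dr; have [_ /(_ z zD r Dr) [j jm _]] := hD; lia.
apply: (@runs_wp_seq _ _ (NSet v_lo (NCst 0))); wp_steps.
apply: (@runs_wp_seq _ _ (NSet v_hi (NSub (NVar v_top) (NCst 1)))); wp_steps.
set st1 := set_nvar _ _ _; have m0 : (0 < m)%N by lia.
have lo1 : nvar st1 v_lo = 0%N by [].
have hi1 : nvar st1 v_hi = m.-1 by rewrite /st1; upd_simpl; rewrite tm subn1.
have sk1 : key st1 =1 kappa by move=> i; rewrite -sk.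
have := srch M kappa D h m L st1 mM hM mL sk1 sh m0 lo1 hi1 hD zD.
move/runs_frame => run; apply: runs_seq; apply: (runs_weaken run) => //.
move=> st2 [[fn fr fa fb] [km Dk best]]; apply: runs_wp.
have z2 : z = (rvar st2 x_px, rvar st2 x_py) by rewrite !fr.
rewrite z2 in zD nD *.
apply: (@tangent_offset_correct M eps st2 kappa h nr (nvar st2 v_lo)) => //.
- by move=> i; rewrite /key !fb // -sk1.
- by rewrite fa.
- by lia.
- exact: hM.
- by rewrite fr // /st1; upd_simpl; rewrite qu.
- exact: Dn.
- exact: zD.
- by move=> r rn rp; rewrite -z2; apply: best; exact: nD.
Qed.

Section Step.
Variables (M : nat) (eps : bool) (res : nat) (kappa : nat -> R * R).
Variables (nr nb k : nat) (a : nat -> nat) (out0 : nat -> R).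
Hypothesis inp : sweep_input kappa nr nb a k.
Hypothesis sizeM : (nr + nb < M)%N.
Let N := (nr + nb)%N.

Definition sweep_at st := [/\ sweep_state kappa nr nb a k st,
  (nvar st v_i <= N)%N & sweep_inv eps kappa nr nb a k out0 (rarr st res)
    (nvar st v_i) (narr st a_stack) (nvar st v_top)].

(** The potential of the amortized analysis: a push trades one position (2) for one stack entry (1),
    a pop removes an entry, and a query consumes a position. It starts at [2 * N]. *)
Definition sweep_measure st := (2 * nvar st v_i + nvar st v_top)%N.

Lemma push_correct st : sweep_at st -> (0 < nvar st v_i)%N ->
  nvar st v_id = a (nvar st v_i).-1 -> (nvar st v_id < nr)%N ->
  ((1 < nvar st v_top)%N -> sign_of R eps *
     det (kappa (narr st a_stack (nvar st v_top).-1) - kappa (nvar st v_id))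
         (kappa (narr st a_stack (nvar st v_top).-2) - kappa (nvar st v_id)) <
           0) ->
  wp M push (fun st' => sweep_at st' /\
    (sweep_measure st' < sweep_measure st)%N) st.
Proof.
move=> [stt iN [hl mi hr ho hx]] i0 ide idr turn.
have iN' : (0 < nvar st v_i <= N)%N by rewrite i0.
have pd := sweep_hull_pop inp iN' _ hl; rewrite -ide in pd.
have {pd}hl' := pending_push turn (pd idr).
wp_steps; rewrite -/N in mi *; try lia.
rewrite /sweep_at /sweep_measure; upd_simpl; rewrite subn1 addn1.
split; last lia.
split; [by case: stt | lia | split].
- left; apply: hull_ext hl' => r; rewrite ide.
  by rewrite -/N; apply: processed_red; rewrite -?ide.
- lia.
- move=> j; rewrite /upd; case: eqP => // jm jm1; apply: hr; lia.
- move=> pos /andP[ip pN] bl; apply: ho => //; rewrite pN andbT.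
  have [//|pi] := leqP (nvar st v_i) pos.
  have pe : pos = (nvar st v_i).-1 by lia.
  by move: bl idr; rewrite ide pe; lia.
- exact: hx.
Qed.

Lemma hull_step_correct st : sweep_at st -> (0 < nvar st v_i)%N ->
  nvar st v_id = a (nvar st v_i).-1 -> (nvar st v_id < nr)%N ->
  (rvar st x_px, rvar st x_py) = kappa (nvar st v_id) ->
  wp M (hull_step eps) (fun st' => sweep_at st' /\
    (sweep_measure st' < sweep_measure st)%N) st.
Proof.
move=> at0 i0 ide idr pe; have push0 := push_correct at0 i0 ide idr.
have [[nrE szE frE sk [oE qE]] iN [hl mi hr ho hx]] := at0.
have iN' : (0 < nvar st v_i <= N)%N by rewrite i0.
have sk1 i : rarr st a_key1 i = (kappa i).1 by rewrite -sk.
have sk2 i : rarr st a_key2 i = (kappa i).2 by rewrite -sk.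
wp_steps; case: ltnP => m2; first by apply: push0 => ?; exfalso; lia.
set m := nvar st v_top in hl mi hr m2 push0 *.
set h := narr st a_stack in hl hr push0 *.
have h1M : (h (m - 1)%N < M)%N by have := hr (m - 1)%N; lia.
have h2M : (h (m - 2)%N < M)%N by have := hr (m - 2)%N; lia.
wp_steps; rewrite -/m -/h; try lia.
rewrite turnE; upd_simpl; rewrite -/m -/h !sk1 !sk2 -!surjective_pairing pe.
rewrite subn1 subn2.
case: ltP => turn.
  lazymatch goal with |- wp _ _ _ ?st1 =>
    have := @push_correct st1 at0 i0 ide idr; rewrite /sweep_measure; upd_simpl
  end; apply => _.
  exact: turn.
wp_steps.
rewrite /sweep_at /sweep_measure; upd_simpl; rewrite -/m; split; last lia.
split=> //; split=> //; last 2 first.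
- lia.
- by move=> j jm; apply: hr; rewrite -/m; lia.
right; split=> //; first by rewrite -ide.
have pd := sweep_hull_pop inp iN' _ hl; rewrite -ide in pd.
have em : m = (m - 2).+2 by lia.
have m1 : (m - 1 = (m - 2).+1)%N by lia.
rewrite -/h m1 -ide; apply: pending_pop; last by rewrite -em; exact: pd.
by move: turn; rewrite -m1 subn1 subn2.
Qed.

End Step.

Lemma sweep_step_correct eps res : res \notin [:: a_key1; a_key2] ->
  exists C, forall M kappa nr nb k a out0, sweep_input kappa nr nb a k ->
  (nr + nb < M)%N -> (4 * nb < M)%N ->
  forall st, sweep_at eps res kappa nr nb k a out0 st -> (0 < nvar st v_i)%N ->
  runs M (sweep_step eps res) st (C * (up_log 2 (nr + nb)).+1) (fun st' =>
    sweep_at eps res kappa nr nb k a out0 st' /\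
    (sweep_measure st' < sweep_measure st)%N).
Proof.
move=> res_key.
have [C qry] := query_correct eps.
set K := (ccost fetch + ccost (hull_step eps) + ccost (record_offset res) +
  5)%N.
exists (C + K)%N => M kappa nr nb k a out0 inp sizeM outM st at0 i0.
pose N := (nr + nb)%N; rewrite -/N.
apply: (@runs_leq _ _ _ _ (ccost fetch + (3 +
  (C * (up_log 2 N).+1 + (ccost (record_offset res) + ccost (hull_step
    eps)))).+1));
  last first.
- have : (K <= K * (up_log 2 N).+1)%N by rewrite leq_pmulr.
  by rewrite mulnDl {1}/K; lia.
have [[nrE szE frE sk [oE qE]] iN [hl mi hr ho hx]] := at0.
have iN' : (0 < nvar st v_i <= N)%N by rewrite i0.
have [[aN _ _] _ inj k4] := inp.
have idN : (a (nvar st v_i).-1 < N)%N by apply: aN; rewrite -/N; lia.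
have sk1 i : rarr st a_key1 i = (kappa i).1 by rewrite -sk.
have sk2 i : rarr st a_key2 i = (kappa i).2 by rewrite -sk.
apply: runs_wp_seq; wp_steps; rewrite ?oE ?subn1 ?sk1 ?sk2;
  try (rewrite -/N in idN *; lia).
set b := a _; set st1 := set_rvar _ _ _.
have at1 : sweep_at eps res kappa nr nb k a out0 st1 by [].
have ms1 : sweep_measure st1 = sweep_measure st by [].
have pe : (rvar st1 x_px, rvar st1 x_py) = kappa b.
  by rewrite /st1; upd_simpl; rewrite -surjective_pairing.
apply: runs_if; rewrite /st1; upd_simpl; rewrite -/st1 nrE => red.
  apply: (@runs_leq _ _ _ _ (ccost (hull_step eps))); last first.
  - by rewrite addnA leq_addl.
  by apply: runs_wp; rewrite -ms1; apply: hull_step_correct.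
rewrite -leqNgt in red.
have hl1 : hull (sign_of R eps) kappa (processed nr N a (nvar st v_i))
    (narr st a_stack) (nvar st v_top).
  by case: hl => // -[_ red' _]; have := red : (nr <= b)%N; rewrite leqNgt red'.
have := qry M kappa _ _ _ (up_log 2 N) nr st1 _ _ _ sk erefl erefl qE hl1.
rewrite pe => /(_ _ _ _ (sweep_before inp iN')) q.
apply: runs_seq; apply: (runs_weaken (runs_frame (q _ _ _ _ _))) => //.
- by change (nvar st v_top < M)%N; lia.
- by move=> j /hr jn; change (narr st a_stack j < M)%N; lia.
- apply: leq_trans (up_logP N (isT : 1 < 2)%N).
  by change (nvar st v_top <= N)%N; rewrite /N; lia.
- by move=> r [].
- by move=> r rn rp; apply: (sweep_processed inp iN').
move=> st2 [[fn fr fa fb] off].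
apply: (runs_leq (runs_wp _)); [ | exact: leq_addr].
have key_res x : x \in [:: a_key1; a_key2] -> x != res.
  by move=> xk; apply: contraNneq res_key => <-.
have bn : (b - nr < nb)%N by rewrite -/b /N in idN; lia.
wp_steps; rewrite !fn // /st1; upd_simpl; rewrite ?nrE ?frE; try lia.
rewrite /sweep_at /sweep_measure; upd_simpl; rewrite !fn // !fa // /st1;
  upd_simpl.
split; last lia.
split; [ | lia | split].
- split; upd_simpl; rewrite ?fn //; last by rewrite fa // fr.
  by move=> i; rewrite /key /= /upd !(negPf (key_res _ _)) // !fb // -sk.
- left; apply: hull_ext hl1 => r; rewrite subn1; exact: processed_blue.
- lia.
- exact: hr.
- move=> pos /andP[ip pN] bl; rewrite /upd eqxx; case: eqP => [e|ne].
    have pb : a pos = b by lia.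
    by rewrite pb.
  rewrite fb //; apply: ho => //; rewrite pN andbT.
  have [//|pi] := leqP (nvar st v_i) pos.
  have pe' : pos = (nvar st v_i).-1 by lia.
  by case: ne; rewrite pe'.
- move=> x xo; rewrite /upd eqxx; case: eqP => [e|_].
    by have := xo _ bn; rewrite e eqxx.
  by rewrite fb //; apply: hx.
Qed.

Lemma sweep_correct eps res : res \notin [:: a_key1; a_key2] ->
  exists C, forall M kappa nr nb k a st,
  sweep_input kappa nr nb a k -> (nr + nb < M)%N -> (4 * nb < M)%N ->
  sweep_state kappa nr nb a k st ->
  let N := (nr + nb)%N in
  runs M (sweep eps res) st (C * (N.+1 * (up_log 2 N).+1)) (fun st' =>
    (forall j, (j < nb)%N -> is_offset eps kappa nr (kappa (nr + j)%N)
       (rarr st' res (4 * j + k)%N)) /\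
    (forall x, (forall j, (j < nb)%N -> x != (4 * j + k)%N) ->
       rarr st' res x = rarr st res x)).
Proof.
move=> res_key; have [C0 step0] := sweep_step_correct eps res_key.
exists (2 * C0 + 100)%N => M kappa nr nb k a st inp NM outM stt N.
pose L1 := (up_log 2 N).+1; pose D := (C0 * L1 + 4)%N.
have [[aN asurj _] _ _ k4] := inp; have [nrE szE frE sk [oE qE]] := stt.
apply: (@runs_leq _ _ _ _ (2 + (2 + ((2 * N) * D + 3).+1))); last first.
- have : (N * L1 <= N.+1 * L1)%N by rewrite leq_mul2r leqnSn orbT.
  have : (N <= N * L1)%N by rewrite leq_pmulr.
  have : (0 < N.+1 * L1)%N by rewrite muln_gt0.
  rewrite -/L1 /D; move: (N.+1 * L1)%N => X.
  have -> : (2 * N * (C0 * L1 + 4) = 2 * C0 * (N * L1) + 8 * N)%N by ring.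
  move: (N * L1)%N => Y X0 NY YX.
  have : (C0 * Y <= C0 * X)%N by rewrite leq_mul2l YX orbT.
  lia.
apply: (@runs_wp_seq _ _ (NSet v_top (NCst 0))); wp_steps.
apply: (@runs_wp_seq _ _ (NSet v_i (NVar v_size))); wp_steps.
apply: (@runs_while _ _ _ _ (fun f st' => f = (sweep_measure st' * D)%N /\
  sweep_at eps res kappa nr nb k a (rarr st res) st') (2 * N * D)).
- split; first by rewrite /sweep_measure; upd_simpl; rewrite szE addn0.
  split; upd_simpl; [ by split | by rewrite szE | ].
  split; rewrite ?szE //; last by move=> pos; lia.
  left; apply: hull_empty => r [_ [pos]]; lia.
- move=> f st1 fr [-> at1] /= i0; exists (C0 * L1)%N.
  apply: runs_weaken (step0 M kappa nr nb k a _ inp NM outM st1 at1 i0) _ _ =>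
    //.
  move=> st2 [at2 lt2]; exists (sweep_measure st2 * D)%N => //.
  have : ((sweep_measure st2).+1 * D <= sweep_measure st1 * D)%N.
    by rewrite leq_mul2r lt2 orbT.
  by rewrite mulSn {1}/D; lia.
- move=> f st1 fr /= i0 [_ [_ _ [_ _ _ ho hx]]]; split; last exact: hx.
  move: i0; rewrite -leqNgt leqn0 => /eqP i0 j jn.
  have [|pos posN e] := asurj (nr + j)%N; first by lia.
  have := ho pos; rewrite e i0 /= posN leq_addr addKn; exact.
Qed.

End SweepCorrect.

(** * Angles in the four rotated frames *)

Notation x_x := 2%N (only parsing).
Notation x_y := 3%N (only parsing).

Notation a_rho := 6%N (only parsing).
Notation a_lambda := 7%N (only parsing).

Definition set_keys (a1 a2 : nat) (pos : nexp) : cmd :=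
  RLoad x_x a1 (NVar v_i) ;; RLoad x_y a2 (NVar v_i) ;;
  RStore a_key1 pos
    (RAdd (RMul (RVar x_x) (RVar 0)) (RMul (RVar x_y) (RVar 1))) ;;
  RStore a_key2 pos
    (rsub (RMul (RVar x_y) (RVar 0)) (RMul (RVar x_x) (RVar 1))) ;;
  incr v_i.

(** The language has no constant pi; a quarter turn is obtained once as the arc cosine of 0. *)
Definition init_keys : cmd :=
  NSet v_i (NCst 0) ;;
  While (NLt (NVar v_i) (NVar v_red)) (set_keys 0 1 (NVar v_i)) ;;
  NSet v_i (NCst 0) ;;
  While (NLt (NVar v_i) (NVar v_blue))
    (set_keys 2 3 (NAdd (NVar v_red) (NVar v_i))) ;;
  NSet v_size (NAdd (NVar v_red) (NVar v_blue)) ;;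
  RSet x_quarter (RUn Acos (ROfN (NCst 0))).

Definition rotate_key : cmd :=
  load_key x_x x_y v_i ;;
  RStore a_key1 (NVar v_i) (RVar x_y) ;;
  RStore a_key2 (NVar v_i) (RUn Opp (RVar x_x)) ;;
  incr v_i.

Definition rotate_keys : cmd :=
  NSet v_i (NCst 0) ;;
  While (NLt (NVar v_i) (NVar v_size)) rotate_key.

Definition offsets : cmd :=
  NSet v_frame (NCst 0) ;;
  While (NLt (NVar v_frame) (NCst 4))
    (merge_sort ;; sweep true a_rho ;; sweep false a_lambda ;;
     rotate_keys ;; incr v_frame).

Section OffsetsCorrect.
Variable R : realType.
Implicit Types (st : state R) (M : nat) (u v : R * R).

(** Clockwise: turning the points back replaces turning the axes counterclockwise. *)
Definition rot90 v : R * R := (v.2, - v.1).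

(** Coordinates along the two given lines, scaled by the length of [u]. The scaling is harmless,
    since only signs and quotients of coordinate differences are used. *)
Definition key0 u (pts : seq (R * R)) i : R * R :=
  (dot (nth 0 pts i) u, dot (nth 0 pts i) (rotate (pi / 2) u)).

Lemma init_keys_correct : exists C, forall u red blue M,
  let N := (size red + size blue)%N in
  (N < M)%N ->
  runs M init_keys (input_state u red blue) (C * N.+1) (fun st =>
    [/\ nvar st v_red = size red, nvar st v_blue = size blue, nvar st v_size =
      N,
        forall i, (i < N)%N -> key st i = key0 u (red ++ blue) i
      & rvar st x_quarter = pi / 2]).
Proof.
set c1 := set_keys 0 1 (NVar v_i).
set c2 := set_keys 2 3 (NAdd (NVar v_red) (NVar v_i)).
exists (ccost c1 + ccost c2 + 30)%N => u red blue M N NM.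
have rot_u : rotate (pi / 2) u = (- u.2, u.1).
  by rewrite /rotate cos_pihalf sin_pihalf !mul0r !mul1r add0r addr0.
apply: (@runs_leq _ _ _ _ (2 + ((ccost c1 + 1 + 3) * (size red).+1 + (2 +
  ((ccost c2 + 1 + 3) * (size blue).+1 + 10))))); last first.
- by rewrite /N; nia.
apply: (@runs_wp_seq _ _ (NSet v_i (NCst 0))); wp_steps.
apply: runs_seq; set st0 := set_nvar _ _ _.
apply: (@runs_for _ _ _ _ _ (size red) _ (fun n st =>
  forall i, (i < n)%N -> key st i = key0 u (red ++ blue) i)) => //.
  move=> n st [fn fr fa fb] ti inv; split; first by rewrite /= fn.
  move=> nr; apply: runs_wp; wp_steps; rewrite ti; try (rewrite /N in NM; lia).
  split; first by rewrite addn1.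
  move=> i; rewrite ltnS leq_eqVlt /key; upd_simpl => /orP[/eqP->|lt].
    rewrite {1 2}/upd !eqxx !fr // !fb // /key0 rot_u nth_cat nr /dot /=.
    by congr pair; ring.
  rewrite /upd (ltn_eqF lt); exact: inv.
move=> st1 [fn1 fr1 fa1 fb1] ti1 inv1.
apply: (@runs_wp_seq _ _ (NSet v_i (NCst 0))); wp_steps.
apply: runs_seq; set st2 := set_nvar _ _ _.
apply: (@runs_for _ _ _ _ _ (size blue) _ (fun n st =>
  forall i, (i < size red + n)%N -> key st i = key0 u (red ++ blue) i)) => //.
- by move=> i; rewrite addn0; exact: inv1.
- move=> n st [fn fr fa fb] ti inv.
  split; first by rewrite /= fn // /st2; upd_simpl; rewrite fn1.
  have redE : nvar st v_red = size red by rewrite fn // /st2; upd_simpl;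
    rewrite fn1.
  move=> nr; apply: runs_wp; wp_steps; rewrite ti ?redE; try (rewrite /N in NM;
    lia).
  split; first by rewrite addn1.
  move=> i; rewrite addnS ltnS leq_eqVlt /key; upd_simpl => /orP[/eqP->|lt].
    rewrite {1 2}/upd !eqxx !fr // !fb // /st2; upd_simpl.
    rewrite !fr1 // !fb1 // /key0 rot_u nth_cat ltnNge leq_addr addKn /dot /=.
    by congr pair; ring.
  rewrite /upd (ltn_eqF lt); exact: inv.
move=> st3 [fn3 fr3 fa3 fb3] ti3 inv3.
have [n0 n1] : nvar st3 v_red = size red /\ nvar st3 v_blue = size blue.
  by rewrite !fn3 // /st2; upd_simpl; rewrite !fn1.
apply: (runs_leq (k1 := ccost
  (NSet v_size (NAdd (NVar v_red) (NVar v_blue)) ;;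
   RSet x_quarter (RUn Acos (ROfN (NCst 0)))))); [ | by []].
apply: runs_wp; wp_steps; rewrite n0 n1.
by split=> //; upd_simpl; rewrite acos0.
Qed.

Lemma rotate_keys_correct : exists C, forall M N st, (N < M)%N ->
  nvar st v_size = N ->
  runs M rotate_keys st (C * N.+1) (fun st' =>
    forall i, (i < N)%N -> key st' i = rot90 (key st i)).
Proof.
exists (ccost rotate_key + 10)%N => M N st NM sN.
apply: (@runs_leq _ _ _ _ (2 + (ccost rotate_key + 1 + 3) * N.+1)); last first.
- by nia.
apply: (@runs_wp_seq _ _ (NSet v_i (NCst 0))); wp_steps.
set st0 := set_nvar _ _ _.
apply: (@runs_for _ _ _ _ _ N _ (fun n st1 =>
  (forall i, (i < n)%N -> key st1 i = rot90 (key st i)) /\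
  (forall i, (n <= i)%N -> key st1 i = key st i))) => //.
- move=> n st1 [fn fr fa fb] ti [inv1 inv2]; split; first by rewrite /= fn.
  move=> nN; apply: runs_wp; wp_steps; rewrite ti; try lia.
  split; first by rewrite addn1.
  have [k1 k2] : rarr st1 a_key1 n = (key st n).1 /\ rarr st1 a_key2 n = (key
    st n).2.
    by rewrite -(inv2 n (leqnn n)).
  split=> i; rewrite /key; upd_simpl.
    rewrite ltnS leq_eqVlt => /orP[/eqP->|lt].
      by rewrite {1 2}/upd !eqxx k1 k2.
    by rewrite /upd (ltn_eqF lt); exact: inv1.
  by move=> ni; rewrite /upd (gtn_eqF ni); apply: inv2; exact: ltnW.
- by move=> st1 _ _ [].
Qed.

Lemma is_offset_ext eps kappa kappa' nr z (o : R) :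
  (forall i, (i < nr)%N -> kappa i = kappa' i) ->
  is_offset eps kappa nr z o -> is_offset eps kappa' nr z o.
Proof.
move=> e [h1 h2 h3]; split=> //.
- by move=> r [rn]; rewrite -e // => rp; exact: h2.
- case: h3 => [|[r [rn [rp r2]] ro]]; first by left.
  by right; exists r; rewrite -e.
Qed.

Definition rot90n k v := iter k rot90 v.

Lemma rot90_inj : injective rot90.
Proof. by move=> [a b] [c d] [-> /oppr_inj ->]. Qed.

Lemma offsets_correct : exists C, forall M nr nb kappa st,
  let N := (nr + nb)%N in
  (2 * N + 4 < M)%N -> (4 * nb < M)%N ->
  nvar st v_red = nr -> nvar st v_blue = nb -> nvar st v_size = N ->
  rvar st x_quarter = pi / 2 ->
  (forall i, (i < N)%N -> key st i = kappa i) ->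
  (forall i j, (i < N)%N -> (j < N)%N -> kappa i = kappa j -> i = j) ->
  runs M offsets st (C * (N.+1 * (up_log 2 N).+1)) (fun st' =>
    forall k j, (k < 4)%N -> (j < nb)%N ->
      is_offset true (fun i => rot90n k (kappa i)) nr
        (rot90n k (kappa (nr + j)%N)) (rarr st' a_rho (4 * j + k)%N) /\
      is_offset false (fun i => rot90n k (kappa i)) nr
        (rot90n k (kappa (nr + j)%N)) (rarr st' a_lambda (4 * j + k)%N)).
Proof.
have [C1 sort] := merge_sort_correct R.
have [C2 sweep1] := @sweep_correct R true a_rho isT.
have [C3 sweep2] := @sweep_correct R false a_lambda isT.
have [C4 rotk] := rotate_keys_correct.
exists (5 * (C1 + C2 + C3 + C4 + 100))%N => M nr nb kappa st N NM outM nrE nbE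
  szE qE kE inj.
pose Z := (N.+1 * (up_log 2 N).+1)%N.
have NZ : (N.+1 <= Z)%N by rewrite leq_pmulr.
have Z0 : (0 < Z)%N by rewrite muln_gt0.
rewrite -/Z; pose K := (C1 * Z + (C2 * Z + (C3 * Z + (C4 * N.+1 + 4))))%N.
apply: (@runs_leq _ _ _ _ (2 + (K + 1 + 3) * 5)); last first.
- by rewrite /K; nia.
apply: (@runs_wp_seq _ _ (NSet v_frame (NCst 0))); wp_steps.
apply: (@runs_for _ _ _ _ _ 4 K (fun n st1 =>
  (forall i, (i < N)%N -> key st1 i = rot90n n (kappa i)) /\
  forall k j, (k < n)%N -> (j < nb)%N ->
    is_offset true (fun i => rot90n k (kappa i)) nr
      (rot90n k (kappa (nr + j)%N)) (rarr st1 a_rho (4 * j + k)%N) /\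
    is_offset false (fun i => rot90n k (kappa i)) nr
      (rot90n k (kappa (nr + j)%N)) (rarr st1 a_lambda (4 * j + k)%N))) => //;
        last first.
  by move=> st1 _ _ [].
move=> n st1 [fn fr fa fb] ti [kE1 off1]; split=> // n4.
have {szE}szE1 : nvar st1 v_size = N by rewrite fn.
have {nrE}nrE1 : nvar st1 v_red = nr by rewrite fn.
have {qE}qE1 : rvar st1 x_quarter = pi / 2 by rewrite fr.
have {fn fr fa fb} _ := tt.
apply: runs_seq; apply: runs_weaken (runs_frame (sort M (key st1) N st1 _ szE1
  _)) _ _ => //.
  lia.
move=> st2 [[fn fr fa fb] [enum srt]].
have key2 : key st2 =1 key st1 by move=> i; rewrite /key !fb.
have inp : sweep_input (key st1) nr nb (narr st2 a_order) n.
  split=> // i j iN jN; rewrite !kE1 //; elim: (n) => [|n' IH];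
    first exact: inj.
  by move=> /rot90_inj; exact: IH.
have ss2 : sweep_state (key st1) nr nb (narr st2 a_order) n st2.
  by split; rewrite ?fn // fr.
have NM' : (nr + nb < M)%N by rewrite /N in NM; lia.
apply: runs_seq; apply: runs_weaken (runs_frame (sweep1 M _ _ _ _ _ st2 inp NM'
  outM ss2)) _ _ => //.
move=> st3 [[fn3 fr3 fa3 fb3] [off3 u3]].
have ss3 : sweep_state (key st1) nr nb (narr st2 a_order) n st3.
  case: ss2 => a1 a2 a3 a4 [a5 a6]; split; rewrite ?fn3 ?fa3 ?fr3 //.
  by move=> i; rewrite -a4 /key !fb3.
apply: runs_seq; apply: runs_weaken (runs_frame (sweep2 M _ _ _ _ _ st3 inp NM'
  outM ss3)) _ _ => //.
move=> st4 [[fn4 fr4 fa4 fb4] [off4 u4]].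
have szE4 : nvar st4 v_size = N by case: ss3 => _ a2 _ _ _; rewrite fn4.
apply: runs_seq; apply: runs_weaken (runs_frame (rotk M N st4 _ szE4)) _ _ =>
  //.
move=> st5 [[fn5 fr5 fa5 fb5] k5]; apply: runs_wp; wp_steps.
  by rewrite fn5 // fn4 // fn3 // fn // ti; lia.
split; first by rewrite fn5 // fn4 // fn3 // fn // ti addn1.
have kE4 i : key st4 i = key st1 i by rewrite -key2 /key !fb4 // !fb3.
have rhoE : rarr st5 a_rho = rarr st3 a_rho by rewrite fb5 // fb4.
have lamE : rarr st5 a_lambda = rarr st4 a_lambda by rewrite fb5.
split=> [i iN|k j]; first by rewrite [LHS]k5 // kE4 kE1.
upd_simpl; rewrite rhoE lamE ltnS leq_eqVlt => /orP[/eqP->|kn] jn.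
  rewrite -kE1; last by rewrite /N; lia.
  split.
  - by apply: is_offset_ext (off3 j jn) => i iN; rewrite kE1 // /N; lia.
  - by apply: is_offset_ext (off4 j jn) => i iN; rewrite kE1 // /N; lia.
(* Frames occupy different residues modulo 4, so the current sweeps leave the results of earlier
   frames intact. *)
have ne j' : (4 * j + k)%N != (4 * j' + n)%N by lia.
have [h1 h2] := off1 k j kn jn.
rewrite u3 // u4 // fb3 // !fb //.
Qed.

End OffsetsCorrect.

(** * Complement of a union of open intervals *)

Notation x_cur := 2%N (only parsing).
Notation x_left := 3%N (only parsing).
Notation x_right := 4%N (only parsing).

Definition full_turn : rexp := RMul (ROfN (NCst 4)) (RVar x_quarter).

Definition emit (closed : nat) (e : rexp) : cmd :=
  RStore 0 (NVar 0) (RVar x_cur) ;; RStore 1 (NVar 0) e ;;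
  NStore 0 (NVar 0) (NCst 1) ;; NStore 1 (NVar 0) (NCst closed) ;;
  incr 0.

(** The gap is emitted also when [x_left] equals [x_cur]: the intervals are open, so a common end
    point is a component consisting of one angle. Empty intervals and those starting at or after the
    full turn are skipped. *)
Definition complement_step : cmd :=
  NLoad v_id a_order (NVar v_i) ;; load_key x_left x_right v_id ;;
  If (BAnd (RLt (RVar x_left) (RVar x_right)) (RLt (RVar x_left) full_turn))
    (If (RLt (RVar x_left) (RVar x_cur)) Skip (emit 1 (RVar x_left)) ;;
     If (RLt (RVar x_cur) (RVar x_right)) (RSet x_cur (RVar x_right)) Skip)
    Skip ;;
  incr v_i.

(** As [x_cur] starts at 0, an interval with negative left end emits nothing. The last component is
    open on the right because the full turn itself is excluded. *)
Definition complement : cmd :=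
  NSet 0 (NCst 0) ;; RSet x_cur (ROfN (NCst 0)) ;; NSet v_i (NCst 0) ;;
  While (NLt (NVar v_i) (NVar v_size)) complement_step ;;
  If (RLt (RVar x_cur) full_turn) (emit 0 full_turn) Skip.

Section Components.
Variable R : realType.
Implicit Types (A I : set R) (x y t : R).

(** A connected subset of the line is an interval, so it cannot pass the point outside [A] that
    separates [t] from a point of [A] outside [I]. *)
Lemma interval_component A I t : is_interval I -> I `<=` A -> I t ->
  (forall x, A x -> ~ I x -> exists2 y, ~ A y & x < y < t \/ t < y < x) ->
  connected_component A t = I.
Proof.
move=> itvI IA It sep; apply/seteqP; split; last first.
  by apply: connected_component_max => //; apply/connected_intervalP.
move=> x cx; apply: contrapT => nIx.
have [y nAy yb] := sep x (connected_component_sub cx) nIx.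
apply: nAy; apply: (@connected_component_sub _ A t).
have /connected_intervalP itvC := @component_connected _ A t.
have ct : connected_component A t t by apply: connected_component_refl;
  exact: IA.
by case: yb => /andP[xy yt]; [apply: (itvC x t) | apply: (itvC t x)] => //;
  rewrite !ltW.
Qed.

End Components.

Section Complement.
Variables (R : realType) (kappa : nat -> R * R) (N : nat) (T : R).
Implicit Types (a : nat -> nat) (L U : nat -> R).

Definition covered t := exists2 j, (j < N)%N & (kappa j).1 < t < (kappa j).2.

Definition uncovered : set R := [set t | 0 <= t < T /\ ~ covered t].

(* [L c, U c] for [c < n] are the gaps left so far by the open intervals in the
   positions below [i] of the order [a], and [x] bounds these intervals. *)
Record complement_inv a i n x L U : Prop := ComplementInv {
  cpl_ge0 : 0 <= x;
  cpl_bound : forall pos, (pos < i)%N -> (kappa (a pos)).1 < (kappa (a pos)).2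
    ->
    (kappa (a pos)).1 < T -> (kappa (a pos)).2 <= x;
  cpl_cur : x = 0 \/ exists2 j, (j < N)%N & (kappa j).1 < x <= (kappa j).2;
  cpl_gap : forall c, (c < n)%N -> [/\ 0 <= L c, L c <= U c, U c < x & U c < T];
  cpl_order : forall c d, (c < d)%N -> (d < n)%N -> U c < L d;
  cpl_left : forall c, (c < n)%N ->
    L c = 0 \/ exists2 j, (j < N)%N & (kappa j).1 < L c <= (kappa j).2;
  cpl_right : forall c, (c < n)%N ->
    exists2 j, (j < N)%N & (kappa j).1 = U c /\ U c < (kappa j).2;
  cpl_free : forall c t, (c < n)%N -> L c <= t <= U c -> ~ covered t;
  cpl_full : forall t, 0 <= t < x -> t < T -> covered t \/
    exists2 c, (c < n)%N & L c <= t <= U c }.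

Variable a : nat -> nat.
Hypothesis enum_a : enumerates a N.
Hypothesis sorted_a : forall i j, (i <= j)%N -> (j < N)%N ->
  key_le kappa (a i) (a j).

Lemma key_le_fst i j : key_le kappa i j -> (kappa i).1 <= (kappa j).1.
Proof.
rewrite /key_le /lex_le /lex_pos /= negb_or => /andP[]; rewrite -leNgt; lra.
Qed.

Lemma complement_start L U : complement_inv a 0 0 0 L U.
Proof.
split=> //; first by left.
by move=> t h; exfalso; lra.
Qed.

Lemma complement_skip i n x L U : complement_inv a i n x L U ->
  ~~ (((kappa (a i)).1 < (kappa (a i)).2) && ((kappa (a i)).1 < T)) ->
  complement_inv a i.+1 n x L U.
Proof.
move=> [h1 h2 h3 h4 h5 h6 h7 h8 h9] ne; split=> //.
move=> pos; rewrite ltnS leq_eqVlt => /orP[/eqP->|pi]; last exact: h2.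
by move=> p1 p2; rewrite p1 p2 in ne.
Qed.

Lemma complement_hit i n x L U : (i < N)%N -> complement_inv a i n x L U ->
  (kappa (a i)).1 < (kappa (a i)).2 -> (kappa (a i)).1 < T ->
  (kappa (a i)).1 < x ->
  complement_inv a i.+1 n (Num.max x (kappa (a i)).2) L U.
Proof.
move=> iN [h1 h2 h3 h4 h5 h6 h7 h8 h9] lr lT lx.
have [aN _ _] := enum_a.
have xm : x <= Num.max x (kappa (a i)).2 by rewrite le_max lexx.
split=> //.
- exact: le_trans xm.
- move=> pos; rewrite ltnS leq_eqVlt => /orP[/eqP-> _ _|pi p1 p2].
    by rewrite le_max lexx orbT.
  exact: le_trans (h2 _ pi p1 p2) xm.
- have [xr|rx] := ltP x (kappa (a i)).2; last by case: h3; [left | right].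
  by right; exists (a i); [exact: aN | rewrite lr lexx].
- by move=> c cn; have [? ? ? ?] := h4 c cn; split=> //; exact: lt_le_trans xm.
- move=> t /andP[t0]; rewrite lt_max => /orP[tx|tr] tT; first by apply: h9;
    rewrite ?t0.
  have [tx|xt] := ltP t x; first by apply: h9; rewrite ?t0.
  by left; exists (a i); [exact: aN | rewrite tr andbT; exact: lt_le_trans xt].
Qed.

(** An interval earlier in the order ends by [x], and a later one starts no earlier than the [i]-th.
    Those excluded from the bound, starting at [T] or beyond, cannot reach [t < T]. *)
Lemma not_covered_between i x t : (i < N)%N ->
  (forall pos, (pos < i)%N -> (kappa (a pos)).1 < (kappa (a pos)).2 ->
    (kappa (a pos)).1 < T -> (kappa (a pos)).2 <= x) ->
  x <= t -> t <= (kappa (a i)).1 -> t < T -> ~ covered t.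
Proof.
move=> iN bound xt ti tT [j jN /andP[jt tj]].
have [_ asurj _] := enum_a; have [pos pN pj] := asurj j jN.
rewrite -pj in jt tj; have [pi|ip] := ltnP pos i.
  have := bound pos pi (lt_trans jt tj) (lt_trans jt tT); lra.
by have := key_le_fst (sorted_a ip pN); lra.
Qed.

Lemma complement_emit i n x L U : (i < N)%N -> complement_inv a i n x L U ->
  (kappa (a i)).1 < (kappa (a i)).2 -> (kappa (a i)).1 < T ->
  x <= (kappa (a i)).1 ->
  complement_inv a i.+1 n.+1 (Num.max x (kappa (a i)).2)
    (upd L n x) (upd U n (kappa (a i)).1).
Proof.
move=> iN [h1 h2 h3 h4 h5 h6 h7 h8 h9] lr lT xl.
have [aN _ _] := enum_a.
have xr : x < (kappa (a i)).2 by exact: le_lt_trans lr.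
have -> : Num.max x (kappa (a i)).2 = (kappa (a i)).2 by rewrite max_r // ltW.
have un f v : upd f n v n = v :> R by rewrite /upd eqxx.
have ul (f : nat -> R) v c : (c < n)%N -> upd f n v c = f c.
  by move=> cn; rewrite /upd (ltn_eqF cn).
split=> //.
- by apply: ltW; exact: le_lt_trans xr.
- move=> pos; rewrite ltnS leq_eqVlt => /orP[/eqP-> //|pi p1 p2].
  by apply: le_trans (h2 _ pi p1 p2) _; exact: ltW.
- by right; exists (a i); [exact: aN | rewrite lr lexx].
- move=> c; rewrite ltnS leq_eqVlt => /orP[/eqP->|cn]; first by rewrite !un;
    split.
  by rewrite !ul //; have [? ? ux ?] := h4 c cn; split=> //; exact: lt_trans xr.
- move=> c d cd; rewrite ltnS leq_eqVlt => /orP[/eqP dn|dn]; last first.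
    by rewrite (ul _ _ _ dn) (ul _ _ _ (ltn_trans cd dn)); exact: h5.
  rewrite dn in cd *; rewrite un (ul _ _ _ cd).
  by have [] := h4 c cd.
- move=> c; rewrite ltnS leq_eqVlt => /orP[/eqP->|cn]; first by rewrite un.
  by rewrite ul //; exact: h6.
- move=> c; rewrite ltnS leq_eqVlt => /orP[/eqP->|cn]; last by rewrite ul //;
    exact: h7.
  by rewrite un; exists (a i); first exact: aN.
- move=> c t; rewrite ltnS leq_eqVlt => /orP[/eqP->|cn]; last first.
    by rewrite !ul //; exact: h8.
  rewrite !un => /andP[xt ti]; apply: (not_covered_between iN h2) => //.
  exact: le_lt_trans lT.
- move=> t /andP[t0 tr] tT; have [tx|xt] := ltP t x.
    have t0x : 0 <= t < x by rewrite t0.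
    have [ct|[c cn ct]] := h9 t t0x tT; first by left.
    by right; exists c; [exact: ltnW | rewrite !ul].
  have [lt|tl] := ltP (kappa (a i)).1 t.
    by left; exists (a i); [exact: aN | rewrite lt tr].
  by right; exists n => //; rewrite !un xt tl.
Qed.

(** The clauses [result_left] and [result_right] carry maximality: unless it is 0 or [T], each end
    of a listed interval has covered angles immediately outside it. *)
Record complement_result n L U (closed : nat -> bool) : Prop :=
  ComplementResult {
  result_ge0 : forall c, (c < n)%N -> 0 <= L c /\ L c < U c ?<= if closed c;
  result_end : forall c, (c < n)%N ->
    if closed c then U c < T else U c == T;
  result_order : forall c d, (c < d)%N -> (d < n)%N -> U c < L d;
  result_left : forall c, (c < n)%N ->
    L c = 0 \/ exists2 j, (j < N)%N & (kappa j).1 < L c <= (kappa j).2;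
  result_right : forall c, (c < n)%N -> closed c ->
    exists2 j, (j < N)%N & (kappa j).1 = U c /\ U c < (kappa j).2;
  result_free : forall c t, (c < n)%N -> L c <= t -> t < U c ?<= if closed c ->
    ~ covered t;
  result_full : forall t, 0 <= t < T -> covered t \/
    exists2 c, (c < n)%N & L c <= t /\ t < U c ?<= if closed c }.

Lemma complement_result_stop n x L U (closed : nat -> bool) : T <= x ->
  (forall c, (c < n)%N -> closed c) -> complement_inv a N n x L U ->
  complement_result n L U closed.
Proof.
move=> Tx cl [h1 h2 h3 h4 h5 h6 h7 h8 h9]; split=> //.
- by move=> c cn; rewrite (cl c cn); have [] := h4 c cn.
- by move=> c cn; rewrite (cl c cn); have [] := h4 c cn.
- by move=> c cn _; exact: h7.
- by move=> c t cn; rewrite (cl c cn) /= => lt tu; apply: (h8 c) => //;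
    rewrite lt.
- move=> t /andP[t0 tT]; have [|ct|[c cn /andP[lt tu]]] := h9 t _ tT.
  + by rewrite t0; exact: lt_le_trans Tx.
  + by left.
  + by right; exists c => //; rewrite (cl c cn).
Qed.

Lemma complement_result_last n x L U (closed : nat -> bool) : x < T ->
  (forall c, (c < n)%N -> closed c) -> closed n = false ->
  complement_inv a N n x L U ->
  complement_result n.+1 (upd L n x) (upd U n T) closed.
Proof.
move=> xT cl ncl [h1 h2 h3 h4 h5 h6 h7 h8 h9].
have un f v : upd f n v n = v :> R by rewrite /upd eqxx.
have ul (f : nat -> R) v c : (c < n)%N -> upd f n v c = f c.
  by move=> cn; rewrite /upd (ltn_eqF cn).
split.
- move=> c; rewrite ltnS leq_eqVlt => /orP[/eqP->|cn]; first by rewrite !un ncl.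
  by rewrite !ul // (cl c cn); have [] := h4 c cn.
- move=> c; rewrite ltnS leq_eqVlt => /orP[/eqP->|cn];
    first by rewrite un ncl eqxx.
  by rewrite ul // (cl c cn); have [] := h4 c cn.
- move=> c d cd; rewrite ltnS leq_eqVlt => /orP[/eqP dn|dn]; last first.
    by rewrite (ul _ _ _ dn) (ul _ _ _ (ltn_trans cd dn)); exact: h5.
  rewrite dn in cd *; rewrite un (ul _ _ _ cd).
  by have [] := h4 c cd.
- move=> c; rewrite ltnS leq_eqVlt => /orP[/eqP->|cn]; first by rewrite un.
  by rewrite ul //; exact: h6.
- move=> c; rewrite ltnS leq_eqVlt => /orP[/eqP->|cn]; first by rewrite ncl.
  by rewrite ul // => _; exact: h7.
- move=> c t; rewrite ltnS leq_eqVlt => /orP[/eqP->|cn]; last first.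
    by rewrite !ul // (cl c cn) /= => lt tu; apply: (h8 c) => //; rewrite lt.
  rewrite !un ncl /= => xt tT [j jN /andP[jt tj]].
  have [_ asurj _] := enum_a; have [pos pN pj] := asurj j jN.
  rewrite -pj in jt tj.
  have := h2 pos pN (lt_trans jt tj) (lt_trans jt tT); lra.
- move=> t /andP[t0 tT]; have [tx|xt] := ltP t x; last first.
    by right; exists n => //; rewrite !un ncl.
  have t0x : 0 <= t < x by rewrite t0.
  have [ct|[c cn /andP[lt tu]]] := h9 t t0x tT; first by left.
  by right; exists c; [exact: ltnW | rewrite !ul // (cl c cn)].
Qed.

Lemma complement_result_outputs (st : state R) n (cl : nat -> bool) :
  output_size st = n ->
  complement_result n (rarr st 0%N) (rarr st 1%N) cl ->
  (forall c, (c < n)%N -> narr st 0%N c != 0%N) ->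
  (forall c, (c < n)%N -> (narr st 1%N c != 0%N) = cl c) ->
  outputs_intervals st uncovered.
Proof.
move=> sz [h1 h2 h3 h4 h5 h6 h7] flag clE; rewrite /outputs_intervals sz.
set L := rarr st 0%N in h1 h3 h4 h6 h7 *; set U := rarr st 1%N in h1 h2 h3 h5
  h6 h7 *.
have outE c t : (c < n)%N ->
    output_interval st c t <-> L c <= t /\ t < U c ?<= if cl c.
  by move=> cn; rewrite /output_interval /= flag // clE //=;
    split=> [/andP[]|[-> ->]].
have le_end c t : (c < n)%N -> t < U c ?<= if cl c -> t <= U c /\ t < T.
  by move=> cn; have := h2 c cn; case: (cl c) => /= [e|/eqP e] tu; split; lra.
have sub c : (c < n)%N -> output_interval st c `<=` uncovered.
  move=> cn t /(outE _ _ cn)[lt tu]; split; last exact: h6 lt tu.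
  have [l0 _] := h1 c cn; have [_ ->] := le_end c t cn tu.
  by rewrite andbT; exact: le_trans lt.
split.
- apply/seteqP; split=> [t [/andP[t0 tT] nc]|t [c cn]]; last exact: sub.
  have [|//|[c cn ct]] := h7 t; first by rewrite t0.
  by exists c => //; apply/outE.
- move=> c cn; have [l0 lu] := h1 c cn.
  have lc : output_interval st c (L c) by apply/outE.
  exists (L c); first exact: sub lc.
  apply/esym/interval_component => //; last 1 first.
  + move=> x [/andP[x0 xT] ncx] nx; have [xl|lx] := ltP x (L c).
      case: (h4 c cn) => [e|[j jN /andP[j1 j2]]];
        first by have := le_lt_trans x0 xl; rewrite e ltxx.
      (* A covered point strictly between [x] and [L c]: it lies in the interval [j], which reaches
         at least up to [L c]. *)
      pose y := (Num.max x (kappa j).1 + L c) / 2.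
      have [m1 m2] : x <= Num.max x (kappa j).1 /\ (kappa j).1 <= Num.max x
        (kappa j).1.
        by rewrite !le_max !lexx orbT.
      have m3 : Num.max x (kappa j).1 < L c by rewrite gt_max xl.
      exists y; last by left; rewrite /y; apply/andP; split; lra.
      by case=> _; apply; exists j => //; rewrite /y; apply/andP; split; lra.
    have nxu : ~ x < U c ?<= if cl c by move=> xu; apply: nx; apply/outE.
    have [ec|ec] := boolP (cl c); last first.
      have := h2 c cn; rewrite (negPf ec) => /eqP e; case: nxu;
        rewrite (negPf ec) /=.
      by rewrite e.
    rewrite ec /= in nxu; have ux : U c < x by rewrite ltNge; apply/negP.
    have [j jN [j1 j2]] := h5 c cn ec.
    pose y := (U c + Num.min x (kappa j).2) / 2.
    have [m1 m2] : Num.min x (kappa j).2 <= x /\ Num.min x (kappa j).2 <=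
      (kappa j).2.
      by rewrite !ge_min !lexx orbT.
    have m3 : U c < Num.min x (kappa j).2 by rewrite lt_min ux.
    have lu' : L c <= U c by move: lu; rewrite ec.
    exists y; last by right; rewrite /y; apply/andP; split; lra.
    by case=> _; apply; exists j => //; rewrite /y; apply/andP; split; lra.
  + move=> x y /(outE _ _ cn)[lx xu] /(outE _ _ cn)[ly yu] z /andP[xz zy].
    apply/(outE _ _ cn); split; first exact: le_trans xz.
    by move: yu; case: (cl c) => /= yu; [exact: le_trans yu | exact:
      le_lt_trans yu].
  + exact: sub.
- have dis c d t : (c < d)%N -> (d < n)%N -> output_interval st c t ->
      output_interval st d t -> False.
    move=> cd dn /(outE _ _ (ltn_trans cd dn))[_ tu] /(outE _ _ dn)[lt _].
    have [tu' _] := le_end c t (ltn_trans cd dn) tu.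
    by have := h3 c d cd dn; lra.
  move=> c d /= cn dn [t [ct dt]]; have [cd|dc|//] := ltngtP c d.
    by case: (dis c d t).
  by case: (dis d c t).
Qed.

End Complement.

Section ComplementCorrect.
Variable R : realType.
Implicit Types (st : state R) (M : nat).

Lemma complement_correct : exists C, forall M N kappa st,
  (N + 1 < M)%N -> nvar st v_size = N -> key st =1 kappa ->
  rvar st x_quarter = pi / 2 ->
  enumerates (narr st a_order) N ->
  (forall i j, (i <= j)%N -> (j < N)%N ->
    key_le kappa (narr st a_order i) (narr st a_order j)) ->
  runs M complement st (C * N.+1) (fun st' =>
    outputs_intervals st' (uncovered kappa N (2 * pi))).
Proof.
pose fin : cmd := If (RLt (RVar x_cur) full_turn) (emit 0 full_turn) Skip.
exists (ccost complement_step + ccost fin + 20)%N.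
move=> M N kappa st NM szE kE qE enum srt.
apply: (@runs_leq _ _ _ _ (2 + (3 + (2 + ((ccost complement_step + 1 + 3) *
  N.+1 + ccost fin))))); last first.
- by move: (ccost fin) (ccost complement_step) => X Y; nia.
have fullE st' : rvar st' x_quarter = pi / 2 -> reval st' full_turn = 2 * pi.
  by rewrite /= => ->; field.
pose a := narr st a_order.
apply: (@runs_wp_seq _ _ (NSet 0 (NCst 0))); wp_steps.
apply: (@runs_wp_seq _ _ (RSet x_cur (ROfN (NCst 0)))); wp_steps.
apply: (@runs_wp_seq _ _ (NSet v_i (NCst 0))); wp_steps.
apply: runs_seq.
apply: (@runs_for _ _ _ _ _ N (ccost complement_step) (fun i st1 =>
  [/\ complement_inv kappa N (2 * pi) a i (nvar st1 0%N) (rvar st1 x_cur)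
       (rarr st1 0%N) (rarr st1 1%N), (nvar st1 0%N <= i)%N
    & forall c, (c < nvar st1 0%N)%N -> narr st1 0%N c != 0%N /\ narr st1 1%N c
      != 0%N])) => //.
- by split=> //; exact: complement_start.
- move=> i st1 [fn fr fa fb] ti [inv ni flag]; split; first by rewrite /= fn.
  move=> iN; apply: runs_wp.
  have aE : narr st1 a_order = a by rewrite fa.
  have sk1 j : rarr st1 a_key1 j = (kappa j).1 by rewrite fb // -kE.
  have sk2 j : rarr st1 a_key2 j = (kappa j).2 by rewrite fb // -kE.
  have aN : (a i < N)%N by case: enum => h _ _; exact: h.
  have qE1 : rvar st1 x_quarter = pi / 2 by rewrite fr.
  pose Q (st2 : state R) := nvar st2 v_i = i /\
    [/\ complement_inv kappa N (2 * pi) a i.+1 (nvar st2 0%N) (rvar st2 x_cur)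
       (rarr st2 0%N) (rarr st2 1%N), (nvar st2 0%N <= i.+1)%N
    & forall c, (c < nvar st2 0%N)%N -> narr st2 0%N c != 0%N /\ narr st2 1%N c
      != 0%N].
  have finish st2 : Q st2 -> wp M (incr v_i) (fun st' => nvar st' v_i = i.+1 /\
      [/\ complement_inv kappa N (2 * pi) a i.+1 (nvar st' 0%N) (rvar st' x_cur)
         (rarr st' 0%N) (rarr st' 1%N), (nvar st' 0%N <= i.+1)%N
      & forall c, (c < nvar st' 0%N)%N ->
          narr st' 0%N c != 0%N /\ narr st' 1%N c != 0%N]) st2.
    by move=> [iE q]; wp_steps; rewrite iE; split; rewrite ?addn1.
  do 3 wp_step; rewrite ?ti ?aE; try lia.
  do 4 wp_step; rewrite ?ti ?aE ?sk1 ?sk2; try lia.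
  wp_step; wp_step.
  wp_step; rewrite fullE // ?sk2.
  case: ifPn => [/andP[lr lT]|skip]; last first.
    wp_step; apply: finish; rewrite /Q; upd_simpl; split=> //.
    by split=> //; [exact: complement_skip | exact: leqW].
  do 2 wp_step; case: ltP => [lx|xl].
    do 2 wp_step; rewrite ?sk2.
    have inv' := complement_hit enum iN inv lr lT lx.
    case: ltP => xr; wp_step; apply: finish; rewrite /Q; upd_simpl; split=> //;
      (split=> //; last exact: leqW).
    + by rewrite max_r ?ltW // in inv'.
    + by rewrite max_l in inv'.
  have inv' := complement_emit enum srt iN inv lr lT xl.
  have xr : rvar st1 x_cur < (kappa (a i)).2 by exact: le_lt_trans lr.
  rewrite max_r ?ltW // in inv'.
  wp_steps; try lia; rewrite ?sk2 ?xr.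
  wp_step; apply: finish; rewrite /Q; upd_simpl; rewrite addn1.
  split=> //; split=> // c; rewrite ltnS leq_eqVlt /upd.
  by case: eqP => [->|_] /=; [rewrite ?eqxx | exact: flag].
move=> st1 [fn1 fr1 fa1 fb1] ti [inv ni flag].
have qE1 : rvar st1 x_quarter = pi / 2 by rewrite fr1.
apply: runs_wp; wp_step; rewrite fullE //.
case: ltP => xT; last first.
  wp_step; pose cl (c : nat) := true.
  apply: (complement_result_outputs (n := nvar st1 0%N) (cl := cl)) => //.
  - exact: complement_result_stop xT _ inv.
  - by move=> c /flag[].
  - by move=> c /flag[].
pose cl c := c != nvar st1 0%N.
wp_steps; rewrite ?fullE //; try lia.
have ncl : cl (nvar st1 0%N) = false by rewrite /cl eqxx.
have cll c : (c < nvar st1 0%N)%N -> cl c by move=> cn; rewrite /cl ltn_eqF.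
apply: (complement_result_outputs (n := (nvar st1 0%N).+1) (cl := cl)).
- by rewrite /output_size; upd_simpl; rewrite addn1.
- upd_simpl; exact: (complement_result_last enum xT cll ncl inv).
- move=> c; rewrite ltnS leq_eqVlt; upd_simpl; rewrite /upd.
  by case: eqP => [->|_] //= /flag[].
- move=> c; rewrite ltnS leq_eqVlt; upd_simpl; rewrite /upd /cl.
  by case: eqP => [->|_] //= /flag[].
Qed.

End ComplementCorrect.

(** * Gaps of the blue points and their translates *)

Notation x_start := 2%N (only parsing).
Notation x_end := 3%N (only parsing).
Notation x_high := 4%N (only parsing).
Notation x_low := 5%N (only parsing).

Notation gap_base := (NMul (NCst 4) (NDiv (NVar v_i) (NCst 24))).

(** The subtraction of 2 is done on reals, since natural subtraction would truncate the two negative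
    shifts. *)
Definition gap_shift : rexp :=
  RMul (rsub (ROfN (NSub (NVar v_i) (NMul (NCst 6) (NDiv (NVar v_i) (NCst 6)))))
             (ROfN (NCst 2)))
       (RVar x_quarter).

Definition gap_candidate_cmd k : cmd :=
  RLoad x_high a_lambda (NAdd gap_base (NCst ((k + 2) %% 4))) ;;
  RLoad x_low a_rho (NAdd gap_base (NCst k)) ;;
  RSet x_low (rsub (RVar x_quarter) (RVar x_low)) ;;
  If (RLt (RVar x_start) (RVar x_high)) Skip
    (RSet x_low (RAdd (RVar x_low) (RVar x_quarter))) ;;
  If (RLt (RVar x_low) (RVar x_end)) (RSet x_end (RVar x_low)) Skip.

(** Cell [24 * j + 6 * m + i] stands for blue point [j], the gap starting at its [m]-th stored
    angle, and translate [i]. Its quotient by 6 is therefore the address [4 * j + m] in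
    [a_lambda]. *)
Definition gap_step : cmd :=
  RLoad x_start a_lambda (NDiv (NVar v_i) (NCst 6)) ;;
  RSet x_end (RMul (ROfN (NCst 2)) (RVar x_quarter)) ;;
  gap_candidate_cmd 0 ;; gap_candidate_cmd 1 ;;
  gap_candidate_cmd 2 ;; gap_candidate_cmd 3 ;;
  RStore a_key1 (NVar v_i) (RAdd (RVar x_start) gap_shift) ;;
  RStore a_key2 (NVar v_i) (RAdd (RVar x_end) gap_shift) ;;
  incr v_i.

Definition gaps : cmd :=
  NSet v_size (NMul (NCst 24) (NVar v_blue)) ;;
  NSet v_i (NCst 0) ;;
  While (NLt (NVar v_i) (NVar v_size)) gap_step.

Section GapsCorrect.
Variable R : realType.
Implicit Types (st : state R) (M : nat) (low high : nat -> R) (x p : R).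

(* For good intervals [low k, high k] modulo [p], the open interval from [x] to
   [gap_end p low high x] is the gap that starts at [x = high k], empty if [x]
   lies inside another interval; [2 * p] bounds all candidates. *)
Definition gap_candidate p low high x k :=
  if x < high k then low k else low k + p.

Definition gap_end p low high x :=
  \big[Num.min/2 * p]_(k <- [:: 3; 2; 1; 0]%N) gap_candidate p low high x k.

Definition low_of (rho : nat -> R) j k : R := pi / 2 - rho (4 * j + k)%N.
(** A half turn makes the points before the viewpoint lexicographically positive and reverses the
    axis; hence the angle comes from frame [k + 2], swept with orientation [false]. *)
Definition high_of (lam : nat -> R) j k : R := lam (4 * j + (k + 2) %% 4)%N.

Definition shift_of t : R := ((t - 6 * (t %/ 6))%:R - 2) * (pi / 2).

Definition gap_key rho lam t : R * R :=
  let x := lam (t %/ 6)%N in let j := (t %/ 24)%N in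
  (x + shift_of t,
   gap_end (pi / 2) (low_of rho j) (high_of lam j) x + shift_of t).

Lemma gap_candidate_correct M k st e : (k < 4)%N ->
  let j := (nvar st v_i %/ 24)%N in
  (4 * j + 4 <= M)%N -> rvar st x_quarter = pi / 2 -> rvar st x_end = e ->
  runs M (gap_candidate_cmd k) st (ccost (gap_candidate_cmd k)) (fun st' =>
     rvar st' x_end = Num.min (gap_candidate (pi / 2) (low_of (rarr st a_rho) j)
       (high_of (rarr st a_lambda) j) (rvar st x_start) k) e).
Proof.
move=> k4 j jM qE eE; have kM : ((k + 2) %% 4 < 4)%N by rewrite ltn_mod.
apply: runs_wp; wp_steps; rewrite -?/j; try lia.
rewrite /gap_candidate -/(high_of (rarr st a_lambda) j k) qE.
rewrite -/(low_of (rarr st a_rho) j k).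
by case: (_ < high_of _ _ _); wp_steps; rewrite ?qE eE; case: ltP => le;
  wp_steps;
  rewrite /= ?eE ?(min_l (ltW le)) ?(min_r le).
Qed.

Lemma gap_step_correct : exists C, forall M nb st,
  (4 * nb < M)%N -> rvar st x_quarter = pi / 2 ->
  (nvar st v_i < 24 * nb)%N -> (nvar st v_i < M)%N ->
  runs M gap_step st C (fun st' =>
    [/\ nvar st' v_i = (nvar st v_i).+1,
        key st' (nvar st v_i) =
          gap_key (rarr st a_rho) (rarr st a_lambda) (nvar st v_i)
      & forall t, t != nvar st v_i -> key st' t = key st t]).
Proof.
pose cc k := ccost (gap_candidate_cmd k).
eexists => M nb st nM qE tn tM.
pose j := (nvar st v_i %/ 24)%N.
have jM : (4 * j + 4 <= M)%N by rewrite /j; lia.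
set rho := rarr st a_rho; set lam := rarr st a_lambda.
apply: (@runs_wp_seq _ _ (RLoad x_start _ _)); wp_steps.
apply: (@runs_wp_seq _ _ (RSet x_end _)); wp_steps.
set st0 := set_rvar _ _ _.
pose pre (e : R) (st1 : state R) := [/\ rvar st1 x_end = e,
  rvar st1 x_start = lam (nvar st v_i %/ 6)%N,
  nvar st1 v_i = nvar st v_i & rarr st1 = rarr st /\ rvar st1 x_quarter = pi /
    2].
have pre0 : pre (2 * (pi / 2)) st0.
  by split; rewrite /st0; upd_simpl; rewrite ?qE.
have step k e c st1 K Q : (k < 4)%N -> pre e st1 ->
    (forall st2, pre (Num.min (gap_candidate (pi / 2) (low_of rho j)
       (high_of lam j) (lam (nvar st v_i %/ 6)%N) k) e) st2 -> runs M c st2 K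
         Q) ->
    runs M (gap_candidate_cmd k ;; c) st1 (cc k + K) Q.
  move=> k4 [eE sE iE [aE q1E]] rest; apply: runs_seq.
  have h := @gap_candidate_correct M k st1 e k4; rewrite iE aE sE in h.
  have run := runs_frame (h jM q1E eE).
  apply: (runs_weaken run) => // st2 [[fn fr fa fb] e2]; apply: rest.
  split=> //; [by rewrite fr | by rewrite fn | split; last by rewrite fr].
  by apply/funext => x; rewrite fb // aE.
apply: (step _ _ _ _ _ _ _ pre0) => // st1 pre1.
apply: (step _ _ _ _ _ _ _ pre1) => // st2 pre2.
apply: (step _ _ _ _ _ _ _ pre2) => // st3 pre3.
apply: (step _ _ _ _ _ _ _ pre3) => // st4 [e4 s4 i4 [a4 q4]].
apply: runs_wp; wp_steps; rewrite ?i4 //.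
split; first by rewrite addn1.
- rewrite /key; upd_simpl; rewrite /upd !eqxx s4 e4 /gap_key -/j.
  rewrite /gap_end !big_cons big_nil /shift_of /= ?i4 ?q4.
  by congr pair.
- by move=> t ti; rewrite /key; upd_simpl; rewrite /upd (negPf ti) a4.
Qed.

Lemma gaps_correct : exists C, forall M nb st,
  (24 * nb < M)%N -> nvar st v_blue = nb -> rvar st x_quarter = pi / 2 ->
  runs M gaps st (C * nb.+1) (fun st' =>
    [/\ nvar st' v_size = (24 * nb)%N, rvar st' x_quarter = pi / 2
    & forall t, (t < 24 * nb)%N ->
      key st' t = gap_key (rarr st a_rho) (rarr st a_lambda) t]).
Proof.
have [C step] := gap_step_correct.
exists (24 * (C + 20))%N => M nb st nM nbE qE.
apply: (@runs_leq _ _ _ _ (4 + (2 + (C + 1 + 3) * (24 * nb).+1))); last first.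
- by nia.
apply: (@runs_wp_seq _ _ (NSet v_size _)); wp_steps; rewrite ?nbE; try lia.
apply: (@runs_wp_seq _ _ (NSet v_i (NCst 0))); wp_steps.
set st0 := set_nvar _ _ _.
apply: (@runs_for _ _ _ _ _ (24 * nb) C (fun n st' => forall t, (t < n)%N ->
  key st' t = gap_key (rarr st a_rho) (rarr st a_lambda) t)) => //.
- move=> i st1 [fn fr fa fb] ti inv; split; first by rewrite /= fn.
  move=> iN; have [||||] := step M nb st1.
  + by lia.
  + by rewrite fr.
  + by rewrite ti.
  + by rewrite ti; lia.
  move=> t [st2 [e le [i2 k2 o2]]]; exists t, st2; split=> //.
  rewrite i2 ti; split=> // t'; rewrite ltnS leq_eqVlt => /orP[/eqP->|lt].
    by rewrite -ti k2 !fb.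
  by rewrite o2 ?inv // ti neq_ltn lt.
- by move=> st1 [fn fr fa fb] _ inv; split; rewrite ?fn ?fr.
Qed.

End GapsCorrect.

(** * From quadrants to angular intervals *)

Section CircularGaps.
Variable R : realType.
Implicit Types (p x y t : R) (low high : nat -> R).

Lemma lt_gap_end p low high x y : y < gap_end p low high x <->
  y < 2 * p /\ forall k, (k < 4)%N -> y < gap_candidate p low high x k.
Proof.
rewrite /gap_end !big_cons big_nil !lt_min; split.
  by move=> /and5P[h3 h2 h1 h0 hp]; split=> // -[|[|[|[|k]]]].
by move=> [-> h]; rewrite !h.
Qed.

Section Period.
Variables (p : R) (low high : nat -> R).
Hypotheses (p0 : 0 < p).
Hypothesis low_bounds : forall k, (k < 4)%N -> 0 <= low k <= p.
Hypothesis high_bounds : forall k, (k < 4)%N -> 0 <= high k <= p.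
(* The union of the intervals [low k, high k] is closed on the circle of length
   [p], where the end point [p] is glued to [0]. *)
Hypothesis glued : (forall k, (k < 4)%N -> high k < p) ->
  forall k, (k < 4)%N -> 0 < low k.

Lemma max_high : exists2 m, (m < 4)%N & forall k, (k < 4)%N -> high k <= high m.
Proof.
suff main n : (0 < n)%N -> exists2 m, (m < n)%N &
    forall k, (k < n)%N -> high k <= high m by exact: main.
elim: n => // -[|n] IH _.
  by exists 0%N => // -[].
have [m mn mP] := IH isT; have [le|lt] := leP (high n.+1) (high m).
  exists m => [|k]; first exact: ltnW.
  by rewrite ltnS leq_eqVlt => /orP[/eqP->|] //; exact: mP.
exists n.+1 => // k; rewrite ltnS leq_eqVlt => /orP[/eqP-> //|kn].
by apply: le_trans (mP k kn) _; exact: ltW.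
Qed.

Lemma max_high_below t : (exists2 k, (k < 4)%N & high k < t) ->
  exists m, [/\ (m < 4)%N, high m < t &
    forall k, (k < 4)%N -> high k < t -> high k <= high m].
Proof.
suff main n : (exists2 k, (k < n)%N & high k < t) -> exists m,
    [/\ (m < n)%N, high m < t & forall k, (k < n)%N -> high k < t -> high k <=
      high m].
  exact: main.
elim: n => [|n IH] [k kn kt]; first by [].
have [hn|hn] := ltP (high n) t; last first.
  have kn' : (k < n)%N.
    rewrite ltn_neqAle -ltnS kn andbT; apply: contraTneq kt => ->.
    by rewrite -leNgt.
  have [|m [mn mt mP]] := IH; first by exists k.
  exists m; split=> //; first exact: ltnW.
  move=> i; rewrite ltnS leq_eqVlt => /orP[/eqP-> |]; last exact: mP.
  by move=> /lt_le_trans /(_ hn); rewrite ltxx.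
have [[m [mn mt mP]]|no] := pselect (exists m, [/\ (m < n)%N, high m < t &
    forall k, (k < n)%N -> high k < t -> high k <= high m]).
  have [le|lt] := leP (high n) (high m).
    exists m; split=> //; first exact: ltnW.
    by move=> i; rewrite ltnS leq_eqVlt => /orP[/eqP-> //|]; exact: mP.
  exists n; split=> // i; rewrite ltnS leq_eqVlt => /orP[/eqP-> //|iN it].
  by apply: le_trans (mP i iN it) _; exact: ltW.
exists n; split=> // i; rewrite ltnS leq_eqVlt => /orP[/eqP-> //|iN it].
by case: no; apply: IH; exists i.
Qed.

(** A blocked [t] lies in the gap starting at the largest [high] below it or, if there is none, in
    the gap starting at the largest [high] of the preceding period, with index [s.-1]. Only the
    right ends below [t] are consulted, so empty intervals with [high k < low k] do no harm. *)
Lemma circular_gaps t s : (0 < s < 6)%N -> 0 < t <= p ->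
  (forall k, (k < 4)%N -> ~ (low k <= t <= high k)) <->
  exists k i, [/\ (k < 4)%N, (i < 6)%N &
    high k + (i%:R - 2) * p < t + (s%:R - 2) * p <
    gap_end p low high (high k) + (i%:R - 2) * p].
Proof.
move=> /andP[s0 s6] /andP[t0 tp]; split=> [bad|].
  have [ex|nex] := pselect (exists2 k, (k < 4)%N & high k < t).
    have [m [m4 mt mP]] := max_high_below ex.
    exists m, s; split=> //; rewrite !ltrD2r mt /=.
    apply/lt_gap_end; split; first lra.
    move=> k k4; rewrite /gap_candidate.
    have [hk|hk] := ltP (high m) (high k).
      have hkt : t <= high k.
        by rewrite leNgt; apply/negP => /(mP k k4); rewrite leNgt hk.
      by rewrite ltNge; apply/negP => lt; apply: (bad k k4); rewrite lt hkt.
    (* The candidate [low k + p] exceeds [t] unless [t = p] and [low k = 0]. If [p] is blocked, no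
       [high] reaches [p], and [glued] excludes this case. *)
    have := low_bounds k4; have [ep|np] := eqVneq t p; last first.
      by have : t < p by [rewrite lt_neqAle np]; lra.
    suff : 0 < low k by lra.
    apply: glued k4 => i i4; rewrite ltNge; apply/negP => hi.
    by apply: (bad i i4); rewrite ep hi andbT; have /andP[] := low_bounds i4.
  have [m m4 mP] := max_high.
  exists m, s.-1; split=> //; first by lia.
  have -> : (s.-1)%:R = s%:R - 1 :> R by rewrite -subn1 natrB.
  have hm := high_bounds m4; apply/andP; split; first lra.
  have : t + p < gap_end p low high (high m).
    apply/lt_gap_end; split.
      suff : t != p by move=> np; have : t < p by [rewrite lt_neqAle np]; lra.
      apply/eqP => ep; apply: (bad 0%N isT); rewrite ep.
      have /andP[_ ->] := low_bounds (isT : (0 < 4)%N); rewrite leNgt;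
        apply/negP => h.
      by apply: nex; exists 0%N; rewrite ?ep.
    move=> k k4; rewrite /gap_candidate.
    have -> : (high m < high k) = false by apply/negbTE; rewrite -leNgt mP.
    rewrite ltrD2r ltNge; apply/negP => lt; apply: (bad k k4); rewrite lt /=.
    by rewrite leNgt; apply/negP => h; apply: nex; exists k.
  lra.
move=> [k [i [k4 i6 /andP[lt gt]]]] m m4 /andP[lm hm].
have {}gt : t + (s%:R - 2) * p - (i%:R - 2) * p < gap_end p low high (high k)
  by lra.
have {gt} [_ /(_ m m4)] := (lt_gap_end _ _ _ _ _).1 gt; rewrite /gap_candidate.
have lbm := low_bounds m4; have hbm := high_bounds m4;
  have hbk := high_bounds k4.
have step (a b : nat) : (a < b)%N -> a%:R * p + p <= b%:R * p :> R.
  move=> ab; have -> : a%:R * p + p = a.+1%:R * p by rewrite -natr1; ring.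
  by rewrite ler_pM2r // ler_nat.
case: (ltP (high k) (high m)) => hkm gt.
  have [si|is_] := ltnP s i; first by have := step _ _ si; lra.
  have : i%:R * p <= s%:R * p by rewrite ler_pM2r // ler_nat.
  by lra.
have [is_|si] := ltnP i s; first by have := step _ _ is_; lra.
have : s%:R * p <= i%:R * p by rewrite ler_pM2r // ler_nat.
by lra.
Qed.

End Period.
End CircularGaps.

(** * Interior points of the rectilinear hull *)

Section Quadrants.
Variable R : realType.
Implicit Types (u v w x y z b : R * R) (theta t : R) (A Red Blue : set (R * R)).

Lemma dot_continuous w (x : R * R) : continuous (fun y => dot (y - x) w).
Proof.
move=> y; rewrite /dot /=; apply: cvgD.
  apply: cvgM; last exact: cvg_cst.
  by apply: cvgB; [exact: cvg_fst | exact: cvg_cst].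
apply: cvgM; last exact: cvg_cst.
by apply: cvgB; [exact: cvg_snd | exact: cvg_cst].
Qed.

Lemma dot_near_gt0 (c : R) w x y : 0 < c * dot (y - x) w ->
  \forall y' \near y, 0 < c * dot (y' - x) w.
Proof.
move=> h; have cf : c * dot (y' - x) w @[y' --> y] --> c * dot (y - x) w.
  by apply: cvgM; [exact: cvg_cst | exact: dot_continuous].
exact: cvgr_gt cf _ h.
Qed.

Lemma quadrant_nbhs u theta (s s' : bool) x y : quadrant u theta s s' x y ->
  nbhs y (quadrant u theta s s' x).
Proof.
move=> [/dot_near_gt0 h1 /dot_near_gt0 h2].
by apply: filterS2 h1 h2 => y' ? ?; split.
Qed.

Lemma quadrant_nbhs_vertex u theta (s s' : bool) x y : quadrant u theta s s' x
  y ->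
  \forall x' \near x, quadrant u theta s s' x' y.
Proof.
have flip (e : bool) w x' : (-1) ^+ e * dot (y - x') w = - (-1) ^+ e * dot (x'
  - y) w.
  by rewrite /dot /=; ring.
rewrite /quadrant /= !flip => -[/dot_near_gt0 h1 /dot_near_gt0 h2].
by apply: filterS2 h1 h2 => x' ? ?; rewrite !flip.
Qed.

Lemma dot_rotate theta v w : dot (rotate theta v) (rotate theta w) = dot v w.
Proof.
have := cos2Dsin2 theta; rewrite /dot /rotate /= => h.
transitivity ((cos theta ^+ 2 + sin theta ^+ 2) * (v.1 * w.1 + v.2 * w.2)).
  by ring.
by rewrite h mul1r.
Qed.

Lemma rotate_pihalf v : rotate (pi / 2) v = (- v.2, v.1).
Proof.
by rewrite /rotate cos_pihalf sin_pihalf !mul0r !mul1r add0r addr0.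
Qed.

(** Red points in the four open quadrants at [b] remain in those at nearby [y], and a quadrant
    containing [y] contains the quadrant at [y] with the same signs, so it is not free. Conversely,
    an empty quadrant at [b] is itself removed, and [b] is in its closure. *)
Lemma interior_rect_hull u theta Red b : u != 0 ->
  interior (rect_hull u theta Red) b <->
  forall s s', exists2 r, Red r & quadrant u theta s s' b r.
Proof.
move=> u0; split=> [hb s s'|hits]; last first.
  have near_all : \forall y \near b, forall s s',
      exists2 r, Red r & quadrant u theta s s' y r.
    have one s s' : \forall y \near b, exists2 r, Red r & quadrant u theta s s'
      y r.
      have [r Rr /quadrant_nbhs_vertex] := hits s s'.
      by apply: filterS => y qy; exists r.
    apply: filterS (filterI (filterI (one true true) (one true false))
                            (filterI (one false true) (one false false))).
    by move=> y [[? ?] [? ?]] [] [].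
  apply: filterS near_all => y qy [q [[s [s' [x ->]]] free] [y1 y2]].
  have [r Rr [r1 r2]] := qy s s'.
  have sum w : dot (r - x) w = dot (r - y) w + dot (y - x) w.
    by rewrite /dot /=; ring.
  by apply: (free r Rr); apply: quadrant_nbhs; split;
    rewrite sum mulrDr addr_gt0.
apply: contrapT => no.
have free : free_quadrants u theta Red (quadrant u theta s s' b).
  split; first by exists s, s', b.
  by move=> r Rr /interior_subset qr; apply: no; exists r.
set w1 := rotate theta u; set w2 := rotate theta (rotate (pi / 2) u).
have w12 : dot w1 w2 = 0.
  by rewrite /w1 /w2 dot_rotate rotate_pihalf /dot /=; ring.
have w21 : dot w2 w1 = 0 by rewrite -w12 /dot; ring.
have uu : 0 < dot u u.
  have : u.1 != 0 \/ u.2 != 0.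
    have [u1|] := eqVneq u.1 0; last by left.
    right; apply: contraNneq u0 => u2.
    by rewrite [u]surjective_pairing u1 u2.
  by rewrite /dot -!expr2 => -[|] h; [rewrite ltr_pwDl | rewrite ltr_wpDl];
    rewrite ?sqr_ge0 // lt_neqAle sqr_ge0 eq_sym expf_eq0 /= h.
have w11 : 0 < dot w1 w1 by rewrite dot_rotate.
have w22 : 0 < dot w2 w2.
  by rewrite dot_rotate rotate_pihalf; move: uu; rewrite /dot /=; lra.
pose sg (e : bool) : R := (-1) ^+ e.
have sg2 e : sg e * sg e = 1 by rewrite /sg -signr_addb addbb.
(* The bisector of the quadrant: the points [f e] on it approach [b] from within the removed
   quadrant. *)
pose d : R * R := (sg s * w1.1 + sg s' * w2.1, sg s * w1.2 + sg s' * w2.2).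
pose f (e : R) : R * R := (b.1 + e * d.1, b.2 + e * d.2).
have fq e : 0 < e -> quadrant u theta s s' b (f e).
  move=> e0; split; rewrite -/w1 -/w2 -/(sg _).
    have -> : sg s * dot (f e - b) w1 =
        e * (sg s * sg s * dot w1 w1 + sg s * sg s' * dot w2 w1).
      by rewrite /dot /f /d /=; ring.
    by rewrite w21 mulr0 addr0 sg2 mul1r mulr_gt0.
  have -> : sg s' * dot (f e - b) w2 =
      e * (sg s' * sg s' * dot w2 w2 + sg s' * sg s * dot w1 w2).
    by rewrite /dot /f /d /=; ring.
  by rewrite w12 mulr0 addr0 sg2 mul1r mulr_gt0.
have fc : f e @[e --> 0] --> b.
  have lin (x y : R) : x + e * y @[e --> (0 : R)] --> x.
    rewrite -[X in _ --> X]addr0 -[X in _ --> _ + X](mul0r y).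
    by apply: cvgD; [exact: cvg_cst | apply: cvgMr_tmp; exact: cvg_id].
  exact: (cvg_pair (lin b.1 d.1) (lin b.2 d.2)).
have /nbhs_ballP[e /= e0 he] := fc _ hb.
have e2 : 0 < e / 2 by rewrite divr_gt0.
have : rect_hull u theta Red (f (e / 2)).
  by apply: he; rewrite /ball /= sub0r normrN gtr0_norm // ltr_pdivrMr //; lra.
by apply; exists (quadrant u theta s s' b) => //; exact: fq.
Qed.

End Quadrants.

(** * Blocked directions as conditions on angles *)

Section FreeDirections.
Variable R : realType.
Implicit Types (u v w z : R * R) (theta t : R) (kappa : nat -> R * R).

Definition in_quadrant theta v : Prop :=
  0 < cos theta * v.1 + sin theta * v.2 /\
  0 < - sin theta * v.1 + cos theta * v.2.

Definition blocked kappa nr z theta : Prop := forall k, (k < 4)%N ->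
  exists2 r, (r < nr)%N & in_quadrant theta (rot90n k (kappa r) - rot90n k z).

Lemma rot90nB k v w : rot90n k v - rot90n k w = rot90n k (v - w).
Proof.
elim: k => [|k IH] //=; rewrite /rot90n /= -/(rot90n k v) -/(rot90n k w).
rewrite -/(rot90n k (v - w)) -IH /rot90.
by rewrite [LHS]surjective_pairing /=; congr pair; ring.
Qed.

Lemma in_quadrantD theta v :
  in_quadrant (theta + pi / 2) v <-> in_quadrant theta (rot90 v).
Proof.
rewrite /in_quadrant cosDpihalf sinDpihalf /=.
by split=> -[h1 h2]; split; lra.
Qed.

Lemma rot90n4 k v : rot90n (k + 4) v = rot90n k v.
Proof.
by rewrite /rot90n iterD /= /rot90 /= !opprK -surjective_pairing.
Qed.

Lemma rot90n_mod k v : rot90n (k %% 4) v = rot90n k v.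
Proof.
rewrite {2}(divn_eq k 4) addnC; elim: (k %/ 4)%N => [|n IH];
  first by rewrite addn0.
by rewrite mulSn addnCA [(4 + _)%N]addnC rot90n4.
Qed.

(** A quarter turn sends each wedge to its cyclic neighbour; [(k + 3) %% 4] is the predecessor of
    [k]. *)
Lemma blockedD kappa nr z theta :
  blocked kappa nr z (theta + pi / 2) <-> blocked kappa nr z theta.
Proof.
split=> h k k4.
  have [|r rn] := h ((k + 3) %% 4)%N; first by rewrite ltn_mod.
  rewrite rot90nB => /in_quadrantD q; exists r => //.
  by move: q; rewrite rot90nB rot90n_mod -[rot90 _]/(rot90n _.+1 _) -addnS
    rot90n4.
have [|r rn] := h (k.+1 %% 4)%N; first by rewrite ltn_mod.
by rewrite rot90nB rot90n_mod => q; exists r => //; rewrite rot90nB;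
  apply/in_quadrantD.
Qed.

Lemma blockedDn kappa nr z theta n :
  blocked kappa nr z (theta + n%:R * (pi / 2)) <-> blocked kappa nr z theta.
Proof.
elim: n => [|n IH]; first by rewrite mul0r addr0.
rewrite -natr1 mulrDl mul1r addrA; split.
  by move=> /blockedD /IH.
by move=> /IH /blockedD.
Qed.

Lemma dot_rotate_key u theta (r z : R * R) :
  let v := (dot r u, dot r (rotate (pi / 2) u)) -
           (dot z u, dot z (rotate (pi / 2) u)) in
  dot (r - z) (rotate theta u) = cos theta * v.1 + sin theta * v.2 /\
  dot (r - z) (rotate theta (rotate (pi / 2) u)) =
    - sin theta * v.1 + cos theta * v.2.
Proof. by rewrite rotate_pihalf /dot /rotate /=; split; ring. Qed.

(* The wedges of signs [(s, s')] are the rotations by multiples of pi / 2 of the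
   one of positive signs. *)
Definition wedge_index (s s' : bool) : nat :=
  if s then if s' then 2 else 1 else if s' then 3 else 0.

Lemma quadrantE u theta s s' (r z : R * R) :
  quadrant u theta s s' z r <-> in_quadrant theta (rot90n (wedge_index s s')
    ((dot r u, dot r (rotate (pi / 2) u)) - (dot z u, dot z (rotate (pi / 2)
      u)))).
Proof.
have [e1 e2] := @dot_rotate_key u theta r z.
rewrite /quadrant /in_quadrant /= e1 e2; move: (_ - _) => v.
by case: s; case: s'; rewrite /= ?expr0 ?expr1 ?mul1r ?mulN1r;
  split=> -[h1 h2]; split; lra.
Qed.

Lemma separating_anglesE u (red blue : seq (R * R)) : u != 0 ->
  separating_angles u [set` red] [set` blue] =
  [set theta | 0 <= theta < 2 * pi /\ forall j, (j < size blue)%N ->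
     ~ blocked (key0 u (red ++ blue)) (size red)
         (key0 u (red ++ blue) (size red + j)%N) theta].
Proof.
move=> u0.
have redE r : (r < size red)%N -> key0 u (red ++ blue) r =
    (dot (nth 0 red r) u, dot (nth 0 red r) (rotate (pi / 2) u)).
  by move=> rn; rewrite /key0 nth_cat rn.
have blueE j : key0 u (red ++ blue) (size red + j)%N =
    (dot (nth 0 blue j) u, dot (nth 0 blue j) (rotate (pi / 2) u)).
  by rewrite /key0 nth_cat ltnNge leq_addr addKn.
have main theta j :
    interior (rect_hull u theta [set` red]) (nth 0 blue j) <->
    blocked (key0 u (red ++ blue)) (size red)
      (key0 u (red ++ blue) (size red + j)%N) theta.
  rewrite interior_rect_hull //; split=> h.
    move=> k k4; have [s [s' ->]] : exists s s', k = wedge_index s s'.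
      by case: k k4 => [|[|[|[|k]]]] // _;
        [exists false, false | exists true, false | exists true, true | exists
          false, true].
    have [r /= rr /quadrantE q] := h s s'.
    exists (index r red); first by rewrite index_mem.
    by rewrite rot90nB redE ?index_mem // blueE nth_index.
  move=> s s'; have [|r rn] := h (wedge_index s s'); first by case: s; case: s'.
  rewrite rot90nB redE // blueE => q; exists (nth 0 red r);
    first exact: mem_nth.
  exact/quadrantE.
apply/seteqP; split=> theta [th h]; split=> //.
  by move=> j jn /main; apply: h; exact: mem_nth.
move=> b /= bb; rewrite -(nth_index 0 bb) => /main.
by apply: h; rewrite index_mem.
Qed.

(** Writing [v = rho * (sin al, cos al)] turns the two conditions into positivity of the sine and
    cosine of [al + theta]. The arc tangent requires [0 < v.2]: this coordinate is the combination
    of the two positive quantities with coefficients [sin theta > 0] and [cos theta >= 0]. *)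
Lemma in_quadrant_atan theta v : 0 < theta <= pi / 2 ->
  in_quadrant theta v <->
  0 < v.2 /\ - theta < atan (v.1 / v.2) < pi / 2 - theta.
Proof.
move=> /andP[t0 tp]; have pi0 := @pi_gt0 R.
have s0 : 0 < sin theta by apply: sin_gt0_pi; rewrite t0; lra.
have c0 : 0 <= cos theta by apply: cos_ge0_pihalf; rewrite tp andbT; lra.
have polar : 0 < v.2 -> exists2 rho : R, 0 < rho &
    v.1 = rho * sin (atan (v.1 / v.2)) /\ v.2 = rho * cos (atan (v.1 / v.2)).
  move=> v2; set al := atan _.
  have ca : 0 < cos al by apply: cos_gt0_pihalf; rewrite atan_gtNpi2 atan_ltpi2.
  exists (v.2 / cos al); first exact: divr_gt0.
  split; last by rewrite divfK // gt_eqF.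
  have : tan al = v.1 / v.2 by exact: atanK.
  rewrite /tan => e; have -> : v.2 / cos al * sin al = v.2 * (sin al / cos al).
    by rewrite mulrAC mulrA.
  by rewrite e mulrC divfK // gt_eqF.
have conv rho al : 0 < rho -> v.1 = rho * sin al -> v.2 = rho * cos al ->
    in_quadrant theta v <-> 0 < sin (al + theta) /\ 0 < cos (al + theta).
  move=> r0 e1 e2; rewrite /in_quadrant e1 e2 sinD cosD.
  have -> : cos theta * (rho * sin al) + sin theta * (rho * cos al) =
    rho * (sin al * cos theta + cos al * sin theta) by ring.
  have -> : - sin theta * (rho * sin al) + cos theta * (rho * cos al) =
    rho * (cos al * cos theta - sin al * sin theta) by ring.
  by rewrite !pmulr_rgt0.
have al1 := atan_gtNpi2 (v.1 / v.2); have al2 := atan_ltpi2 (v.1 / v.2).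
split=> [q|[v2 /andP[a1 a2]]].
  have v2 : 0 < v.2.
    have [h1 h2] := q.
    have e : v.2 = sin theta * (cos theta * v.1 + sin theta * v.2) +
        cos theta * (- sin theta * v.1 + cos theta * v.2).
      transitivity ((cos theta ^+ 2 + sin theta ^+ 2) * v.2); last by ring.
      by rewrite cos2Dsin2 mul1r.
    by rewrite e ltr_pwDl ?mulr_gt0 // mulr_ge0 // ltW.
  split=> //; have [rho r0 [e1 e2]] := polar v2.
  have [q1 _] := conv _ _ r0 e1 e2; have {q1} [sp cp] := q1 q.
  set al := atan _ in al1 al2 sp cp *; apply/andP; split.
    rewrite ltNge; apply/negP => le.
    have : 0 <= sin (- (al + theta)) by apply: sin_ge0_pi; apply/andP; split;
      lra.
    by rewrite sinN; lra.
  rewrite ltNge; apply/negP => le.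
  have : 0 <= sin (al + theta - pi / 2) by apply: sin_ge0_pi; apply/andP;
    split; lra.
  by rewrite sinBpihalf; lra.
have [rho r0 [e1 e2]] := polar v2; apply/(conv _ _ r0 e1 e2).
set al := atan _ in al1 al2 a1 a2 *; split.
  by apply: sin_gt0_pi; apply/andP; split; lra.
by apply: cos_gt0_pihalf; apply/andP; split; lra.
Qed.

End FreeDirections.

Lemma gap_index (j m i : nat) : (m < 4)%N -> (i < 6)%N ->
  let t := (24 * j + 6 * m + i)%N in
  [/\ (t %/ 6 = 4 * j + m)%N, (t %/ 24 = j)%N & (t - 6 * (t %/ 6) = i)%N].
Proof. by move=> m4 i6 t; rewrite /t; split; lia. Qed.

Lemma gap_index_inv (t : nat) :
  (t - 6 * (t %/ 6) < 6)%N /\ (4 * (t %/ 24) + (t %/ 6) %% 4 = t %/ 6)%N.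
Proof. by split; lia. Qed.

(** * Free intervals and gaps of a blue point *)

Section FreeIntervals.
Variable R : realType.
Variables (kappa : nat -> R * R) (nr nb : nat) (rho lam : nat -> R).
Hypothesis offs : forall k j, (k < 4)%N -> (j < nb)%N ->
  is_offset true (fun i => rot90n k (kappa i)) nr
    (rot90n k (kappa (nr + j)%N)) (rho (4 * j + k)%N) /\
  is_offset false (fun i => rot90n k (kappa i)) nr
    (rot90n k (kappa (nr + j)%N)) (lam (4 * j + k)%N).
Hypothesis distinct : forall r j, (r < nr)%N -> (j < nb)%N ->
  kappa r != kappa (nr + j)%N.

Lemma rot90n_eq0 k (v : R * R) : rot90n k v = 0 -> v = 0.
Proof.
elim: k => //= k IH e; apply: IH; apply: rot90_inj; rewrite [LHS]e.
by rewrite /rot90 /= oppr0.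
Qed.

Section Blue.
Variable j : nat.
Hypothesis jnb : (j < nb)%N.
Let z := kappa (nr + j)%N.
Let dir k r := rot90n k (kappa r) - rot90n k z.

Lemma low_offset k : (k < 4)%N ->
  [/\ 0 <= low_of rho j k <= pi / 2,
      forall r, (r < nr)%N -> lex_pos (dir k r) -> 0 < (dir k r).2 ->
        pi / 2 - low_of rho j k <= atan ((dir k r).1 / (dir k r).2)
    & low_of rho j k = 0 \/ exists r, [/\ (r < nr)%N, lex_pos (dir k r),
        0 < (dir k r).2 &
        pi / 2 - low_of rho j k = atan ((dir k r).1 / (dir k r).2)]].
Proof.
move=> k4; have [[h1 h2 h3] _] := offs k4 jnb.
have e : pi / 2 - low_of rho j k = rho (4 * j + k)%N by rewrite /low_of; ring.
split; rewrite ?e.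
- by move: h1 e => /andP[? ?] e; apply/andP; split; lra.
- by move=> r rn rp r2; have := h2 r; rewrite /offset_of /sign_of !mul1r; apply.
- case: h3 => [h|[r [rn [rp r2]] h]]; first by left; lra.
  by right; exists r; move: r2 h; rewrite /offset_of /sign_of !mul1r.
Qed.

Lemma high_offset k : (k < 4)%N ->
  [/\ 0 <= high_of lam j k <= pi / 2,
      forall r, (r < nr)%N -> lex_pos (- dir k r) -> 0 < (dir k r).2 ->
        high_of lam j k <= - atan ((dir k r).1 / (dir k r).2)
    & high_of lam j k = pi / 2 \/ exists r, [/\ (r < nr)%N, lex_pos (- dir k r),
        0 < (dir k r).2 &
        high_of lam j k = - atan ((dir k r).1 / (dir k r).2)]].
Proof.
move=> k4; have k2 : ((k + 2) %% 4 < 4)%N by rewrite ltn_mod.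
have [_ [h1 h2 h3]] := offs k2 jnb.
have opp r : rot90n ((k + 2) %% 4) (kappa r) - rot90n ((k + 2) %% 4) z = - dir
  k r.
  by rewrite !rot90nB rot90n_mod addnC /rot90n iterD /= /rot90 /= /dir rot90nB.
have off r : offset_of false (- dir k r) = - atan ((dir k r).1 / (dir k r).2).
  by rewrite /offset_of /sign_of /= mulN1r opprK mulNr atanN.
have sgn r : sign_of R false * (- dir k r).2 = (dir k r).2.
  by rewrite /sign_of /= mulN1r opprK.
split=> //.
- by move=> r rn rp r2; have := h2 r; rewrite -/z opp off sgn; apply.
- case: h3 => [h|[r [rn]]]; first by left.
  by rewrite -/z opp off sgn => -[rp r2] h; right; exists r.
Qed.

Lemma dir_neq0 k r : (r < nr)%N -> dir k r != 0.
Proof.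
move=> rn; apply/eqP; rewrite /dir rot90nB => /rot90n_eq0/eqP.
by rewrite subr_eq0; apply/negP; exact: distinct.
Qed.

(** A red point differs from the blue one, so its difference is lexicographically positive or
    negative. In the open half-plane the former have arc tangent >= 0 and can violate only the lower
    bound on [theta]; the latter have arc tangent < 0 and can violate only the upper bound. *)
Lemma free_interval k theta : (k < 4)%N -> 0 < theta <= pi / 2 ->
  (forall r, (r < nr)%N -> ~ in_quadrant theta (dir k r)) <->
  low_of rho j k <= theta <= high_of lam j k.
Proof.
move=> k4 th; have [l1 l2 l3] := low_offset k4;
  have [h1 h2 h3] := high_offset k4.
have /andP[t0 tp] := th; have pi0 := @pi_gt0 R; split=> [free|/andP[lt th']].
  apply/andP; split.
    case: l3 => [->|[r [rn rp r2 e]]]; first exact: ltW.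
    rewrite leNgt; apply/negP => lt; apply: (free r rn).
    apply/in_quadrant_atan => //; split=> //; rewrite -e; apply/andP; split;
      lra.
  case: h3 => [->//|[r [rn rp r2 e]]].
  rewrite leNgt; apply/negP => lt; apply: (free r rn).
  apply/in_quadrant_atan => //; split=> //; apply/andP; split; first lra.
  suff : atan ((dir k r).1 / (dir k r).2) < 0 by lra.
  have r1 : (dir k r).1 < 0.
    case/orP: rp => /= [|/andP[_]]; first by rewrite oppr_gt0.
    by rewrite oppr_gt0 => /(lt_trans r2); rewrite ltxx.
  by rewrite -[ltRHS](@atan0 R) lt_atan // pmulr_llt0 ?invr_gt0.
move=> r rn /(in_quadrant_atan _ th) [r2 /andP[a1 a2]].
have [rp|rp] := boolP (lex_pos (dir k r)).
  have := l2 r rn rp r2; lra.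
have := h2 r rn (lex_pos_total (dir_neq0 k rn) rp) r2; lra.
Qed.

(** Direction [k] at angle 0 has the same wedge as direction [k - 1] at pi / 2. A red point bounding
    [high] there has negative first and positive second coordinate; a quarter turn makes both
    positive, so its angle bounds [rho] below pi / 2 in direction [k]. *)
Lemma low_gt0 : (forall k, (k < 4)%N -> high_of lam j k < pi / 2) ->
  forall k, (k < 4)%N -> 0 < low_of rho j k.
Proof.
move=> hlt k k4; have k3 : ((k + 3) %% 4 < 4)%N by rewrite ltn_mod.
have [_ _ h3] := high_offset k3; have := hlt _ k3.
case: h3 => [->|[r [rn rp r2 _]] _]; first by rewrite ltxx.
have e : dir k r = rot90 (dir ((k + 3) %% 4) r).
  rewrite /dir !rot90nB rot90n_mod -[RHS]/(rot90n (k + 3).+1 _) -addnS.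
  by rewrite rot90n4.
have r1 : (dir ((k + 3) %% 4) r).1 < 0.
  case/orP: rp => /= [|/andP[_]]; first by rewrite oppr_gt0.
  by rewrite oppr_gt0 => /(lt_trans r2); rewrite ltxx.
have [_ l2 _] := low_offset k4.
have lp : lex_pos (dir k r) by rewrite e /lex_pos /= r2.
have s2 : 0 < (dir k r).2 by rewrite e /= oppr_gt0.
have := l2 r rn lp s2; have := atan_ltpi2 ((dir k r).1 / (dir k r).2); lra.
Qed.

Lemma blocked_gaps theta s : (0 < s < 6)%N -> 0 < theta <= pi / 2 ->
  blocked kappa nr z theta <-> exists k i, [/\ (k < 4)%N, (i < 6)%N &
    high_of lam j k + (i%:R - 2) * (pi / 2) < theta + (s%:R - 2) * (pi / 2) <
    gap_end (pi / 2) (low_of rho j) (high_of lam j) (high_of lam j k) +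
      (i%:R - 2) * (pi / 2)].
Proof.
move=> s6 th; have p0 : 0 < pi / 2 :> R by rewrite divr_gt0 // pi_gt0.
have lb k : (k < 4)%N -> 0 <= low_of rho j k <= pi / 2 by case/low_offset.
have hb k : (k < 4)%N -> 0 <= high_of lam j k <= pi / 2 by case/high_offset.
apply: iff_trans (circular_gaps p0 lb hb low_gt0 s6 th).
split=> [bl k k4|bad k k4].
  move=> /(free_interval k4 th) free; have [r rn] := bl k k4.
  exact: free.
apply: contrapT => no; apply: (bad k k4); apply/(free_interval k4 th) => r rn q.
by apply: no; exists r.
Qed.

End Blue.

Lemma covered_blocked theta : 0 <= theta < 2 * pi ->
  covered (gap_key rho lam) (24 * nb) theta <->
  exists2 j, (j < nb)%N & blocked kappa nr (kappa (nr + j)%N) theta.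
Proof.
move=> /andP[th0 th2]; set p : R := pi / 2.
have p0 : 0 < p by rewrite divr_gt0 // pi_gt0.
have thp : theta < 4 * p by rewrite /p; lra.
have [s s6 sP] : exists2 s, (0 < s < 6)%N & 0 < theta - (s%:R - 2) * p <= p.
  have [h|h] := leP theta 0; first by exists 1%N => //; apply/andP; split; lra.
  have [h1|h1] := leP theta p; first by exists 2%N => //; apply/andP; split;
    lra.
  have [h2|h2] := leP theta (2 * p); first by exists 3%N => //; apply/andP;
    split; lra.
  have [h3|h3] := leP theta (3 * p); first by exists 4%N => //; apply/andP;
    split; lra.
  by exists 5%N => //; apply/andP; split; lra.
set th := theta - (s%:R - 2) * p in sP.
have thE : theta = th + (s%:R - 2) * p by rewrite /th; ring.
have red z : blocked kappa nr z theta <-> blocked kappa nr z th.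
  rewrite -(blockedDn kappa nr z theta 2) -(blockedDn kappa nr z th s).
  (* Two quarter turns are added on both sides so that only natural multiples occur. *)
  suff -> : theta + 2%:R * (pi / 2) = th + s%:R * (pi / 2) by [].
  by rewrite thE -/p; ring.
split=> [[t tN]|[j jnb]].
  rewrite /gap_key /shift_of /= => tb.
  have jnb : (t %/ 24 < nb)%N by rewrite ltn_divLR // mulnC.
  exists (t %/ 24)%N => //; apply/red/(blocked_gaps jnb s6 sP).
  set m := ((t %/ 6) %% 4)%N; have m4 : (m < 4)%N by rewrite ltn_mod.
  (* The angle stored in frame [m] is the right end of the interval of the opposite direction. *)
  exists ((m + 2) %% 4)%N, (t - 6 * (t %/ 6))%N.
  have [t6 tE] := gap_index_inv t.
  rewrite -thE; split; [by rewrite ltn_mod | exact: t6 |].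
  have -> : high_of lam (t %/ 24) ((m + 2) %% 4) = lam (t %/ 6)%N.
    rewrite /high_of modnDml -addnA modnDr modn_mod; congr lam.
    exact: tE.
  exact: tb.
move=> /red/(blocked_gaps jnb s6 sP) [k [i [k4 i6]]]; rewrite -thE => kb.
set m := ((k + 2) %% 4)%N; have m4 : (m < 4)%N by rewrite ltn_mod.
set t := (24 * j + 6 * m + i)%N.
have [t6 t24 ti] := gap_index j m4 i6; rewrite -/t in t6 t24 ti.
exists t; first by rewrite mulnC -ltn_divLR // t24.
by rewrite /gap_key /shift_of /= ti t24 t6.
Qed.

End FreeIntervals.

(** * The algorithm *)

Definition separating_program : cmd :=
  init_keys ;; offsets ;; gaps ;; merge_sort ;; complement.

Section MainLemmas.
Variable R : realType.
Implicit Types (u : R * R) (red blue : seq (R * R)).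

Lemma key0_inj u pts i j : u != 0 -> uniq pts -> (i < size pts)%N ->
  (j < size pts)%N -> key0 u pts i = key0 u pts j -> i = j.
Proof.
move=> u0 un ip jp; rewrite /key0 rotate_pihalf => -[e1 e2].
apply/eqP; rewrite -(nth_uniq 0 ip jp un) [X in X == _]surjective_pairing.
rewrite [X in _ == X]surjective_pairing.
set x := nth 0 pts i in e1 e2 *; set y := nth 0 pts j in e1 e2 *.
rewrite /dot /= in e1 e2.
have uu : u.1 ^+ 2 + u.2 ^+ 2 != 0.
  rewrite paddr_eq0 ?sqr_ge0 // !expf_eq0 /=.
  by apply: contraNN u0 => /andP[/eqP u1 /eqP u2];
    rewrite [u]surjective_pairing u1 u2.
apply/eqP; congr pair; apply: (mulfI uu).
  transitivity ((x.1 * u.1 + x.2 * u.2) * u.1 - (x.1 * - u.2 + x.2 * u.1) *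
    u.2).
    by ring.
  by rewrite e1 e2; ring.
transitivity ((x.1 * u.1 + x.2 * u.2) * u.2 + (x.1 * - u.2 + x.2 * u.1) * u.1).
  by ring.
by rewrite e1 e2; ring.
Qed.

(** Sorting at most [24 * n] gaps dominates the cost of every phase. It also dictates the memory:
    the merge width can reach almost [48 * n]. *)
Lemma separating_program_correct : exists C, forall u red blue M, u != 0 ->
  uniq (red ++ blue) -> let n := (size red + size blue)%N in (48 * n + 10 <=
    M)%N ->
  runs M separating_program (input_state u red blue)
    (C * ((24 * n).+1 * (up_log 2 (24 * n)).+1)) (fun st =>
    outputs_intervals st (separating_angles u [set` red] [set` blue])).
Proof.
have [C1 init] := init_keys_correct R.
have [C2 offs] := offsets_correct R.
have [C3 gps] := gaps_correct R.
have [C4 sort] := merge_sort_correct R.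
have [C5 cpl] := complement_correct R.
exists (C1 + C2 + C3 + C4 + C5)%N => u red blue M u0 un n nM.
set nr := size red in n nM *; set nb := size blue in n nM *.
set Z := ((24 * n).+1 * _)%N.
have nZ : (n.+1 <= Z)%N by rewrite /Z; nia.
have bZ : (nb.+1 <= Z)%N by rewrite /Z /n; nia.
have gZ : ((24 * nb).+1 <= Z)%N by rewrite /Z /n; nia.
have lZ : (n.+1 * (up_log 2 n).+1 <= Z)%N.
  by apply: leq_mul; rewrite ltnS ?leq_up_log //; lia.
have sZ : ((24 * nb).+1 * (up_log 2 (24 * nb)).+1 <= Z)%N.
  by apply: leq_mul; rewrite ltnS ?leq_up_log // /n; lia.
apply: (@runs_leq _ _ _ _ (C1 * n.+1 + (C2 * (n.+1 * (up_log 2 n).+1) +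
  (C3 * nb.+1 + (C4 * ((24 * nb).+1 * (up_log 2 (24 * nb)).+1) + C5 * (24 *
    nb).+1)))));
  last first.
- by rewrite !mulnDl -!addnA !leq_add // leq_mul2l ?nZ ?bZ ?gZ ?lZ ?sZ orbT.
apply: runs_seq; apply: runs_weaken (init u red blue M _) _ _ => //; first lia.
move=> st1 [nrE nbE szE kE qE].
have inj i j : (i < n)%N -> (j < n)%N ->
    key0 u (red ++ blue) i = key0 u (red ++ blue) j -> i = j.
  by move=> iN jN; apply: key0_inj; rewrite ?size_cat.
apply: runs_seq; apply: runs_weaken (runs_frame
  (offs M nr nb (key0 u (red ++ blue)) st1 _ _ nrE nbE szE qE kE inj)) _ _ =>
    //.
- by rewrite -/n; lia.
- by rewrite /n in nM; lia.
move=> st2 [[fn2 fr2 fa2 fb2] off2].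
apply: runs_seq; apply: runs_weaken (gps M nb st2 _ _ _) _ _ => //.
- by rewrite /n in nM; lia.
- by rewrite fn2.
- by rewrite fr2.
move=> st3 [sz3 q3 k3].
set kg := gap_key _ _ in k3.
apply: runs_seq; apply: runs_weaken (runs_frame (sort M (key st3) _ st3 _ sz3
  _)) _ _ => //.
- by rewrite /n in nM; lia.
move=> st4 [[fn4 fr4 fa4 fb4] [enum srt]].
apply: runs_weaken (cpl M (24 * nb)%N (key st3) st4 _ _ _ _ enum srt) _ _ => //.
- by rewrite /n in nM; lia.
- by rewrite fn4.
- by move=> i; rewrite /key !fb4.
- by rewrite fr4.
move=> st5; suff -> : uncovered (key st3) (24 * nb) (2 * pi) =
  separating_angles u [set` red] [set` blue] by [].
rewrite separating_anglesE // -/nr -/nb.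
have distinct r j : (r < nr)%N -> (j < nb)%N ->
    key0 u (red ++ blue) r != key0 u (red ++ blue) (nr + j)%N.
  move=> rn jn; apply/eqP => /inj e; have : r = (nr + j)%N by apply: e;
    rewrite /n; lia.
  by lia.
have cov theta : covered (key st3) (24 * nb) theta <-> covered kg (24 * nb)
  theta.
  by split=> -[t tN]; rewrite ?k3 // => tb; exists t; rewrite ?k3.
apply/seteqP; split=> theta [th h]; split=> //.
  move=> j jn bl; apply: h; apply/cov.
  by apply/(covered_blocked off2 distinct th); exists j.
by move=> /cov /(covered_blocked off2 distinct th) [j jn]; exact: h.
Qed.

(** For [n >= 2], [24 * n <= n ^ 6] because [24 <= 2 ^ 5]. So the binary logarithm rounded up is
    less than 1 + 6 log2 n, and the remaining 2 is at most 2 log2 n; hence the factor 8. *)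
Lemma up_log_ln n : (1 < n)%N ->
  (up_log 2 (24 * n)).+1%:R <= 8 / ln 2 * ln n%:R :> R.
Proof.
move=> n1; set L := up_log 2 (24 * n).
have ln2 : 0 < ln 2 :> R by rewrite ln_gt0 // ltr1n.
have /andP[Ln _] : (2 ^ L.-1 < 24 * n <= 2 ^ L)%N by apply: up_log_bounds =>
  //; lia.
have n6 : (24 * n <= n ^ 6)%N.
  rewrite expnSr leq_mul2r; apply/orP; right.
  by apply: (@leq_trans (2 ^ 5)) => //; rewrite leq_exp2r.
have : ln ((2 ^ L.-1)%:R : R) <= ln ((n ^ 6)%:R).
  by rewrite ler_ln ?posrE ?ltr0n ?expn_gt0 ?ler_nat; lia.
rewrite !natrX !lnXn ?ltr0n //; last lia.
have lnn : ln 2 <= ln n%:R :> R by rewrite ler_ln ?posrE ?ltr0n ?ler_nat; lia.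
move=> h; rewrite mulrAC ler_pdivlMr //.
have L1 : L.+1%:R = L.-1%:R + 2 :> R.
  have L0 : (0 < L)%N by rewrite lt0n up_log_eq0; lia.
  by rewrite -[in LHS](prednK L0) -!natr1; ring.
have {}h : L.-1%:R * ln 2 <= 6%:R * ln n%:R :> R by rewrite !mulr_natl.
by rewrite L1 mulrDl; lra.
Qed.

End MainLemmas.

Theorem theorem7 (R : realType) (u : R * R) (hu : u != 0) :
  exists (prog : cmd) (T S : nat -> nat),
    [/\ (fun n : nat => (T n)%:R : R^o) =O_\oo
          (fun n : nat => n%:R * ln (n%:R : R) : R^o),
        (fun n : nat => (S n)%:R : R^o) =O_\oo (fun n : nat => n%:R : R^o)
      & forall red blue : seq (R * R),
          uniq red -> uniq blue ->
          (forall x, x \in red -> x \notin blue) ->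
          (forall x y z, x \in red ++ blue -> y \in red ++ blue ->
             z \in red ++ blue -> x != y -> x != z -> y != z ->
             ~ collinear x y z) ->
          let n := (size red + size blue)%N in
          exists (t : nat) (st : state R),
            [/\ exec (S n) prog (input_state u red blue) t st,
                (t <= T n)%N
              & outputs_intervals st
                  (separating_angles u [set` red] [set` blue])]].
Proof.
have [C correct] := separating_program_correct R.
exists separating_program,
  (fun n => C * ((24 * n).+1 * (up_log 2 (24 * n)).+1))%N, (fun n => 48 * n +
    10)%N.
split.
(* The factor 25 bounds [(24 * n).+1] by a multiple of [n], and [8 / ln 2] comes from [up_log_ln];
   the summand 1 keeps the constant positive even for [C = 0]. *)
- apply/eqO_exP; exists (C%:R * 25 * (8 / ln 2) + 1).
    have ln2 : 0 < ln 2 :> R by rewrite ln_gt0 // ltr1n.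
    by rewrite ltr_wpDl // !mulr_ge0 // ?ler0n // invr_ge0 ltW.
  near=> n; have n1 : (1 < n)%N by near: n; exact: nbhs_infty_gt.
  have lnn : 0 < ln n%:R :> R by rewrite ln_gt0 // ltr1n.
  rewrite !ger0_norm ?ler0n ?mulr_ge0 ?ler0n ?(ltW lnn) //.
  rewrite !natrM.
  have h1 : (24 * n).+1%:R <= 25 * n%:R :> R by rewrite -natrM ler_nat; lia.
  have h2 := up_log_ln R n1.
  apply: (@le_trans _ _ (C%:R * (25 * n%:R * (8 / ln 2 * ln n%:R)))).
    by rewrite ler_wpM2l ?ler0n // ler_pM ?ler0n.
  rewrite [leRHS]mulrDl [1 * _]mul1r -[leLHS]addr0 lerD ?mulr_ge0 ?ler0n ?(ltW
    lnn) //.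
  by rewrite le_eqVlt; apply/orP; left; apply/eqP; ring.
- apply/eqO_exP; exists 58 => //; near=> n.
  have n0 : (0 < n)%N by near: n; exact: nbhs_infty_gt.
  by rewrite !ger0_norm ?ler0n // -natrM ler_nat; lia.
- move=> red blue unr unb dis _ n.
  have un : uniq (red ++ blue).
    rewrite cat_uniq unr unb andbT /=; apply/hasPn => x xb.
    by apply/negP => /dis; rewrite xb.
  exact: correct un _ => //.
Unshelve. all: by end_near. Qed.
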